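(* Let $A\subset\mathbb R^n$ be arbitrary. For every $y\in\mathbb R^n$, $$\varepsilon_y^A(\mathbb R^n)=\begin{cases}\kappa_\alpha\gamma_A(y)&\text{if $A$ is inner $\alpha$-thin at infinity},\\ 1&\text{otherwise.}\end{cases}$$
   Context: Standing assumptions: $n\ge3$, $\alpha\in(0,2]$, and $\kappa_\alpha(x,y)=|x-y|^{\alpha-n}$ is the Riesz kernel on $\mathbb R^n$. $\mathfrak M^+$ denotes the cone of positive Radon measures $\mu$ on $\mathbb R^n$ whose potential $\kappa_\alpha\mu(x)=\int|x-z|^{\alpha-n}d\mu(z)$ is not identically $+\infty$. The energy of $\mu$ is $\|\mu\|_\alpha^2=\iint\kappa_\alpha\,d\mu\,d\mu$; $\mathcal E^+_\alpha(A)$ is the set of positive measures of finite energy concentrated on $A$. The inner capacity of $A\subset\mathbb R^n$ is defined by $1/c_\alpha(A)=\inf\{\|\mu\|_\alpha^2:\ \mu\in\mathcal E^+_\alpha(A),\ \mu(\mathbb R^n)=1\}$. ''n.e. on $A$'' means: for all points of $A$ except a subset of inner capacity zero. Inner balayage: for $\mu\in\mathfrak M^+$ and arbitrary $A$, $\mu^A$ is the unique measure in $\mathfrak M^+$ with $\kappa_\alpha\mu^A=\inf\{\kappa_\alpha\nu:\ \nu\in\mathfrak M^+,\ \kappa_\alpha\nu\ge\kappa_\alpha\mu \text{ n.e. on }A\}$ pointwise. $\varepsilon_y$ is the Dirac measure at $y$ and $\varepsilon_y^A:=(\varepsilon_y)^A$. Inner equilibrium measure: $\gamma_A$, if it exists,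 is the unique measure in $\mathfrak M^+$ with $\kappa_\alpha\gamma_A=\inf\{\kappa_\alpha\nu:\ \nu\in\mathfrak M^+,\ \kappa_\alpha\nu\ge1\text{ n.e. on }A\}$ pointwise. $A$ is called inner $\alpha$-thin at infinity if $\gamma_A$ exists. *)

(* Defs.v *)
From HB Require Import structures.
From mathcomp Require Import all_boot all_order all_algebra.
From mathcomp Require Import all_classical all_reals all_analysis.
Set Implicit Arguments. Unset Strict Implicit. Unset Printing Implicit Defensive.
Import Order.TTheory GRing.Theory Num.Theory.
Import numFieldNormedType.Exports.
Local Open Scope classical_set_scope.
Local Open Scope ring_scope.

(* R^n with its Borel sigma-algebra (generated by the open sets of the
   product = Euclidean topology on row vectors). *)
Notation Rn R n :=
  (g_sigma_algebraType (@open (matrix R 1 n))) (only parsing).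

Definition edist (R : realType) (n : nat) (x y : 'rV[R]_n) : R :=
  Num.sqrt (\sum_(i < n) (x ord0 i - y ord0 i) ^+ 2).

(* Riesz kernel |x-y|^(alpha-n), equal to +oo on the diagonal (alpha < n). *)
Definition riesz (R : realType) (n : nat) (alpha : R) (x y : 'rV[R]_n)
  : \bar R :=
  if x == y then +oo%E else ((edist x y) `^ (alpha - n%:R))%:E.

Definition potential (R : realType) (n : nat) (alpha : R)
  (mu : {measure set (Rn R n) -> \bar R}) (x : 'rV[R]_n) : \bar R :=
  (\int[mu]_(z in [set: Rn R n]) riesz alpha x z)%E.

Definition energy (R : realType) (n : nat) (alpha : R)
  (mu : {measure set (Rn R n) -> \bar R}) : \bar R :=
  (\int[mu]_(x in [set: Rn R n]) potential alpha mu x)%E.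

Definition radon (R : realType) (n : nat)
  (mu : {measure set (Rn R n) -> \bar R}) : Prop :=
  forall K : set 'rV[R]_n, compact K -> (mu K < +oo)%E.

Definition Mplus (R : realType) (n : nat) (alpha : R)
  (mu : {measure set (Rn R n) -> \bar R}) : Prop :=
  radon mu /\ exists x, potential alpha mu x <> +oo%E.

Definition concentrated (R : realType) (n : nat)
  (mu : {measure set (Rn R n) -> \bar R}) (A : set 'rV[R]_n) : Prop :=
  mu.-negligible (~` A : set (Rn R n)).

Definition inv_inner_cap (R : realType) (n : nat) (alpha : R)
  (A : set 'rV[R]_n) : \bar R :=
  ereal_inf [set energy alpha mu | mu in
     [set mu : {measure set (Rn R n) -> \bar R} |
        radon mu /\ concentrated mu A /\ (energy alpha mu < +oo)%E
        /\ mu setT = 1%E]].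

Definition cap_zero (R : realType) (n : nat) (alpha : R) (A : set 'rV[R]_n)
  : Prop := inv_inner_cap alpha A = +oo%E.

Definition ne_on (R : realType) (n : nat) (alpha : R) (A : set 'rV[R]_n)
  (P : 'rV[R]_n -> Prop) : Prop :=
  cap_zero alpha [set x | A x /\ ~ P x].

Definition is_balayage (R : realType) (n : nat) (alpha : R)
  (A : set 'rV[R]_n) (mu nu : {measure set (Rn R n) -> \bar R}) : Prop :=
  Mplus alpha nu /\
  forall x, potential alpha nu x =
    ereal_inf [set potential alpha lam x | lam in
      [set lam : {measure set (Rn R n) -> \bar R} | Mplus alpha lam /\
         ne_on alpha A (fun z => (potential alpha lam z >= potential alpha mu z)%E)]].

Definition is_equilibrium (R : realType) (n : nat) (alpha : R)
  (A : set 'rV[R]_n) (g : {measure set (Rn R n) -> \bar R}) : Prop :=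
  Mplus alpha g /\
  forall x, potential alpha g x =
    ereal_inf [set potential alpha lam x | lam in
      [set lam : {measure set (Rn R n) -> \bar R} | Mplus alpha lam /\
         ne_on alpha A (fun z => (potential alpha lam z >= 1)%E)]].

Definition thin_at_infinity (R : realType) (n : nat) (alpha : R)
  (A : set 'rV[R]_n) : Prop :=
  exists g, @is_equilibrium R n alpha A g.

(* Main.v *)
From HB Require Import structures.
From mathcomp Require Import all_boot all_order all_algebra.
From mathcomp Require Import all_classical all_reals all_analysis.
From mathcomp Require Import measurable_realfun ring lra.
Require Import Defs.
Set Implicit Arguments. Unset Strict Implicit. Unset Printing Implicit Defensive.
Import Order.TTheory GRing.Theory Num.Theory.
Import numFieldNormedType.Exports.
Local Open Scope classical_set_scope.
Local Open Scope ring_scope.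

(** Let [k_y] be the Riesz kernel with pole [y]. On a compact [K] contained in [A] minus [y], Gauss
    variation yields measures [rho_K] and [sig_K] carried by [K], whose potentials are at most [k_y],
    respectively [1], everywhere, with equality nearly everywhere on [K]. By symmetry of the energy the
    mass of [rho_K] is the potential of [sig_K] at [y]. Since [alpha <= 2], the kernel is the increasing
    limit of potentials of subordinated Gaussian laws, and this gives both the domination principle and
    the principle of positivity of mass (a smaller potential has a smaller mass). By these, every
    [rho_K] has mass at most that of the balayage, while the vague limit of [rho_K] along an ultrafilter
    is admissible in the definition of the balayage; so the mass of the balayage is the limit of the
    potentials of [sig_K] at [y]. If some potential is at least [1] nearly everywhere on [A], the part of
    [sig_K] escaping to infinity does not contribute in the limit, and the vague limit of [sig_K] is the
    equilibrium measure. If the mass of the balayage is less than [1], a multiple of this very limit is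
    such a potential. *)

(** The set [A] carries no structure, so everything is read off from its compact subsets, and n.e.
    inequalities are tested by measures on them. The test measures [tau] have a finite continuous
    potential: testing [f <= U rho] against [tau] gives, by symmetry, a condition on the integral of
    [U tau] against [rho], which is linear in [rho] with a continuous integrand and hence suited to
    vague limits. The obstacle is that [U tau] has no compact support, so mass going to infinity
    matters. For the measures swept from the Dirac mass, total masses stay bounded and [U tau]
    vanishes at infinity. The measures [sig_K] may have unbounded mass; but far away [U tau] is
    nearly the mass of [tau] times the kernel with any fixed pole [x0], so the escaping part
    contributes at most the mass of [tau] times a bound for the potentials of [sig_K] at [x0]. An
    admissible potential has infimum zero, which makes this bound as small as desired. Removing [y]
    from [A] changes nothing nearly everywhere and keeps the kernel with pole [y] continuous on the
    compact sets. *)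

Section borel_row_vectors.
Context {R : realType} {n : nat}.
Implicit Types (x y z : 'rV[R]_n) (r : R).

Lemma open_measurable_rV (U : set 'rV[R]_n) : open U -> measurable (U : set (Rn R n)).
Proof. by move=> oU; apply: sub_sigma_algebra. Qed.

Lemma closed_measurable_rV (F : set 'rV[R]_n) : closed F -> measurable (F : set (Rn R n)).
Proof.
move=> cF; rewrite -(setCK F); apply: (@measurableC _ (Rn R n)).
by apply: open_measurable_rV; exact: closed_openC.
Qed.

Lemma compact_measurable_rV (F : set 'rV[R]_n) : compact F -> measurable (F : set (Rn R n)).
Proof. move=> cF; apply: closed_measurable_rV; apply: compact_closed => //; exact: norm_hausdorff. Qed.

Lemma continuous_measurable_rV (f : 'rV[R]_n -> R) :
  continuous f -> measurable_fun [set: Rn R n] (f : Rn R n -> R).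
Proof.
move=> h; apply: (measurability _ (RGenOInfty.measurableE R)) => //.
move=> _ [_ [a ->] <-]; rewrite setTI.
apply: open_measurable_rV; apply: open_comp => //; exact: interval_open.
Qed.

Lemma measurable_coord (i : 'I_n) :
  measurable_fun [set: Rn R n] (fun x : Rn R n => (x : 'rV[R]_n) ord0 i).
Proof. by apply: continuous_measurable_rV => x; exact: coord_continuous. Qed.

Lemma mx_ball_rV x r y : 0 < r -> (forall i, `|x ord0 i - y ord0 i| < r) -> ball x r y.
Proof. by move=> r0 h; split => // i j; rewrite ord1; exact: h. Qed.

(** Second countability in explicit form: sup-norm cubes with rational centre and radius [1/(k+1)].
    The Borel sets are generated by arbitrary open sets, and writing these as countable unions of
    cubes is what reduces measurability of a vector-valued map to its coordinates. *)
Lemma open_ball_countable (U : set 'rV[R]_n) : open U ->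
  U = \bigcup_(p in [set p : 'rV[rat]_n * nat |
        [set y : 'rV[R]_n | forall i, `|ratr (p.1 ord0 i) - y ord0 i| < p.2.+1%:R^-1] `<=` U])
      [set y : 'rV[R]_n | forall i, `|ratr (p.1 ord0 i) - y ord0 i| < p.2.+1%:R^-1].
Proof.
move=> oU; apply/seteqP; split; last by move=> x [p /= pU] /pU.
move=> x Ux; have /nbhs_ballP[e /= e0 eU] : nbhs x U by exact: open_nbhs_nbhs.
(* A cube of radius below [e / 2] that contains [x] has all its points within [e] of [x]. *)
have [k ke] : exists k : nat, (k.+1%:R : R)^-1 < e / 2.
  have := near_infty_natSinv_lt (PosNum (divr_gt0 e0 (ltr0n R 2))).
  by case=> k _ /(_ k (leqnn _)) /= h; exists k.
have hq i : exists q : rat, `|ratr q - x ord0 i| < (k.+1%:R : R)^-1.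
  have hk : x ord0 i - (k.+1%:R : R)^-1 < x ord0 i by rewrite ltrBlDr ltrDl invr_gt0.
  have [q] := rat_in_itvoo hk; rewrite in_itv/= => /andP[q1 q2]; exists q.
  by rewrite ltr0_norm ?subr_lt0// opprB ltrBlDr addrC -ltrBlDr.
exists (\row_i projT1 (cid (hq i)), k) => /=; last first.
  by move=> i; rewrite mxE; exact: projT2 (cid (hq i)).
move=> y yq; apply: eU; apply: mx_ball_rV => // i.
have := projT2 (cid (hq i)); have := yq i; rewrite mxE; set q := ratr _ => h1 h2.
rewrite -(subrK q (x ord0 i)) -addrA (le_lt_trans (ler_normD _ _))// (splitr e) ltrD//.
  by rewrite distrC (lt_trans h2).
by rewrite (lt_trans h1).
Qed.

Lemma measurable_rV d (T : measurableType d) (f : T -> 'rV[R]_n) :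
  (forall i, measurable_fun setT (fun t => f t ord0 i)) ->
  measurable_fun setT (f : T -> Rn R n).
Proof.
move=> mf; apply: (@measurability _ _ _ (Rn R n) _ _ (@open 'rV[R]_n)) => //.
move=> _ [U oU <-]; rewrite setTI (open_ball_countable oU) preimage_bigcup.
rewrite bigcup_mkcond; apply: countable_bigcupT_measurable => // p.
case: ifPn => // _.
rewrite (_ : _ @^-1` _ = \bigcap_(i in [set: 'I_n])
    ((fun t => f t ord0 i) @^-1` ball (ratr (p.1 ord0 i) : R) (p.2.+1%:R^-1))); last first.
  by apply/seteqP; split => t /= h i; [move=> _; exact: h|exact: h].
apply: fin_bigcap_measurable => // i _; rewrite -[X in measurable X]setTI.
by apply: mf => //; exact: measurable_ball.
Qed.

Definition box (r : R) : set 'rV[R]_n := [set z | forall i, `|z ord0 i| <= r].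

Lemma compact_box r : compact (box r).
Proof.
have -> : box r = [set v | forall i, `[(- r), r]%classic (v ord0 i)].
  by apply/seteqP; split => v /= h i; have := h i; rewrite in_itv/= ler_norml.
by apply: (@rV_compact _ _ (fun=> `[(- r), r]%classic)) => _; exact: segment_compact.
Qed.

Lemma measurable_box r : measurable (box r : set (Rn R n)).
Proof. apply: compact_measurable_rV; exact: compact_box. Qed.

Lemma le_box r r' : r <= r' -> box r `<=` box r'.
Proof. by move=> rr z zr i; rewrite (le_trans (zr i)). Qed.

Lemma coord_le_norm x i : `|x ord0 i| <= `|x|.
Proof.
rewrite [leRHS]/Num.norm/= mx_normrE.
by apply/bigmax_geP; right => /=; exists (ord0, i).
Qed.

Lemma norm_le_rV x (r : R) : 0 <= r -> (forall i, `|x ord0 i| <= r) -> `|x| <= r.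
Proof.
move=> r0 h; rewrite [leLHS]/Num.norm/= mx_normrE; apply/bigmax_leP; split => //.
by move=> [i j] _ /=; rewrite (ord1 i).
Qed.

Lemma box_ex x : exists k : nat, box k%:R x.
Proof.
exists (Num.bound `|x|) => i; apply: (le_trans (coord_le_norm x i)).
exact/ltW/archi_boundP.
Qed.

Lemma bigcup_box : \bigcup_(k in [set: nat]) box k%:R = [set: 'rV[R]_n].
Proof. by apply/seteqP; split => // x _; have [k] := box_ex x; exists k. Qed.

Lemma compact_sub_box (K : set 'rV[R]_n) : compact K -> exists k : nat, K `<=` box k%:R.
Proof.
move=> /compact_bounded[M [_ hM]].
exists (Num.bound (`|M| + 1)) => x Kx i; apply: (le_trans (coord_le_norm x i)).
apply: (@le_trans _ _ (`|M| + 1)); last exact/ltW/archi_boundP/addr_ge0.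
by apply: hM => //; rewrite (le_lt_trans (ler_norm _))// ltrDl.
Qed.

Lemma edist_ge0 x y : 0 <= edist x y.
Proof. exact: sqrtr_ge0. Qed.

Lemma edistC x y : edist x y = edist y x.
Proof. by congr Num.sqrt; apply: eq_bigr => i _; rewrite -sqrrN opprB. Qed.

Lemma sqr_edist x y : edist x y ^+ 2 = \sum_(i < n) (x ord0 i - y ord0 i) ^+ 2.
Proof. by rewrite sqr_sqrtr// sumr_ge0// => i _; exact: sqr_ge0. Qed.

Lemma coord_le_edist x y i : `|x ord0 i - y ord0 i| <= edist x y.
Proof.
rewrite -(@ler_pXn2r _ 2)// ?nnegrE ?edist_ge0//.
by rewrite sqr_edist real_normK ?num_real// (bigD1 i)//= lerDl sumr_ge0// => j _; exact: sqr_ge0.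
Qed.

Lemma edist_le x y r : 0 <= r -> (forall i, `|x ord0 i - y ord0 i| <= r) -> edist x y <= n%:R * r.
Proof.
move=> r0 h; rewrite -(@ler_pXn2r _ 2)// ?nnegrE ?edist_ge0 ?mulr_ge0// sqr_edist.
apply: (@le_trans _ _ (\sum_(i < n) r ^+ 2)).
  apply: ler_sum => i _; rewrite -(real_normK (num_real (_ - _))).
  by rewrite ler_sqr ?nnegrE.
rewrite sumr_const card_ord -[leLHS]mulr_natl exprMn ler_wpM2r ?sqr_ge0//.
by case: (n) => [|m]; [rewrite expr2 mulr0|rewrite -natrX ler_nat -{1}(expn1 m.+1) leq_pexp2l].
Qed.

Lemma edist0 x y : (edist x y == 0) = (x == y).
Proof.
apply/eqP/eqP => [e0|->].
  apply/rowP => i; apply/eqP; rewrite -subr_eq0 -normr_le0.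
  by rewrite -e0; exact: coord_le_edist.
by rewrite /edist big1 ?sqrtr0// => i _; rewrite subrr expr2 mul0r.
Qed.

Lemma edist_gt0 x y : (0 < edist x y) = (x != y).
Proof. by rewrite lt_def edist_ge0 andbT edist0. Qed.

(* Cauchy-Schwarz, from [2 u v <= (B/A) u^2 + (A/B) v^2] with [A], [B] the two norms. *)
Lemma edist_triangle x y z : edist x z <= edist x y + edist y z.
Proof.
have [/eqP|xy] := eqVneq (edist x y) 0; first by rewrite edist0 => /eqP ->; rewrite lerDr edist_ge0.
have [/eqP|yz] := eqVneq (edist y z) 0; first by rewrite edist0 => /eqP ->; rewrite lerDl edist_ge0.
have A0 : 0 < edist x y by rewrite lt_def xy edist_ge0.
have B0 : 0 < edist y z by rewrite lt_def yz edist_ge0.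
rewrite -(@ler_pXn2r _ 2)// ?nnegrE ?addr_ge0 ?edist_ge0// sqrrD.
set A := edist x y in A0 *; set B := edist y z in B0 *.
have -> : A * B *+ 2 = (B / A) * (A ^+ 2) + (A / B) * (B ^+ 2).
  by field; rewrite !gt_eqF.
rewrite !sqr_edist.
rewrite !mulr_sumr -!big_split/=; apply: ler_sum => i _.
set u := x ord0 i - y ord0 i; set v := y ord0 i - z ord0 i.
have -> : x ord0 i - z ord0 i = u + v by rewrite /u /v; ring.
rewrite sqrrD lerD2r lerD2l -subr_ge0.
have -> : B / A * u ^+ 2 + A / B * v ^+ 2 - u * v *+ 2 = (B * u - A * v) ^+ 2 / (A * B).
  by field; rewrite !gt_eqF.
by rewrite divr_ge0 ?sqr_ge0// mulr_ge0// ltW.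
Qed.

Lemma measurable_edist d (T : measurableType d) (f g : T -> 'rV[R]_n) :
  (forall i, measurable_fun setT (fun t => f t ord0 i)) ->
  (forall i, measurable_fun setT (fun t => g t ord0 i)) ->
  measurable_fun setT (fun t => edist (f t) (g t)).
Proof.
move=> mf mg; apply: (@measurableT_comp _ _ _ _ _ _ (@Num.sqrt R)).
  by apply: continuous_measurable_fun; exact: sqrt_continuous.
apply: measurable_sum => i; apply: measurable_funX; exact: measurable_funB.
Qed.

(** The Lipschitz condition is for the Euclidean distance, the topology that of the sup norm; the
    two are linked by the factor [n] of [edist_le]. Extended values let the lemma apply directly to
    integrals. *)
Lemma open_lipschitz (f : 'rV[R]_n -> \bar R) (C : R) :
  (forall x x', (f x <= f x' + (C * edist x x')%:E)%E) ->
  forall a, open [set x | (a%:E < f x)%E].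
Proof.
move=> h a; rewrite openE => x /= afx; rewrite /interior.
have [e e0 ae] : exists2 e : R, 0 < e & ((a + e)%:E < f x)%E.
  move: afx; case: (f x) => [r||]//; last by move=> _; exists 1 => //; rewrite ltry.
  by rewrite lte_fin => ar; exists ((r - a) / 2); rewrite ?lte_fin; lra.
(* Both factors carry [+ 1], which keeps the divisor positive when [C] or [n] is zero; a move by [d]
   in the sup norm then changes [f] by at most [e]. *)
pose d := e / ((`|C| + 1) * (n%:R + 1)).
have d0 : 0 < d by rewrite divr_gt0// mulr_gt0// ltr_wpDl.
apply/nbhs_ballP; exists d => //= y [_ xy] /=.
have exy : C * edist x y <= e.
  apply: (@le_trans _ _ ((`|C| + 1) * ((n%:R + 1) * d))); last first.
    by rewrite mulrA /d mulrCA mulfV ?mulr1// gt_eqF// mulr_gt0// ltr_wpDl.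
  apply: (@le_trans _ _ ((`|C| + 1) * edist x y)).
    by rewrite ler_wpM2r ?edist_ge0// (le_trans (ler_norm _))// lerDl.
  rewrite ler_wpM2l ?addr_ge0//; apply: (@le_trans _ _ (n%:R * d)).
    by apply: edist_le => [|i]; [exact: ltW|apply/ltW/xy].
  by rewrite ler_wpM2r ?(ltW d0)// lerDl.
have : ((a + e)%:E < f y + e%:E)%E.
  by apply: (lt_le_trans ae); apply: (le_trans (h x y)); rewrite leeD2l// lee_fin.
by rewrite EFinD lteD2rE.
Qed.

End borel_row_vectors.

(** * The Riesz kernel and potentials *)

Section riesz_kernel.
Context {R : realType} {n : nat} (alpha : R) (alpha_n : alpha < n%:R).
Implicit Types (x y z : 'rV[R]_n) (r h : R).

(** For [alpha < n] this is the minimum of the kernel and the level [h^(alpha-n)]. Written through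
    the distance, it inherits a Lipschitz bound from the triangle inequality and increases to the
    kernel as [h] tends to 0, on the diagonal as well. *)
Definition truncated_riesz h x y : R := (Num.max (edist x y) h) `^ (alpha - n%:R).

Local Notation tk := truncated_riesz.

Lemma riesz_ge0 x y : (0 <= riesz alpha x y)%E.
Proof. by rewrite /riesz; case: ifP => // _; rewrite lee_fin powR_ge0. Qed.

Lemma rieszC x y : riesz alpha x y = riesz alpha y x.
Proof. by rewrite /riesz eq_sym edistC. Qed.

Lemma truncated_rieszC h x y : tk h x y = tk h y x.
Proof. by rewrite /tk edistC. Qed.

Lemma truncated_riesz_ge0 h x y : 0 <= tk h x y.
Proof. exact: powR_ge0. Qed.

Lemma powR_neg_le (u v : R) : 0 < u -> u <= v -> v `^ (alpha - n%:R) <= u `^ (alpha - n%:R).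
Proof.
move=> u0 uv; rewrite -opprB !powRN lef_pV2 ?posrE ?powR_gt0// ?(lt_le_trans u0)//.
by apply: ge0_ler_powR => //; rewrite ?nnegrE ?subr_ge0 ltW// (lt_le_trans u0).
Qed.

Lemma truncated_riesz_le_cst h x y : 0 < h -> tk h x y <= h `^ (alpha - n%:R).
Proof. by move=> h0; apply: powR_neg_le => //; rewrite le_max lexx orbT. Qed.

Lemma truncated_riesz_anti h h' x y : 0 < h -> h <= h' -> tk h' x y <= tk h x y.
Proof.
move=> h0 hh; apply: powR_neg_le; first by rewrite lt_max h0 orbT.
by rewrite ge_max !le_max lexx/= hh orbT.
Qed.

Lemma truncated_riesz_le h x y : 0 < h -> ((tk h x y)%:E <= riesz alpha x y)%E.
Proof.
move=> h0; rewrite /riesz; case: eqP => [_|/eqP xy]; first exact: leey.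
by rewrite lee_fin; apply: powR_neg_le; rewrite ?edist_gt0// le_max lexx.
Qed.

Lemma truncated_riesz_eq h x y : h <= edist x y -> x != y ->
  riesz alpha x y = (tk h x y)%:E.
Proof. by move=> hxy xy; rewrite /riesz (negbTE xy) /tk max_l. Qed.

Lemma bernoulli_sub (u : R) m : 0 <= u <= 1 -> 1 - m%:R * (1 - u) <= u ^+ m.
Proof.
move=> /andP[u0 u1]; elim: m => [|m ih]; first by rewrite mul0r subr0 expr0.
have h : 0 <= 1 - u by rewrite subr_ge0.
have : u * (1 - m%:R * (1 - u)) <= u ^+ m.+1 by rewrite exprS ler_wpM2l.
have hm : 0 <= m%:R * ((1 - u) * (1 - u)) by rewrite !mulr_ge0.
rewrite -natr1; set M := m%:R in hm *; move: hm; nra.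
Qed.

(** A bound for the slope of [r^(alpha-n)] on [[h, +oo[]. The exponent [n - alpha] is rounded up to
    a natural number so that Bernoulli's inequality [bernoulli_sub] can stand in for a
    derivative. *)
Definition riesz_lip h : R := h `^ (alpha - n%:R) * (Num.bound (n%:R - alpha))%:R / h.

Lemma riesz_lip_ge0 h : 0 < h -> 0 <= riesz_lip h.
Proof. by move=> h0; rewrite /riesz_lip !mulr_ge0 ?powR_ge0// invr_ge0 ltW. Qed.

Lemma powR_neg_lipschitz h (u v : R) : 0 < h -> h <= u -> u <= v ->
  u `^ (alpha - n%:R) - v `^ (alpha - n%:R) <= riesz_lip h * (v - u).
Proof.
move=> h0 hu uv; have u0 : 0 < u by exact: lt_le_trans hu.
have v0 : 0 < v by exact: lt_le_trans uv.
have s0 : 0 < n%:R - alpha by rewrite subr_gt0.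
set N := Num.bound (n%:R - alpha).
have -> : v `^ (alpha - n%:R) = u `^ (alpha - n%:R) * (u / v) `^ (n%:R - alpha).
  rewrite powRM ?invr_ge0 ?(ltW u0) ?(ltW v0)// mulrA -powRD; last by rewrite (gt_eqF u0) implybT.
  have -> : alpha - n%:R + (n%:R - alpha) = 0 by ring.
  rewrite powRr0 mul1r -powR_inv1 ?(ltW v0)// -powRrM; congr (_ `^ _); ring.
(* The base [u / v] lies in []0, 1]], so raising the exponent from [n - alpha] to [N] only lowers
   the power. *)
have h1 : 1 - N%:R * (1 - u / v) <= (u / v) `^ (n%:R - alpha).
  have uv1 : 0 < u / v <= 1 by rewrite divr_gt0//= ler_pdivrMr// mul1r.
  apply: (le_trans (bernoulli_sub _ _)); first by case/andP: uv1 => /ltW -> ->.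
  rewrite -powR_mulrn; last by rewrite divr_ge0// ltW.
  by apply: ger_powR => //; rewrite ltW// archi_boundP// ltW.
rewrite -[X in X - _]mulr1 -mulrBr.
apply: (@le_trans _ _ (h `^ (alpha - n%:R) * (N%:R * (1 - u / v)))); last first.
  rewrite /riesz_lip -/N -!mulrA ler_wpM2l ?powR_ge0// ler_wpM2l//.
  rewrite -{1}(divff (lt0r_neq0 v0)) -mulrBl mulrC ler_wpM2r ?subr_ge0//.
  by rewrite lef_pV2 ?posrE// (le_trans hu).
apply: (@le_trans _ _ (u `^ (alpha - n%:R) * (N%:R * (1 - u / v)))).
  by rewrite ler_wpM2l ?powR_ge0//; lra.
rewrite ler_wpM2r//; last exact: powR_neg_le.
by rewrite mulr_ge0// subr_ge0 ler_pdivrMr// mul1r.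
Qed.

Lemma truncated_riesz_lipschitz h x x' z : 0 < h ->
  tk h x z <= tk h x' z + riesz_lip h * edist x x'.
Proof.
move=> h0; rewrite -lerBlDl /tk.
have L0 := riesz_lip_ge0 h0.
set u := Num.max _ _; set v := Num.max _ _.
have hu : h <= u by rewrite le_max lexx orbT.
have [uv|/ltW vu] := leP u v; last first.
  apply: (@le_trans _ _ 0); last by rewrite mulr_ge0 ?edist_ge0.
  by rewrite subr_le0; apply: powR_neg_le => //; rewrite (lt_le_trans h0)// le_max lexx orbT.
apply: (le_trans (powR_neg_lipschitz h0 hu uv)).
rewrite ler_wpM2l// lerBlDr ge_max; apply/andP; split.
  by rewrite (le_trans (edist_triangle _ x _))// edistC lerD2l le_max lexx.
by rewrite (le_trans hu)// lerDr edist_ge0.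
Qed.

Lemma measurable_truncated_riesz d (T : measurableType d) (f g : T -> 'rV[R]_n) h :
  (forall i, measurable_fun setT (fun t => f t ord0 i)) ->
  (forall i, measurable_fun setT (fun t => g t ord0 i)) ->
  measurable_fun setT (fun t => tk h (f t) (g t)).
Proof.
move=> mf mg; apply: (@measurableT_comp _ _ _ _ _ _ (@powR R ^~ (alpha - n%:R))).
  exact: measurable_powR.
apply: measurable_maxr => //; exact: measurable_edist.
Qed.

Local Notation tkn m := (tk (m.+1%:R^-1)).

Lemma truncated_riesz_nd x y : {homo (fun m => (tkn m x y)%:E) : a b / (a <= b)%N >-> (a <= b)%E}.
Proof.
move=> a b ab; rewrite lee_fin; apply: truncated_riesz_anti; first by rewrite invr_gt0.
by rewrite lef_pV2 ?posrE// ler_nat.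
Qed.

Lemma cvg_truncated_riesz x y : (fun m => (tkn m x y)%:E) @ \oo --> riesz alpha x y.
Proof.
have [->|xy] := eqVneq x y.
  rewrite /riesz eqxx; apply/cvgeyPge => A.
  have s0 : 0 < n%:R - alpha by rewrite subr_gt0.
  (* On the diagonal the truncated kernel is [(m+1)^(n-alpha)], which exceeds [A] as soon as [m+1]
     exceeds [B]. *)
  pose B := (Num.max A 1) `^ (n%:R - alpha)^-1.
  near=> m; rewrite lee_fin.
  have e0 : edist y y = 0 by apply/eqP; rewrite edist0.
  rewrite /tk e0 max_r ?invr_ge0// -[_^-1]powR_inv1// -powRrM mulN1r opprB.
  apply: (@le_trans _ _ (B `^ (n%:R - alpha))).
    by rewrite /B -powRrM mulVf ?gt_eqF// powRr1 ?le_max ?ler01 ?orbT// lexx.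
  apply: ge0_ler_powR; rewrite ?nnegrE ?powR_ge0// 1?ltW//.
  rewrite (lt_le_trans (archi_boundP (powR_ge0 _ _)))//.
  by rewrite ler_nat; near: m; exists (Num.bound B) => // m /= /leq_trans; apply.
apply: cvg_near_cst; near=> m; rewrite [RHS](@truncated_riesz_eq (m.+1%:R^-1))//.
apply/ltW; near: m; move: xy; rewrite -edist_gt0 => e0.
exact: (near_infty_natSinv_lt (PosNum e0)).
Unshelve. all: by end_near. Qed.

Lemma measurable_riesz d (T : measurableType d) (f g : T -> 'rV[R]_n) :
  (forall i, measurable_fun setT (fun t => f t ord0 i)) ->
  (forall i, measurable_fun setT (fun t => g t ord0 i)) ->
  measurable_fun setT (fun t => riesz alpha (f t) (g t)).
Proof.
move=> mf mg; apply: (emeasurable_fun_cvg (fun m t => (tkn m (f t) (g t))%:E)).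
- by move=> m; apply/measurable_EFinP; exact: measurable_truncated_riesz.
- by move=> t _; exact: cvg_truncated_riesz.
Qed.

End riesz_kernel.

(** * Tonelli's theorem with sigma-finiteness as a hypothesis *)

Section sigma_finite_copy.
Context d (T : measurableType d) (R : realType) (m : {measure set T -> \bar R})
  (sm : sigma_finite setT m).

(* The library states Tonelli for measures carrying a sigma-finite instance, whereas here
   sigma-finiteness is a consequence of the hypothesis [radon]. *)
Definition sigma_finite_copy of sigma_finite setT m : set T -> \bar R := m.
Local Notation m' := (sigma_finite_copy sm).
HB.instance Definition _ := Measure.copy m' m.
HB.instance Definition _ := Measure_isSigmaFinite.Build d T R m' sm.
End sigma_finite_copy.

Section tonelli.
Local Open Scope ereal_scope.
Context d1 d2 (T1 : measurableType d1) (T2 : measurableType d2) (R : realType).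

Lemma tonelli (m1 : {measure set T1 -> \bar R}) (m2 : {measure set T2 -> \bar R})
    (f : T1 * T2 -> \bar R) :
  sigma_finite setT m1 -> sigma_finite setT m2 -> measurable_fun setT f -> (forall x, 0 <= f x) ->
  \int[m1]_x \int[m2]_y f (x, y) = \int[m2]_y \int[m1]_x f (x, y).
Proof.
move=> s1 s2 mf f0.
exact: (@fubini_tonelli _ _ _ _ _ (sigma_finite_copy s1) (sigma_finite_copy s2) f mf f0).
Qed.

Lemma measurable_integral_snd (m2 : {measure set T2 -> \bar R}) (f : T1 * T2 -> \bar R) :
  sigma_finite setT m2 -> measurable_fun setT f -> (forall x, 0 <= f x) ->
  measurable_fun setT (fun x => \int[m2]_y f (x, y)).
Proof.
move=> s2 mf f0.
exact: (@measurable_fun_fubini_tonelli_F _ _ _ _ _ (sigma_finite_copy s2) f mf f0).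
Qed.
End tonelli.

(** * Potentials as increasing limits of Lipschitz functions *)

Section potentials.
Local Open Scope ereal_scope.
Context {R : realType} {n : nat} (alpha : R) (alpha_n : (alpha < n%:R)%R).
Notation measure_rV := {measure set (Rn R n) -> \bar R}.
Implicit Types (mu nu : measure_rV) (x y z : 'rV[R]_n).
Local Notation tkn m := (truncated_riesz alpha (m.+1%:R^-1)).

Lemma finite_radon mu : mu setT < +oo -> radon mu.
Proof.
move=> h K cK; apply: le_lt_trans h; apply: le_measure; rewrite ?inE//.
exact: compact_measurable_rV.
Qed.

Lemma radon_sigma_finite mu : radon mu -> sigma_finite setT mu.
Proof.
move=> rmu; exists (fun k => box k%:R); first by rewrite bigcup_box.
by move=> k; split; [exact: measurable_box|exact/rmu/compact_box].
Qed.

Lemma measurable_riesz_l x : measurable_fun [set: Rn R n] (riesz alpha x).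
Proof. by apply: measurable_riesz => // i; exact: measurable_coord. Qed.

Lemma measurable_riesz_r x : measurable_fun [set: Rn R n] (fun z : Rn R n => riesz alpha z x).
Proof. by apply: measurable_riesz => // i; exact: measurable_coord. Qed.

Lemma measurable_riesz_prod :
  measurable_fun setT (fun p : Rn R n * Rn R n => riesz alpha p.1 p.2).
Proof.
apply: measurable_riesz => // i.
  by apply: (@measurableT_comp _ _ _ _ _ _ (fun x : Rn R n => (x : 'rV[R]_n) ord0 i)) => //; exact: measurable_coord.
by apply: (@measurableT_comp _ _ _ _ _ _ (fun x : Rn R n => (x : 'rV[R]_n) ord0 i)) => //; exact: measurable_coord.
Qed.

Lemma measurable_truncated_riesz_l h x : measurable_fun [set: Rn R n] (truncated_riesz alpha h x).
Proof. by apply: measurable_truncated_riesz => // i; exact: measurable_coord. Qed.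

Lemma potential_ge0 mu x : 0 <= potential alpha mu x.
Proof. by apply: integral_ge0 => z _; exact: riesz_ge0. Qed.

Lemma measurable_potential mu : radon mu ->
  measurable_fun [set: Rn R n] (potential alpha mu).
Proof.
move=> rmu; have := @measurable_integral_snd _ _ (Rn R n) (Rn R n) R mu (fun p => riesz alpha p.1 p.2).
apply; [exact: radon_sigma_finite|exact: measurable_riesz_prod|by move=> p; exact: riesz_ge0].
Qed.

Lemma potential_sym mu nu : radon mu -> radon nu ->
  \int[nu]_x potential alpha mu x = \int[mu]_x potential alpha nu x.
Proof.
move=> rmu rnu.
have h : \int[nu]_x \int[mu]_z riesz alpha x z = \int[mu]_z \int[nu]_x riesz alpha x z.
  apply: (@tonelli _ _ (Rn R n) (Rn R n) R nu mu (fun p => riesz alpha p.1 p.2)).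
  - exact: radon_sigma_finite.
  - exact: radon_sigma_finite.
  - exact: measurable_riesz_prod.
  - by move=> p; exact: riesz_ge0.
rewrite /potential h.
by apply: eq_integral => x _; apply: eq_integral => z _; exact: rieszC.
Qed.

(** Cutting the kernel near its pole and the measure to a box with the same index gives, for a Radon
    measure, a finite Lipschitz function. It increases to the potential, whence lower semicontinuity
    and the approximation of values from below. *)
Definition truncated_potential mu (m : nat) x : \bar R :=
  \int[mu]_(z in box m%:R) (tkn m x z)%:E.

Lemma truncated_potentialE mu m x : truncated_potential mu m x =
  \int[mu]_z (((fun z => (tkn m x z)%:E) \_ (box m%:R)) z).
Proof. by rewrite /truncated_potential integral_mkcond. Qed.

Lemma cvg_truncated_potential mu x :
  (fun m => truncated_potential mu m x) @ \oo --> potential alpha mu x.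
Proof.
rewrite /potential.
under [X in _ --> X]eq_integral => z _.
  rewrite (_ : riesz alpha x z = limn (fun m => ((fun z => (tkn m x z)%:E) \_ (box m%:R)) z)).
  over.
  apply/esym/cvg_lim => //; have [k zk] := box_ex z.
  refine (cvg_trans _ (@cvg_truncated_riesz _ _ _ alpha_n x z)); apply: near_eq_cvg.
  exists k => // m /= km; rewrite patchE mem_set//.
  by apply: le_box zk; rewrite ler_nat.
rewrite (_ : truncated_potential mu ^~ x =
    (fun m => \int[mu]_z (((fun z => (tkn m x z)%:E) \_ (box m%:R)) z))); last first.
  by apply/funext => m; rewrite truncated_potentialE.
apply: cvg_monotone_convergence => //.
- move=> m; apply/(measurable_restrictT _ _).1; first exact: measurable_box.
  by apply: measurable_funTS; apply/measurable_EFinP; exact: measurable_truncated_riesz_l.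
- by move=> m z _; rewrite patchE; case: ifP => // _; rewrite lee_fin truncated_riesz_ge0.
- move=> z _ a b ab; rewrite !patchE; case: ifPn => [/set_mem za|_].
    rewrite mem_set; first exact: truncated_riesz_nd.
    by apply: le_box za; rewrite ler_nat.
  by case: ifP => // _; rewrite lee_fin truncated_riesz_ge0.
Qed.

Lemma truncated_potential_nd mu x :
  {homo (fun m => truncated_potential mu m x) : a b / (a <= b)%N >-> (a <= b)}.
Proof.
move=> a b ab; rewrite !truncated_potentialE; apply: ge0_le_integral => //.
- by move=> z _; rewrite patchE; case: ifP => // _; rewrite lee_fin truncated_riesz_ge0.
- apply/(measurable_restrictT _ _).1; first exact: measurable_box.
  by apply: measurable_funTS; apply/measurable_EFinP; exact: measurable_truncated_riesz_l.
- apply/(measurable_restrictT _ _).1; first exact: measurable_box.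
  by apply: measurable_funTS; apply/measurable_EFinP; exact: measurable_truncated_riesz_l.
- move=> z _; rewrite !patchE; case: ifPn => [/set_mem za|_].
    rewrite mem_set; first exact: truncated_riesz_nd.
    by apply: le_box za; rewrite ler_nat.
  by case: ifP => // _; rewrite lee_fin truncated_riesz_ge0.
Qed.

Lemma truncated_potential_le mu m x : truncated_potential mu m x <= potential alpha mu x.
Proof.
have h := @cvg_truncated_potential mu x.
have /ereal_nondecreasing_cvgn h2 : nondecreasing_seq (fun m => truncated_potential mu m x).
  by move=> a b ab; exact: truncated_potential_nd.
by rewrite (cvg_unique _ h h2)//; apply: ereal_sup_ubound; exists m.
Qed.

Lemma potential_sup mu x (a : R) : (a%:E < potential alpha mu x) ->
  exists m, a%:E < truncated_potential mu m x.
Proof.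
have h := @cvg_truncated_potential mu x.
have /ereal_nondecreasing_cvgn h2 : nondecreasing_seq (fun m => truncated_potential mu m x).
  by move=> b c bc; exact: truncated_potential_nd.
rewrite (cvg_unique _ h h2)// => /ereal_sup_gt[_ [m _ <-] am]; by exists m.
Qed.

Lemma truncated_potential_lipschitz mu m x x' : radon mu ->
  truncated_potential mu m x <= truncated_potential mu m x' +
   (riesz_lip (n:=n) alpha m.+1%:R^-1 * fine (mu (box m%:R)) * edist x x')%:E.
Proof.
move=> rmu; have mub : mu (box m%:R) \is a fin_num.
  by rewrite ge0_fin_numE//; exact/rmu/compact_box.
have m0 : (0 < m.+1%:R^-1 :> R)%R by rewrite invr_gt0.
have -> : (riesz_lip (n:=n) alpha m.+1%:R^-1 * fine (mu (box m%:R)) * edist x x')%:E =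
   \int[mu]_(z in box m%:R) (riesz_lip (n:=n) alpha m.+1%:R^-1 * edist x x')%:E.
  rewrite integral_cst; last exact: measurable_box.
  rewrite -(fineK mub) -EFinM; congr EFin.
  by rewrite mulrAC.
rewrite -ge0_integralD//=.
- apply: ge0_le_integral => //.
  + exact: measurable_box.
  + by move=> z _; rewrite lee_fin truncated_riesz_ge0.
  + by apply: measurable_funTS; apply/measurable_EFinP; exact: measurable_truncated_riesz_l.
  + apply: emeasurable_funD => //.
    by apply: measurable_funTS; apply/measurable_EFinP; exact: measurable_truncated_riesz_l.
  + by move=> z _; rewrite -EFinD lee_fin; exact: truncated_riesz_lipschitz.
- exact: measurable_box.
- by move=> z _; rewrite lee_fin truncated_riesz_ge0.
- by apply: measurable_funTS; apply/measurable_EFinP; exact: measurable_truncated_riesz_l.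
- by move=> z _; rewrite lee_fin mulr_ge0 ?edist_ge0// riesz_lip_ge0.
Qed.

Lemma potential_lsc mu a : radon mu -> open [set x | a%:E < potential alpha mu x].
Proof.
move=> rmu.
have -> : [set x | a%:E < potential alpha mu x] = \bigcup_m [set x | a%:E < truncated_potential mu m x].
  apply/seteqP; split => x /= h; first by have [m] := potential_sup h; exists m.
  by have [m _ /= h2] := h; exact/(lt_le_trans h2)/truncated_potential_le.
apply: bigcup_open => m _; apply: open_lipschitz => x x'.
exact: truncated_potential_lipschitz.
Qed.

End potentials.

Lemma lee_pmulE {R : realType} (d : R) (x y : \bar R) : 0 <= d -> (x <= y)%E -> (d%:E * x <= d%:E * y)%E.
Proof. by move=> d0 xy; apply: lee_wpmul2l => //; rewrite lee_fin. Qed.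

(** * Vague compactness along an ultrafilter *)

Section ultra_limits.
Context {R : realType} {I : Type} (U : set_system I) {UU : UltraFilter U}.

Lemma ultra_fmap {T : Type} (f : I -> T) : UltraFilter (f @ U).
Proof.
split; first exact: fmap_proper_filter.
move=> G GF fUG; rewrite predeqE => A; split; last exact: fUG.
move=> GA; have [//|nA] := in_ultra_setVsetC (f @^-1` A) UU.
have GnA : G (~` A) by exact: fUG.
by have /filter_ex [? []] : G (A `&` ~` A) by exact: filterI.
Qed.

Lemma le_lim_proper (F : set_system I) {FF : ProperFilter F} (f g : I -> R) :
  cvg (f @ F) -> cvg (g @ F) -> (forall i, f i <= g i) -> lim (f @ F) <= lim (g @ F).
Proof.
move=> cf cg fg; rewrite -subr_ge0 -limB//; apply: limr_ge; first exact: is_cvgB.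
by apply: nearW => i; rewrite subr_ge0.
Qed.

Lemma ultra_bounded_cvg (f : I -> R) (M : R) :
  (forall i, 0 <= f i <= M) -> cvg (f @ U).
Proof.
move=> h.
have : compact `[0, M]%classic by exact: segment_compact.
rewrite compact_ultra => /(_ (f @ U)); case.
- exact: ultra_fmap.
- by apply: (@filterE _ U) => i /=; rewrite in_itv/=; exact: h.
- by move=> p [_ hp]; apply/cvg_ex; exists p.
Qed.

End ultra_limits.

Section vague_limits.
Local Open Scope ereal_scope.
Context {R : realType} {n : nat} {I : Type} (U : set_system I) {UU : UltraFilter U}.
Notation measure_rV := {measure set (Rn R n) -> \bar R}.
Implicit Types (F G H K : set 'rV[R]_n).
Context (rho : I -> measure_rV) (M : nat -> R)
  (rhoM : forall k i, rho i (box k%:R) <= (M k)%:E).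

Let rho_compact F : compact F -> exists C : R, forall i, rho i F <= C%:E.
Proof.
move=> cF; have [k Fk] := compact_sub_box cF; exists (M k) => i.
apply: le_trans (rhoM k i); apply: le_measure; rewrite ?inE//.
- exact: compact_measurable_rV.
- exact: measurable_box.
Qed.

Let rho_fin F i : compact F -> rho i F \is a fin_num.
Proof.
move=> /rho_compact[C hC]; rewrite ge0_fin_numE//.
by rewrite (le_lt_trans (hC i))// ltry.
Qed.

(** The limit is additive on disjoint compact sets but not regular: mass approaching a compact set
    from outside is missed. As in Riesz's representation theorem, it is therefore turned into a
    content [ultra_open] on open sets, by inner approximation, and then into an outer measure. *)
Definition ultra_content F : R := lim ((fun i => fine (rho i F)) @ U).
Local Notation l := ultra_content.

Let cvg_l F : compact F -> cvg ((fun i => fine (rho i F)) @ U).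
Proof.
move=> cF; have [C hC] := rho_compact cF.
apply: (@ultra_bounded_cvg _ _ _ _ _ C) => i; rewrite fine_ge0//=.
by rewrite -lee_fin fineK// rho_fin.
Qed.

Let l0 : l set0 = 0%R.
Proof. by rewrite /l; under eq_fun do rewrite measure0; exact: lim_cst. Qed.

Let l_le F F' : compact F -> compact F' -> F `<=` F' -> (l F <= l F')%R.
Proof.
move=> cF cF' FF'; apply: le_lim_proper; [exact: cvg_l|exact: cvg_l|].
move=> i; apply: fine_le; rewrite ?rho_fin//.
by apply: le_measure; rewrite ?inE//; exact: compact_measurable_rV.
Qed.

Let lU F F' : compact F -> compact F' -> (l (F `|` F') <= l F + l F')%R.
Proof.
move=> cF cF'; rewrite /l -limD; [|exact: cvg_l|exact: cvg_l].
have cFF' : compact (F `|` F') by exact: compactU.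
apply: le_lim_proper; [exact: cvg_l|by apply: is_cvgD; exact: cvg_l|].
move=> i; rewrite /= fctE -fineD ?rho_fin//; apply: fine_le.
- by rewrite rho_fin.
- by rewrite fin_numD !rho_fin.
- by apply: measureU2; exact: compact_measurable_rV.
Qed.

Let lU_disj F F' : compact F -> compact F' -> F `&` F' = set0 -> l (F `|` F') = (l F + l F')%R.
Proof.
move=> cF cF' FF'; rewrite /l -limD; [|exact: cvg_l|exact: cvg_l].
congr (lim (_ @ U)); apply/funext => i /=; rewrite fctE -fineD ?rho_fin//; congr fine.
by rewrite measureU//; exact: compact_measurable_rV.
Qed.

Let l_lt F (r : R) : compact F -> (l F < r)%R -> \forall i \near U, rho i F < r%:E.
Proof.
move=> cF lr; have : (fun i => fine (rho i F)) @ U --> l F by exact: cvg_l.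
move=> /(_ [set x | (x < r)%R]) /= h.
have : U [set i | (fine (rho i F) < r)%R] by apply: h; exact: lt_nbhsl.
by apply: filterS => i /=; rewrite -lte_fin fineK// rho_fin.
Qed.

Let l_gt F (r : R) : compact F -> (r < l F)%R -> \forall i \near U, r%:E < rho i F.
Proof.
move=> cF lr; have : (fun i => fine (rho i F)) @ U --> l F by exact: cvg_l.
move=> /(_ [set x | (r < x)%R]) /= h.
have : U [set i | (r < fine (rho i F))%R] by apply: h; exact: lt_nbhsr.
by apply: filterS => i /=; rewrite -lte_fin fineK// rho_fin.
Qed.

Definition ultra_open G : \bar R :=
  ereal_sup [set (l F)%:E | F in [set F | compact F /\ F `<=` G]].
Local Notation m := ultra_open.

Let m_ub F G : compact F -> F `<=` G -> (l F)%:E <= m G.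
Proof. by move=> cF FG; apply: ereal_sup_ubound; exists F. Qed.

Let m_ge0 G : 0 <= m G.
Proof. by rewrite -[leLHS]/(0%:E) -l0; apply: m_ub => //; exact: compact0. Qed.

Let m_le G H : G `<=` H -> m G <= m H.
Proof.
move=> GH; apply: ge_ereal_sup => _ [F [cF FG] <-].
by apply: m_ub => //; exact: subset_trans GH.
Qed.

Let m0 : m set0 = 0.
Proof.
apply/eqP; rewrite eq_le m_ge0 andbT; apply: ge_ereal_sup => _ [F [cF F0] <-].
by move: F0; rewrite subset0 => ->; rewrite l0.
Qed.

Lemma compact_open_shrink F G : compact F -> open G -> F `<=` G ->
  exists V : set 'rV[R]_n, [/\ open V, F `<=` V & closure V `<=` G].
Proof.
move=> cF oG FG; have [k Fk] := compact_sub_box cF.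
have clF : closed F by apply: compact_closed => //; exact: norm_hausdorff.
have Fk1 : F `<=` (box (k.+1%:R : R))°.
  move=> x /Fk xk; rewrite /interior; apply/nbhs_ballP; exists 1%R => //= y [_ xy] i.
  have h1 := xk i; have h2 := xy ord0 i.
  rewrite -(subrK (x ord0 i) (y ord0 i)) -natr1 addrC.
  by rewrite (le_trans (ler_normD _ _))// lerD// ltW// distrC.
have := @compact_normal_local 'rV[R]_n _ (@norm_hausdorff _ _) (@compact_box _ _ _) F Fk1 clF G.
move=> [|B sB BG]; first by apply/set_nbhsP; exists G; split.
have /set_nbhsP[V [oV FV VB]] := sB; exists V; split => //.
by apply: subset_trans BG; exact: closure_subset.
Qed.

(** A compact [F] in the union splits along a neighbourhood [V] of [F] minus [H] whose closure lies
    in [G]: the part of [F] in [closure V] lies in [G], the part of [F] outside [V] lies in [H], and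
    both are compact. *)
Let mU G H : open G -> open H -> m (G `|` H) <= m G + m H.
Proof.
move=> oG oH; apply: ge_ereal_sup => _ [F [cF FGH] <-].
have cFH : compact (F `\` H).
  by apply: (subclosed_compact _ cF) => //; apply: closedI; [apply: compact_closed => //; exact: norm_hausdorff|exact: open_closedC].
have [|V [oV FV VG]] := compact_open_shrink cFH oG.
  by move=> x [/FGH[]].
have c1 : compact (F `&` closure V) by apply: compact_closedI => //; exact: closed_closure.
have c2 : compact (F `\` V) by apply: compact_closedI => //; exact: open_closedC.
apply: (@le_trans _ _ (l ((F `&` closure V) `|` (F `\` V)))%:E).
  rewrite lee_fin; apply: l_le => //; first exact: compactU.
  by move=> x Fx; have [Vx|nVx] := pselect (V x); [left; split => //; exact: subset_closure|right].
apply: (@le_trans _ _ (l (F `&` closure V) + l (F `\` V))%:E); first by rewrite lee_fin; exact: lU.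
rewrite EFinD leeD//; apply: m_ub => //; first by move=> x [_ /VG].
by move=> x [Fx nVx]; apply: contrapT => nHx; apply: nVx; exact: FV.
Qed.

Let m_bigU (G : (set 'rV[R]_n)^nat) N : (forall k, open (G k)) ->
  m (\big[setU/set0]_(k < N) G k) <= \sum_(k < N) m (G k).
Proof.
move=> oG; elim: N => [|N ih]; first by rewrite !big_ord0 m0.
rewrite !big_ord_recr/=; apply: le_trans (leeD2r _ ih); apply: mU => //.
by rewrite -bigcup_mkord; apply: bigcup_open.
Qed.

Let m_bigcup (G : (set 'rV[R]_n)^nat) : (forall k, open (G k)) ->
  m (\bigcup_k G k) <= \sum_(k <oo) m (G k).
Proof.
move=> oG; apply: ge_ereal_sup => _ [F [cF FG] <-].
move: (cF); rewrite compact_cover => /(_ _ setT G (fun k _ => oG k) FG)[D _ FD].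
pose N := (\max_(k <- finmap.enum_fset D) k).+1.
have FN : F `<=` \big[setU/set0]_(k < N) G k.
  move=> x /FD[k /= kD Gx]; rewrite -bigcup_mkord; exists k => //=.
  by rewrite ltnS; exact: leq_bigmax_seq.
apply: (le_trans (m_ub cF FN)); apply: (le_trans (m_bigU _ oG)).
rewrite -(big_mkord xpredT (fun k => m (G k))).
by apply: nneseries_lim_ge.
Qed.

Definition ultra_outer (A : set 'rV[R]_n) : \bar R :=
  ereal_inf [set m G | G in [set G | open G /\ A `<=` G]].
Local Notation mo := ultra_outer.

Let mo_ge0 A : 0 <= mo A.
Proof. by apply: le_ereal_inf_tmp => _ [G _ <-]. Qed.

Let mo_le : {homo mo : A B / A `<=` B >-> A <= B}.
Proof.
move=> A B AB; apply: le_ereal_inf_tmp => _ [G [oG BG] <-].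
by apply: ereal_inf_lbound; exists G => //; split => //; exact: subset_trans BG.
Qed.

Let mo_open G : open G -> mo G = m G.
Proof.
move=> oG; apply/eqP; rewrite eq_le; apply/andP; split.
  by apply: ereal_inf_lbound; exists G => //; split.
by apply: le_ereal_inf_tmp => _ [H [oH GH] <-]; exact: m_le.
Qed.

Let mo0 : mo set0 = 0.
Proof. by rewrite mo_open ?m0//; exact: open0. Qed.

Let mo_sigma_subadditive : sigma_subadditive mo.
Proof.
move=> A; have [[i ioo]|/forallNP noo] := pselect (exists i, mo (A i) = +oo).
  by rewrite (eseries_pinfty _ _ ioo) ?leey// => k _; rewrite -ltNye (lt_le_trans _ (mo_ge0 _)).
apply/lee_addgt0Pr => e e0.
have hG k : exists G, [/\ open G, A k `<=` G & m G <= mo (A k) + (e / (2 ^ k.+1)%:R)%:E].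
  have fk : mo (A k) \is a fin_num by rewrite ge0_fin_numE// ltey; exact/eqP.
  have e20 : (0 < e / (2 ^ k.+1)%:R)%R by rewrite divr_gt0// ltr0n expn_gt0.
  have [_ [G [oG AG] <-] h] := lb_ereal_inf_adherent e20 fk.
  by exists G; split => //; exact: ltW.
pose G k := projT1 (cid (hG k)).
have G1 k : open (G k) by have [] := projT2 (cid (hG k)).
have G2 k : A k `<=` G k by have [] := projT2 (cid (hG k)).
have G3 k : m (G k) <= mo (A k) + (e / (2 ^ k.+1)%:R)%:E by have [] := projT2 (cid (hG k)).
apply: le_trans (epsilon_trick _ _ (ltW e0)) => //.
apply: (@le_trans _ _ (\sum_(k <oo) m (G k))); last by apply: lee_nneseries.
apply: le_trans (m_bigcup G1); apply: ereal_inf_lbound; exists (\bigcup_k G k) => //.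
split; first by apply: bigcup_open.
by move=> x [k _ Ax]; exists k => //; exact: G2.
Qed.

HB.instance Definition _ := isOuterMeasure.Build R 'rV[R]_n mo mo0 mo_ge0 mo_le mo_sigma_subadditive.

(** It suffices to cut open sets [H]. The part of [H] in [G] is filled from inside by a compact
    [F1]; what remains of [H] outside [G] lies in the open set [H] minus [F1], which is filled by a
    compact [F2] disjoint from [F1], and [l] is additive on the two. *)
Let open_caratheodory G : open G -> mo.-caratheodory G.
Proof.
move=> oG; apply: le_caratheodory_measurable => X.
apply: le_ereal_inf_tmp => _ [H [oH XH] <-].
apply: (@le_trans _ _ (mo (H `&` G) + mo (H `&` ~` G))).
  by apply: leeD; apply: mo_le; exact: setSI.
rewrite (mo_open (openI oH oG)).
have [->|mHoo] := eqVneq (m H) +oo; first exact: leey.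
have mHfin : m H \is a fin_num by rewrite ge0_fin_numE// ltey.
have key F1 : compact F1 -> F1 `<=` H `&` G -> (l F1)%:E + mo (H `&` ~` G) <= m H.
  move=> c1 F1HG.
  have cl1 : closed F1 by apply: compact_closed => //; exact: norm_hausdorff.
  have o1 : open (H `\` F1) by apply: openI => //; exact: closed_openC.
  apply: (@le_trans _ _ ((l F1)%:E + m (H `\` F1))).
    rewrite leeD2l// -mo_open//; apply: mo_le => x [Hx nGx]; split => //.
    by move=> /F1HG[_].
  rewrite -leeBrDl//; apply: ge_ereal_sup => _ [F2 [c2 F2H] <-].
  rewrite leeBrDl// -EFinD -lU_disj//.
    apply: m_ub; first exact: compactU.
    by move=> x [/F1HG[]|/F2H[]].
  by apply/seteqP; split => // x [F1x /F2H[]].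
have fin2 : mo (H `&` ~` G) \is a fin_num.
  rewrite ge0_fin_numE// (@le_lt_trans _ _ (m H))// ?ltey// -mo_open//.
  by apply: mo_le => x [].
rewrite -leeBrDr//; apply: ge_ereal_sup => _ [F1 [c1 F1HG] <-].
by rewrite leeBrDr//; exact: key.
Qed.

Let borel_caratheodory (A : set (Rn R n)) : measurable A -> mo.-caratheodory A.
Proof.
have sa : sigma_algebra setT (mo.-caratheodory).
  split.
  - exact: caratheodory_measurable_set0.
  - by move=> B; rewrite setTD; exact: caratheodory_measurable_setC.
  - by move=> B; exact: caratheodory_measurable_bigcup.
by move: A; apply: smallest_sub => // G; exact: open_caratheodory.
Qed.

Definition ultra_measure (A : set (Rn R n)) : \bar R := mo A.

Let um0 : ultra_measure set0 = 0. Proof. exact: mo0. Qed.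
Let um_ge0 A : 0 <= ultra_measure A. Proof. exact: mo_ge0. Qed.
Let um_sigma : semi_sigma_additive ultra_measure.
Proof.
move=> A mA tA mUA; apply: (@caratheodory_measure_sigma_additive R 'rV[R]_n mo) => //.
  by move=> k; exact: borel_caratheodory.
exact: borel_caratheodory.
Qed.

HB.instance Definition _ := isMeasure.Build _ (Rn R n) R ultra_measure um0 um_ge0 um_sigma.

(** The two inequalities of the portmanteau theorem. On compact sets [l] is at most the limit
    measure, because every open set around the compact one has a larger content; on open sets the
    limit measure is itself a supremum of values of [l]. *)
Lemma vague_limit : exists lam : measure_rV, [/\ radon lam,
  forall F (r : R), compact F -> lam F < r%:E -> \forall i \near U, rho i F < r%:E &
  forall G (r : R), open G -> r%:E < lam G -> \forall i \near U, r%:E < rho i G].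
Proof.
exists (ultra_measure : measure_rV).
have lF F : compact F -> (l F)%:E <= mo F.
  by move=> cF; apply: le_ereal_inf_tmp => _ [G [oG FG] <-]; exact: m_ub.
split.
- move=> K cK; have [k Kk] := compact_sub_box cK.
  (* An open set squeezed between [K] and the box of side [k.+1]; its content is at most the finite
     value of [l] on that box. *)
  pose V : set 'rV[R]_n := [set x | (`|x| < k.+1%:R)%R].
  have oV : open V by apply: open_comp (@open_lt _ _) => x _; exact: norm_continuous.
  have KV : K `<=` V.
    move=> x /Kk xk; rewrite /V/=; apply: (@le_lt_trans _ _ k%:R); last by rewrite ltr_nat.
    exact: norm_le_rV.
  apply: (@le_lt_trans _ _ (m V)); first by rewrite -mo_open//; exact: mo_le.
  apply: (@le_lt_trans _ _ (l (box k.+1%:R))%:E); last exact: ltry.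
  apply: ge_ereal_sup => _ [F [cF FV] <-]; rewrite lee_fin; apply: l_le => //.
    exact: compact_box.
  by move=> x /FV xV i; apply: (le_trans (coord_le_norm x i)); exact: ltW.
- move=> F r cF Fr; apply: l_lt => //; rewrite -lte_fin.
  by apply: le_lt_trans Fr; exact: lF.
- move=> G r oG; rewrite /= /ultra_measure mo_open// => /ereal_sup_gt[_ [F [cF FG] <-]].
  rewrite lte_fin => rF; have := l_gt cF rF; apply: filterS => i /lt_le_trans; apply.
  apply: le_measure; rewrite ?inE//; [exact: compact_measurable_rV|exact: open_measurable_rV].
Qed.

End vague_limits.

(** * Layer sums and convergence of integrals *)

Section layers.
Local Open Scope ereal_scope.
Context {R : realType} {n : nat}.
Notation measure_rV := {measure set (Rn R n) -> \bar R}.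
Context (phi : 'rV[R]_n -> R) (phi0 : forall x, (0 <= phi x)%R)
  (mphi : measurable_fun [set: Rn R n] (phi : Rn R n -> R))
  (k : nat) (phik : forall x, ~ box k%:R x -> phi x = 0%R) (d : R) (d0 : (0 < d)%R)
  (N : nat) (phiN : forall x, (phi x <= N%:R * d + d)%R)
  (S : nat -> set (Rn R n)) (mS : forall j, measurable (S j))
  (Slt : forall j x, (j.+1%:R * d < phi x)%R -> S j x)
  (Sle : forall j x, S j x -> (j.+1%:R * d <= phi x)%R).

Let layer_sum_le M x : (d * \sum_(j < M) \1_(S j) x <= phi x)%R.
Proof.
elim: M => [|M ih]; first by rewrite big_ord0 mulr0.
have [Sx|nSx] := pselect (S M x).
  apply: le_trans (Sle Sx); rewrite mulrC ler_wpM2r ?(ltW d0)//.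
  apply: (@le_trans _ _ (\sum_(j < M.+1) 1)%R).
    by apply: ler_sum => j _; rewrite indicE; case: (_ \in _).
  by rewrite sumr_const card_ord.
by rewrite big_ord_recr/= indicE memNset// addr0.
Qed.

Let le_layer_sum x : (phi x <= d + d * \sum_(j < N) \1_(S j) x)%R.
Proof.
have := phiN x; elim: N => [|M ih] hM.
  by rewrite big_ord0 mulr0 addr0 (le_trans hM)// mul0r add0r.
have [Sx|nSx] := pselect (S M x); last first.
  rewrite big_ord_recr/= indicE memNset// addr0; apply: ih.
  rewrite leNgt; apply/negP => h; apply: nSx; apply: Slt.
  by rewrite -natr1 mulrDl mul1r.
apply: (le_trans hM); rewrite addrC lerD2l mulrC ler_wpM2l ?(ltW d0)//.
rewrite (eq_bigr (fun=> 1%R)) ?sumr_const ?card_ord// => j _.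
rewrite indicE mem_set//.
have [jM|jM] := eqVneq (j : nat) M; first by rewrite jM.
apply: Slt; apply: lt_le_trans (Sle Sx).
by rewrite ltr_pM2r// ltr_nat ltnS ltn_neqAle jM -ltnS ltn_ord.
Qed.

Let integral_layer_sum (mu : measure_rV) :
  \int[mu]_x (d * \sum_(j < N) \1_(S j) x)%:E = d%:E * \sum_(j < N) mu (S j).
Proof.
under eq_integral => x _ do rewrite EFinM -sumEFin.
rewrite ge0_integralZl_EFin ?ltW//; last 2 first.
- by move=> x _; apply: sume_ge0 => j _; rewrite lee_fin indicE.
- by apply: emeasurable_sum => j; apply/measurable_EFinP; exact: measurable_indic.
rewrite ge0_integral_sum//.
- by congr (_ * _); apply: eq_bigr => j _; rewrite integral_indic// setIT.
- by move=> j; apply/measurable_EFinP; exact: measurable_indic.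
Qed.

Let measurable_layer_sum : measurable_fun [set: Rn R n] (fun x => (d * \sum_(j < N) \1_(S j) x)%R).
Proof. by apply: measurable_funM => //; apply: measurable_sum => j; exact: measurable_indic. Qed.

Let layer_sum_ge0 x : (0 <= d * \sum_(j < N) \1_(S j) x)%R.
Proof. by rewrite mulr_ge0 ?(ltW d0)// sumr_ge0// => j _; rewrite indicE. Qed.

(** [S j] only has to lie between the strict and the weak superlevel set of [phi] at height
    [(j+1) d]. So this bound and [integral_le_layer_sum] hold for compact superlevel sets and for
    open ones alike, matching the two portmanteau inequalities. *)
Lemma layer_sum_le_integral (mu : measure_rV) :
  d%:E * \sum_(j < N) mu (S j) <= \int[mu]_x (phi x)%:E.
Proof.
rewrite -integral_layer_sum; apply: ge0_le_integral => //.
- by move=> x _; rewrite lee_fin.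
- exact/measurable_EFinP.
- exact/measurable_EFinP.
- by move=> x _; rewrite lee_fin.
Qed.

Lemma integral_le_layer_sum (mu : measure_rV) :
  \int[mu]_x (phi x)%:E <= d%:E * mu (box k%:R) + d%:E * \sum_(j < N) mu (S j).
Proof.
have mb : measurable (box k%:R : set (Rn R n)) by exact: measurable_box.
have -> : d%:E * mu (box k%:R) = \int[mu]_x (d * \1_(box k%:R) x)%:E.
  under eq_integral => x _ do rewrite EFinM.
  rewrite ge0_integralZl_EFin ?ltW//.
  - by rewrite integral_indic// setIT.
  - by apply/measurable_EFinP; exact: measurable_indic.
rewrite -integral_layer_sum -ge0_integralD//; last 4 first.
- by move=> x _; rewrite lee_fin mulr_ge0 ?(ltW d0)// indicE.
- by apply/measurable_EFinP; apply: measurable_funM => //; exact: measurable_indic.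
- by move=> x _; rewrite lee_fin.
- exact/measurable_EFinP.
apply: ge0_le_integral => //.
- by move=> x _; rewrite lee_fin.
- exact/measurable_EFinP.
- apply: emeasurable_funD; last exact/measurable_EFinP.
  by apply/measurable_EFinP; apply: measurable_funM => //; exact: measurable_indic.
- move=> x _; rewrite -EFinD lee_fin.
  have [kx|nkx] := pselect (box k%:R x); last by rewrite phik// addr_ge0// mulr_ge0 ?(ltW d0)// indicE.
  by rewrite indicE mem_set// mulr1.
Qed.

End layers.

Section vague_integrals.
Local Open Scope ereal_scope.
Context {R : realType} {n : nat} {I : Type} (U : set_system I) {UU : UltraFilter U}.
Notation measure_rV := {measure set (Rn R n) -> \bar R}.
Context (rho : I -> measure_rV) (M : nat -> R)
  (rhoM : forall k i, rho i (box k%:R) <= (M k)%:E) (lam : measure_rV) (rlam : radon lam)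
  (lamF : forall (F : set 'rV[R]_n) (r : R), compact F -> lam F < r%:E -> \forall i \near U, rho i F < r%:E)
  (lamG : forall (G : set 'rV[R]_n) (r : R), open G -> r%:E < lam G -> \forall i \near U, r%:E < rho i G).

Lemma vague_integral (phi : 'rV[R]_n -> R) (k : nat) : continuous phi ->
  (forall x, (0 <= phi x)%R) -> (forall x, ~ box k%:R x -> phi x = 0%R) ->
  forall e : R, (0 < e)%R -> \forall i \near U,
    \int[rho i]_x (phi x)%:E <= \int[lam]_x (phi x)%:E + e%:E /\
    \int[lam]_x (phi x)%:E <= \int[rho i]_x (phi x)%:E + e%:E.
Proof.
move=> cphi phi0 phik e e0.
have mphi := continuous_measurable_rV cphi.
have [B phiB] : exists B : R, forall x, (phi x <= B)%R.
  have : compact (phi @` box k%:R).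
    by apply: continuous_compact; [exact: continuous_subspaceT|exact: compact_box].
  move=> /compact_bounded[B [_ hB]]; exists (`|B| + 1)%R => x.
  have [kx|nkx] := pselect (box k%:R x); last by rewrite phik// addr_ge0.
  apply: (le_trans (ler_norm _)); apply: hB; last by exists x.
  by rewrite (le_lt_trans (ler_norm _))// ltrDl.
have lk : lam (box k%:R) \is a fin_num by rewrite ge0_fin_numE//; exact/rlam/compact_box.
(* [C] bounds the mass of the box for all measures involved. With mesh [d = e / (2 C)] the rounding
   of [phi] costs at most [d C = e / 2]; the other [e / 2] pays for the layers, each off by at most
   [eta = C / (N+1)]. *)
pose C : R := (`|M k| + fine (lam (box k%:R)) + 1)%R.
have C0 : (0 < C)%R by rewrite /C ltr_wpDl// addr_ge0// fine_ge0.
pose d := (e / (2 * C))%R.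
have d0 : (0 < d)%R by rewrite /d divr_gt0// mulr_gt0.
pose N := (Num.bound (`|B| / d)).
have phiN x : (phi x <= N%:R * d + d)%R.
  apply: (le_trans (phiB x)); apply: (@le_trans _ _ (N%:R * d)%R); last by rewrite lerDl ltW.
  have Bd : (0 <= `|B| / d)%R by rewrite divr_ge0// ltW.
  rewrite -ler_pdivrMr//; apply: le_trans (ltW (archi_boundP Bd)).
  by rewrite ler_pM2r ?invr_gt0// ler_norm.
pose F j : set (Rn R n) := [set x | (j.+1%:R * d <= phi x)%R].
pose G j : set (Rn R n) := [set x | (j.+1%:R * d < phi x)%R].
have oG j : open (G j : set 'rV[R]_n).
  by apply: open_comp (@open_gt _ _) => x _; exact: cphi.
have clF j : closed (F j : set 'rV[R]_n).
  by apply: closed_comp (@closed_ge _ _) => x _; exact: cphi.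
have Fk j : F j `<=` box k%:R.
  move=> x /= Fx; apply: contrapT => /phik px; move: Fx; rewrite /F/= px leNgt.
  by rewrite mulr_gt0.
have cF j : compact (F j : set 'rV[R]_n).
  by apply: (subclosed_compact (clF j) _ (Fk j)); exact: compact_box.
have mF j : measurable (F j) by exact: closed_measurable_rV.
have mG j : measurable (G j) by exact: open_measurable_rV.
have GF j : G j `<=` F j by move=> x /= /ltW.
have lFfin j : lam (F j) \is a fin_num by rewrite ge0_fin_numE//; exact: rlam.
have rfin i j : rho i (F j) \is a fin_num.
  rewrite ge0_fin_numE//; apply: (@le_lt_trans _ _ (M k)%:E); last exact: ltry.
  apply: le_trans (rhoM k i); apply: le_measure; rewrite ?inE//; exact: measurable_box.
have lGfin j : lam (G j) \is a fin_num.
  by rewrite ge0_fin_numE// (le_lt_trans _ (rlam (cF j)))// le_measure// ?inE.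
have rGfin i j : rho i (G j) \is a fin_num.
  by rewrite ge0_fin_numE// (@le_lt_trans _ _ (rho i (F j)))// ?le_measure ?inE// ltey_eq rfin.
pose eta : R := (C / N.+1%:R)%R.
have eta0 : (0 < eta)%R by rewrite divr_gt0.
have near1 : \forall i \near U, forall j : 'I_N,
    rho i (F j) <= lam (F j) + eta%:E /\ lam (G j) <= rho i (G j) + eta%:E.
  apply: filter_forall => j.
  have h1 : lam (F j) < (fine (lam (F j)) + eta)%:E.
    by rewrite EFinD fineK// lteDl.
  have h2 : (fine (lam (G j)) - eta)%:E < lam (G j).
    by rewrite EFinB fineK// lteBlDr// lteDl.
  near=> i; split.
    apply/ltW; rewrite -(fineK (lFfin j)) -EFinD; near: i; exact: lamF.
  rewrite -leeBlDr// -(fineK (lGfin j)) -EFinB; apply/ltW; near: i; exact: lamG.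
have sum_eta (a b : nat -> \bar R) : (forall j : 'I_N, a j <= b j + eta%:E) ->
    \sum_(j < N) a j <= \sum_(j < N) b j + C%:E.
  move=> ab; apply: (@le_trans _ _ (\sum_(j < N) (b j + eta%:E))); first exact: lee_sum.
  rewrite big_split/= leeD2l// sumEFin lee_fin sumr_const card_ord -mulr_natl /eta.
  by rewrite mulrCA ger_pMr// ler_pdivrMr// mul1r ler_nat.
have dC : (d * C = e / 2)%R by rewrite /d; field; rewrite gt_eqF.
near=> i.
have hi : forall j : 'I_N, rho i (F j) <= lam (F j) + eta%:E /\ lam (G j) <= rho i (G j) + eta%:E.
  by near: i; exact: near1.
have bound (mu : measure_rV) : mu (box k%:R) <= (C)%:E -> d%:E * mu (box k%:R) <= (e / 2)%:E.
  by move=> h; have := lee_pmulE (ltW d0) h; rewrite -EFinM dC.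
have ->: e%:E = (e / 2)%:E + d%:E * C%:E :> \bar R by rewrite -EFinM dC -EFinD -splitr.
split.
- have h1 : \int[rho i]_x (phi x)%:E <= d%:E * rho i (box k%:R) + d%:E * \sum_(j < N) rho i (F j).
    by apply: integral_le_layer_sum => // j x /= /ltW.
  have h2 : d%:E * \sum_(j < N) lam (F j) <= \int[lam]_x (phi x)%:E.
    by apply: layer_sum_le_integral => // j x /= /ltW.
  apply: (le_trans h1); rewrite addeCA; apply: leeD.
    apply: bound; apply: (le_trans (rhoM k i)); rewrite lee_fin /C.
    by rewrite -addrA (le_trans (ler_norm _))// lerDl addr_ge0// fine_ge0.
  apply: le_trans (leeD2r _ h2); rewrite -ge0_muleDr ?lee_fin ?(ltW C0)//; last exact: sume_ge0.
  apply: lee_pmulE; first exact: ltW.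
  by apply: (sum_eta (fun j => rho i (F j)) (fun j => lam (F j))) => j; have [] := hi j.
- have h1 : \int[lam]_x (phi x)%:E <= d%:E * lam (box k%:R) + d%:E * \sum_(j < N) lam (G j).
    by apply: integral_le_layer_sum => // j x /= /ltW.
  have h2 : d%:E * \sum_(j < N) rho i (G j) <= \int[rho i]_x (phi x)%:E.
    by apply: layer_sum_le_integral => // j x /= /ltW.
  apply: (le_trans h1); rewrite addeCA; apply: leeD.
    apply: bound; rewrite -(fineK lk) lee_fin /C -addrA addrCA lerDl addr_ge0//.
  apply: le_trans (leeD2r _ h2); rewrite -ge0_muleDr ?lee_fin ?(ltW C0)//; last exact: sume_ge0.
  apply: lee_pmulE; first exact: ltW.
  by apply: (sum_eta (fun j => lam (G j)) (fun j => rho i (G j))) => j; have [] := hi j.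
Unshelve. all: by end_near. Qed.

End vague_integrals.

(** * Regularity, semicontinuity and restriction to continuous potentials *)

Section regularity.
Local Open Scope ereal_scope.
Context {R : realType} {n : nat}.
Notation measure_rV := {measure set (Rn R n) -> \bar R}.
Implicit Types (x y z : 'rV[R]_n) (B : set (Rn R n)).
Context (mu : measure_rV) (mufin : mu setT < +oo).

Let mu_fin B : measurable B -> mu B \is a fin_num.
Proof.
by move=> mB; rewrite ge0_fin_numE// (le_lt_trans _ mufin)// le_measure// ?inE.
Qed.

Definition regular_set B := measurable B /\ forall e : R, (0 < e)%R ->
  exists F G : set 'rV[R]_n, [/\ closed F, open G, F `<=` B, B `<=` G & mu (G `\` F) < e%:E].

Let regular_open (G : set 'rV[R]_n) : open G -> regular_set G.
Proof.
move=> oG; split; first exact: open_measurable_rV.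
move=> e e0.
pose F m : set 'rV[R]_n := [set x | forall y, ~ G y -> (m.+1%:R^-1 <= `|x - y|)%R].
have cF m : closed (F m).
  rewrite (_ : F m = \bigcap_(y in ~` G) [set x | (m.+1%:R^-1 <= `|x - y|)%R]); last by [].
  apply: closed_bigI => y nGy.
  rewrite (_ : mkset _ = ~` ball y (m.+1%:R^-1)); last first.
    by apply/seteqP; split => x; rewrite mx_norm_ball/ball_/= distrC leNgt => /negP.
  by apply: open_closedC; apply: ball_open; rewrite invr_gt0.
have FG m : F m `<=` G.
  move=> x Fx; apply: contrapT => nGx; have := Fx x nGx.
  by rewrite subrr normr0 leNgt invr_gt0 ltr0n.
have : mu \o (fun m => G `\` F m) @ \oo --> mu (\bigcap_m (G `\` F m)).
  apply: nonincreasing_cvg_mu.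
  - apply: le_lt_trans mufin; apply: le_measure; rewrite ?inE//.
    by apply: measurableD; [exact: open_measurable_rV|exact: closed_measurable_rV].
  - by move=> m; apply: measurableD; [exact: open_measurable_rV|exact: closed_measurable_rV].
  - apply: bigcapT_measurable => m.
    by apply: measurableD; [exact: open_measurable_rV|exact: closed_measurable_rV].
  - move=> a b ab; apply/subsetPset => x [Gx nFx]; split => // Fx; apply: nFx => y /Fx.
    by apply: le_trans; rewrite lef_pV2 ?posrE// ler_nat.
rewrite (_ : \bigcap_m (G `\` F m) = set0) ?measure0; last first.
  apply/seteqP; split => // x h; have [Gx _] := h 0%N I.
  have /nbhs_ballP[r /= r0 rG] : nbhs x G by exact: open_nbhs_nbhs.
  have [k _ /(_ k (leqnn _)) /= kr] := near_infty_natSinv_lt (PosNum r0).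
  have [_] := h k I; apply => y nGy; rewrite leNgt; apply/negP => xy; apply: nGy.
  by apply: rG; rewrite mx_norm_ball/ball_/= (lt_trans xy).
move=> /fine_cvgP[h1 h2].
have : \forall m \near \oo, (fine (mu (G `\` F m)) < e)%R.
  exact: (cvgr_lt _ h2 _ e0).
case=> m _ /(_ m (leqnn _)) /= h; exists (F m), G; split => //.
by rewrite -(@fineK _ (mu _)) ?lte_fin// mu_fin//; apply: measurableD; [exact: open_measurable_rV|exact: closed_measurable_rV].
Qed.

Let regularC B : regular_set B -> regular_set (~` B).
Proof.
move=> [mB h]; split; first exact: measurableC.
move=> e /h[F [G [cF oG FB BG le]]]; exists (~` G), (~` F); split.
- exact: open_closedC.
- exact: closed_openC.
- exact: subsetC.
- exact: subsetC.
- by rewrite setDE setCK setIC -setDE.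
Qed.

Let regular_bigcup (B : (set (Rn R n))^nat) : (forall k, regular_set (B k)) -> regular_set (\bigcup_k B k).
Proof.
move=> h; split; first by apply: bigcup_measurable => k _; have [] := h k.
move=> e e0; pose e2 := (e / 2)%R; have e20 : (0 < e2)%R by rewrite /e2 divr_gt0.
have hk k : exists FG : set 'rV[R]_n * set 'rV[R]_n, [/\ closed FG.1, open FG.2, FG.1 `<=` B k, B k `<=` FG.2 &
    mu (FG.2 `\` FG.1) <= (e2 / (2 ^ k.+1)%:R)%:E].
  have ek : (0 < e2 / (2 ^ k.+1)%:R)%R by rewrite divr_gt0// ltr0n expn_gt0.
  have [_ /(_ _ ek)[F [G [cF oG FB BG /ltW le]]]] := h k; by exists (F, G).
pose F k := (projT1 (cid (hk k))).1; pose G k := (projT1 (cid (hk k))).2.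
have cF k : closed (F k) by rewrite /F; case: cid => -[? ?] [].
have oG k : open (G k) by rewrite /G; case: cid => -[? ?] [].
have FB k : F k `<=` B k by rewrite /F; case: cid => -[? ?] [].
have BG k : B k `<=` G k by rewrite /G; case: cid => -[? ?] [].
have FGe k : mu (G k `\` F k) <= (e2 / (2 ^ k.+1)%:R)%:E by rewrite /F /G; case: cid => -[? ?] [].
have mF k : measurable (F k : set (Rn R n)) by exact: closed_measurable_rV.
have mG k : measurable (G k : set (Rn R n)) by exact: open_measurable_rV.
pose GG := \bigcup_k G k.
have mGG : measurable (GG : set (Rn R n)) by apply: bigcup_measurable.
(* The union of all [F k] need not be closed; a finite part of it is, and finiteness of [mu] makes
   the loss small for large [N]. *)
pose FN N : set 'rV[R]_n := \big[setU/set0]_(k < N) F k.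
have cFN N : closed (FN N) by apply: closed_bigsetU => k _.
have mFN N : measurable (FN N : set (Rn R n)) by exact: closed_measurable_rV.
have le2 : mu (GG `\` \bigcup_k F k) <= e2%:E.
  apply: (@le_trans _ _ (\sum_(k <oo) mu (G k `\` F k))).
    apply: measure_sigma_subadditive => //.
    - by move=> k; exact: measurableD.
    - by apply: measurableD => //; apply: bigcup_measurable.
    - move=> x [[k _ Gx] nF]; exists k => //; split => // Fx; apply: nF; by exists k.
  apply: le_trans (epsilon_trick0 xpredT (ltW e20)).
  exact: lee_nneseries.
have : mu \o (fun N => GG `\` FN N) @ \oo --> mu (\bigcap_N (GG `\` FN N)).
  apply: nonincreasing_cvg_mu.
  - apply: le_lt_trans mufin; apply: le_measure; rewrite ?inE//.
    exact: measurableD.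
  - by move=> m; exact: measurableD.
  - by apply: bigcapT_measurable => m; exact: measurableD.
  - move=> a b ab; apply/subsetPset; apply: setDS.
    exact: subset_bigsetU.
rewrite (_ : \bigcap_N (GG `\` FN N) = GG `\` \bigcup_k F k); last first.
  apply/seteqP; split => x.
    move=> hx; split; first by have [] := hx 0%N I.
    by move=> [k _ Fx]; have [_] := hx k.+1 I; apply; rewrite /FN big_ord_recr/=; right.
  move=> [Gx nF] N _; split => //; rewrite /FN -bigcup_mkord => -[k _ Fx].
  by apply: nF; exists k.
have mF' : measurable (GG `\` \bigcup_k F k : set (Rn R n)).
  by apply: measurableD => //; apply: bigcup_measurable.
rewrite -(fineK (mu_fin mF')) => /fine_cvgP[h1 h2].
have le3 : (fine (mu (GG `\` \bigcup_k F k)) < e)%R.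
  rewrite -lte_fin fineK.
    by rewrite (le_lt_trans le2)// lte_fin /e2 ltr_pdivrMr// ltr_pMr// ltr1n.
  by apply: mu_fin; apply: measurableD => //; apply: bigcup_measurable.
have : \forall N \near \oo, (fine (mu (GG `\` FN N)) < e)%R by exact: (cvgr_lt _ h2 _ le3).
case=> N _ /(_ N (leqnn _)) /= hN; exists (FN N), GG; split => //.
- by apply: bigcup_open => k _.
- by rewrite /FN -bigcup_mkord => x [k _ /FB]; exists k.
- by move=> x [k _ /BG]; exists k.
- by rewrite -(@fineK _ (mu _)) ?lte_fin// mu_fin//; exact: measurableD.
Qed.

(** Approximation by a closed set inside and an open set outside is symmetric under complements, so
    the regular sets form a sigma-algebra; open sets are regular because they are increasing unions
    of closed sets. *)
Lemma measurable_regular B : measurable B -> regular_set B.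
Proof.
move: B; apply: smallest_sub; last by move=> G; exact: regular_open.
split; first exact: regular_open open0.
- by move=> B; rewrite setTD; exact: regularC.
- by move=> B; exact: regular_bigcup.
Qed.

Lemma compact_regular B (e : R) : measurable B -> (0 < e)%R ->
  exists K : set 'rV[R]_n, [/\ compact K, K `<=` B & mu (B `\` K) < e%:E].
Proof.
move=> mB e0; have e20 : (0 < e / 2)%R by rewrite divr_gt0.
have [_ /(_ _ e20)[F [G [cF oG FB BG le]]]] := measurable_regular mB.
have mF : measurable (F : set (Rn R n)) by exact: closed_measurable_rV.
have mG : measurable (G : set (Rn R n)) by exact: open_measurable_rV.
have : mu \o (fun k : nat => ~` box k%:R) @ \oo --> mu (\bigcap_k (~` box k%:R : set (Rn R n))).
  apply: nonincreasing_cvg_mu.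
  - by apply: le_lt_trans mufin; apply: le_measure; rewrite ?inE//; apply: measurableC; exact: measurable_box.
  - by move=> m; apply: measurableC; exact: measurable_box.
  - by apply: bigcapT_measurable => m; apply: measurableC; exact: measurable_box.
  - by move=> a b ab; apply/subsetPset; apply: subsetC; apply: le_box; rewrite ler_nat.
rewrite -setC_bigcup bigcup_box setCT measure0 => /fine_cvgP[h1 h2].
have : \forall k \near \oo, (fine (mu (~` box k%:R)) < e / 2)%R by exact: (cvgr_lt _ h2 _ e20).
case=> k _ /(_ k (leqnn _)) /= hk.
have mb : measurable (box k%:R : set (Rn R n)) by exact: measurable_box.
exists (F `&` box k%:R); split.
- by rewrite setIC; apply: compact_closedI => //; exact: compact_box.
- by move=> x [/FB].
- apply: (@le_lt_trans _ _ (mu ((G `\` F) `|` ~` box k%:R))).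
    apply: le_measure; rewrite ?inE//.
    - by apply: measurableD => //; exact: measurableI.
    - by apply: measurableU; [exact: measurableD|exact: measurableC].
    - move=> x [Bx nF]; have [xk|nxk] := pselect (box k%:R x); last by right.
      by left; split; [exact: BG|move=> Fx; exact: nF].
  apply: (le_lt_trans (measureU2 _ _ _)); [exact: measurableD|exact: measurableC|].
  rewrite (splitr e) EFinD lteD//.
  have fb : mu (~` box k%:R) \is a fin_num by apply: mu_fin; exact: measurableC.
  suff : (fine (mu (~` box k%:R)))%:E < (e / 2)%:E by rewrite (fineK fb).
  by rewrite lte_fin.
Qed.

End regularity.

(** * Lower semicontinuous functions and continuity criteria *)

Section lsc_minimum.
Local Open Scope ereal_scope.

(** If the infimum [v] were not attained, the open sets where [g] exceeds some [q > v] would cover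
    [K]; the least [q] of a finite subcover would be a lower bound of [g] larger than [v]. *)
Lemma lsc_compact_min {R : realType} {T : ptopologicalType} (g : T -> \bar R) (K : set T) :
  compact K -> K !=set0 -> (forall a, open [set x | a%:E < g x]) ->
  exists2 x, K x & forall y, K y -> g x <= g y.
Proof.
move=> cK [x0 Kx0] og; apply: contrapT => nmin.
pose v := ereal_inf (g @` K).
have vg x : K x -> v < g x.
  move=> Kx; rewrite lt_neqAle; apply/andP; split; last by apply: ereal_inf_lbound; exists x.
  apply/eqP => vgx; apply: nmin; exists x => // y Ky; rewrite -vgx.
  by apply: ereal_inf_lbound; exists y.
have cov : K `<=` cover [set q : R | v < q%:E] (fun q => [set x | q%:E < g x]).
  move=> x /vg vx; rewrite /cover/=.
  suff [q vq qg] : exists2 q : R, v < q%:E & q%:E < g x by exists q.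
  move: vx; rewrite /v; move: (ereal_inf _) (g x) => [r||] [s||]//=.
  - by rewrite lte_fin => rs; exists ((r + s) / 2)%R; rewrite lte_fin; lra.
  - by move=> _; exists (r + 1)%R; rewrite ?ltry// lte_fin ltrDl.
  - by move=> _; exists (s - 1)%R; rewrite ?ltNyr// lte_fin ltrBlDr ltrDl.
  - by move=> _; exists 0%R; rewrite ?ltNyr ?ltry.
move: (cK); rewrite compact_cover => /(_ _ _ _ (fun q _ => og q) cov)[D Dv KD].
have [q vq qK] : exists2 q : R, v < q%:E & forall x, K x -> q%:E < g x.
  have /KD[q0 /= q0D q0g] := Kx0.
  pose q := \big[Num.min/q0]_(d <- finmap.enum_fset D) d.
  exists q.
    rewrite /q big_seq; elim/big_ind : _.
    - by have := Dv _ q0D; rewrite inE.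
    - by move=> a b va vb; rewrite /Num.min; case: ifP.
    - by move=> d dD; have := Dv _ dD; rewrite inE.
  move=> x /KD[d /= dD]; apply: le_lt_trans; rewrite lee_fin.
  by rewrite /q; apply: ge_bigmin_seq.
have : q%:E <= v by apply: le_ereal_inf_tmp => _ [x Kx <-]; exact/ltW/qK.
by rewrite leNgt vq.
Qed.

End lsc_minimum.

Lemma continuous_epsP {R : realType} {T : topologicalType} (f : T -> R) :
  continuous f <-> forall x e, 0 < e -> \forall y \near x, `|f x - f y| < e.
Proof.
split=> h x; first by move=> e e0; move/cvgrPdist_lt : (h x); apply.
by apply/cvgrPdist_lt => e e0; exact: h.
Qed.

Section continuity_criteria.
Context {R : realType} {n : nat}.

Lemma lipschitz_continuous_rV (f : 'rV[R]_n -> R) (C : R) :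
  (forall x x', f x <= f x' + C * edist x x') -> continuous f.
Proof.
move=> h; apply/continuous_epsP => x e e0.
have h1 : nbhs x [set y | ((f x - e)%:E < (f y)%:E)%E].
  apply: open_nbhs_nbhs; split; last by rewrite /= lte_fin ltrBlDr ltrDl.
  apply: (@open_lipschitz _ _ (fun y => (f y)%:E) C) => y y'.
  by rewrite -EFinD lee_fin.
have h2 : nbhs x [set y | ((- f x - e)%:E < (- f y)%:E)%E].
  apply: open_nbhs_nbhs; split; last by rewrite /= lte_fin ltrBlDr ltrDl.
  apply: (@open_lipschitz _ _ (fun y => (- f y)%:E) C) => y y'.
  by rewrite -EFinD lee_fin edistC; have := h y' y; lra.
near=> y; rewrite ltr_norml; apply/andP; split.
  have : ((- f x - e)%:E < (- f y)%:E)%E by near: y.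
  by rewrite lte_fin; lra.
have : ((f x - e)%:E < (f y)%:E)%E by near: y.
by rewrite lte_fin; lra.
Unshelve. all: by end_near. Qed.

Lemma uniform_approx_continuous (f : 'rV[R]_n -> R) :
  (forall e, 0 < e -> exists g, continuous g /\ forall x, `|f x - g x| <= e) -> continuous f.
Proof.
move=> h; apply/continuous_epsP => x e e0.
have e3 : 0 < e / 4 by rewrite divr_gt0.
have [g [cg fg]] := h _ e3.
near=> y.
have : `|g x - g y| < e / 4 by near: y; move/continuous_epsP : cg; exact.
have := fg x; have := fg y.
rewrite !ler_norml !ltr_norml => /andP[? ?] /andP[? ?] /andP[? ?].
by apply/andP; split; lra.
Unshelve. all: by end_near. Qed.

End continuity_criteria.

Lemma fine_le_addr {R : realType} (a b : \bar R) (c : R) :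
  a \is a fin_num -> b \is a fin_num -> (a <= b + c%:E)%E -> fine a <= fine b + c.
Proof. by move: a b => [a||] [b||]. Qed.

Section restricted_measures.
Local Open Scope ereal_scope.

Lemma ge0_integral_mrestr d (T : measurableType d) (R : realType)
    (mu : {measure set T -> \bar R}) (D : set T) (mD : measurable D) (f : T -> \bar R) :
  measurable_fun setT f -> (forall x, 0 <= f x) ->
  \int[mrestr mu mD]_x f x = \int[mu]_(x in D) f x.
Proof.
move=> mf f0; rewrite -(setvU D) ge0_integral_setU//=; last 3 first.
- exact: measurableC.
- by rewrite setvU.
- by rewrite disj_set2E setICl.
rewrite [X in X + _]null_set_integral ?add0e//.
- by apply: eq_measure_integral => A mA AD; rewrite /= /mrestr setIidl.
- exact: measurableC.
- by apply: measurable_funTS.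
- by rewrite /= /mrestr setICl measure0.
Qed.

End restricted_measures.

(** * Restriction to compact sets with a continuous potential *)

Section nice_measures.
Local Open Scope ereal_scope.
Context {R : realType} {n : nat} (alpha : R) (alpha_n : (alpha < n%:R)%R).
Notation measure_rV := {measure set (Rn R n) -> \bar R}.
Implicit Types (mu nu tau : measure_rV) (x y z : 'rV[R]_n).
Local Notation tk := (truncated_riesz alpha).
Local Notation tkn m := (truncated_riesz alpha (m.+1%:R^-1)).
Local Notation U := (potential alpha).

(* Measures with a finite continuous potential are the test measures for inequalities that hold nearly
   everywhere: every measure with finite energy restricts to such measures on large compact sets. *)
Definition nice_on (K : set 'rV[R]_n) tau := [/\ compact K, tau setT < +oo, tau (~` K) = 0 &
  exists2 g : 'rV[R]_n -> R, continuous g & forall x, U tau x = (g x)%:E].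

Definition riesz_tail h x z := riesz alpha x z - (tk h x z)%:E.

Lemma riesz_tail_ge0 h x z : (0 < h)%R -> 0 <= riesz_tail h x z.
Proof. by move=> h0; rewrite /riesz_tail sube_ge0//; exact: truncated_riesz_le. Qed.

Lemma riesz_tailK h x z : (tk h x z)%:E + riesz_tail h x z = riesz alpha x z.
Proof. by rewrite /riesz_tail addeC subeK. Qed.

Lemma measurable_riesz_tail h x : measurable_fun [set: Rn R n] (riesz_tail h x).
Proof.
apply: emeasurable_funB; first exact: measurable_riesz_l.
by apply/measurable_EFinP; exact: measurable_truncated_riesz_l.
Qed.

(** The tail vanishes from distance [h] on and is homogeneous: doubling both the radius and the
    distance multiplies it by [2^(alpha-n)]. As it decreases with the distance, the worst case is
    [x'] at exactly twice the distance. *)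
Lemma riesz_tail_doubling h x x' z : (0 < h)%R -> (edist x' z <= 2 * edist x z)%R ->
  riesz_tail h x z <= (2 `^ (n%:R - alpha))%:E * riesz_tail (2 * h) x' z.
Proof.
move=> h0 xx'.
have c0 : (0 < 2 `^ (n%:R - alpha) :> R)%R by rewrite powR_gt0.
have h20 : (0 < 2 * h)%R by rewrite mulr_gt0.
have [xz|xz] := eqVneq x' z.
  rewrite {2}/riesz_tail {1}/riesz xz eqxx addye// gt0_muley ?leey//.
have [hr|rh] := leP h (edist x z).
  have -> : riesz_tail h x z = 0.
    rewrite /riesz_tail (@truncated_riesz_eq _ _ _ h)// ?subee//.
    by rewrite -edist_gt0 (lt_le_trans h0).
  by rewrite mule_ge0// ?riesz_tail_ge0// lee_fin ltW.
have r'0 : (0 < edist x' z)%R by rewrite edist_gt0.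
have r0 : (0 < edist x z)%R by rewrite -(@pmulr_rgt0 _ 2%R)// (lt_le_trans r'0).
rewrite /riesz_tail /riesz -!edist0 !gt_eqF// /truncated_riesz (max_r (ltW rh)) max_r; last first.
  by rewrite (le_trans xx')// ler_pM2l// ltW.
rewrite -!EFinB -EFinM lee_fin.
have key (u : R) : (0 < u)%R -> (2 `^ (n%:R - alpha) * (2 * u) `^ (alpha - n%:R) = u `^ (alpha - n%:R))%R.
  move=> u0; rewrite powRM ?(ltW u0)// mulrA -powRD; last by rewrite pnatr_eq0 implybT.
  have -> : (n%:R - alpha + (alpha - n%:R) = 0)%R by ring.
  by rewrite powRr0 mul1r.
rewrite mulrBr key// lerD2r -(key (edist x z))// ler_pM2l//.
by apply: powR_neg_le => //; exact: ltW.
Qed.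

Section restriction.
Context (mu : measure_rV) (mufin : mu setT < +oo).

Let F m x := \int[mu]_z (tkn m x z)%:E.

Let F_fin m x : F m x \is a fin_num.
Proof.
rewrite ge0_fin_numE; last by apply: integral_ge0 => z _; rewrite lee_fin truncated_riesz_ge0.
apply: (@le_lt_trans _ _ (\int[mu]_z (cst (m.+1%:R^-1 `^ (alpha - n%:R))%:E z))).
  apply: ge0_le_integral => //.
  - by move=> z _; rewrite lee_fin truncated_riesz_ge0.
  - by apply/measurable_EFinP; exact: measurable_truncated_riesz_l.
  - by move=> z _; rewrite lee_fin; apply: truncated_riesz_le_cst => //; rewrite invr_gt0.
by rewrite integral_cst// lte_mul_pinfty// lee_fin powR_ge0.
Qed.

Let mF m : measurable_fun [set: Rn R n] (F m).
Proof.
have sm : sigma_finite setT mu by exact/radon_sigma_finite/finite_radon.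
have := @measurable_integral_snd _ _ (Rn R n) (Rn R n) R mu (fun p => (tkn m p.1 p.2)%:E) sm.
apply; last by move=> p; rewrite lee_fin truncated_riesz_ge0.
apply/measurable_EFinP; apply: measurable_truncated_riesz => i.
  by apply: (@measurableT_comp _ _ _ _ _ _ (fun x : Rn R n => (x : 'rV[R]_n) ord0 i)) => //; exact: measurable_coord.
by apply: (@measurableT_comp _ _ _ _ _ _ (fun x : Rn R n => (x : 'rV[R]_n) ord0 i)) => //; exact: measurable_coord.
Qed.

Let cvgF x : F m x @[m --> \oo] --> U mu x.
Proof.
rewrite /potential.
under [X in _ --> X]eq_integral => z _.
  rewrite (_ : riesz alpha x z = limn (fun m => (tkn m x z)%:E)); last first.
    by apply/esym/cvg_lim => //; exact: (@cvg_truncated_riesz _ _ _ alpha_n x z).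
  over.
apply: cvg_monotone_convergence => //.
- by move=> m; apply/measurable_EFinP; exact: measurable_truncated_riesz_l.
- by move=> m z _; rewrite lee_fin truncated_riesz_ge0.
- by move=> z _ a b ab; exact: truncated_riesz_nd.
Qed.

Let F_tail m x : F m x + \int[mu]_z riesz_tail (m.+1%:R^-1) x z = U mu x.
Proof.
have m0 : (0 < m.+1%:R^-1 :> R)%R by rewrite invr_gt0.
rewrite /F -ge0_integralD//.
- by apply: eq_integral => z _; rewrite riesz_tailK.
- by move=> z _; rewrite lee_fin truncated_riesz_ge0.
- by apply/measurable_EFinP; exact: measurable_truncated_riesz_l.
- by move=> z _; exact: riesz_tail_ge0.
- exact: measurable_riesz_tail.
Qed.

(* Egorov's theorem makes the potentials of the truncated kernels converge
   uniformly on [K]; halving the distances to the points of [K] transports this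
   to the whole space at the cost of the factor [2^(n-alpha)]. *)
Lemma nice_restriction (B : set (Rn R n)) (e : R) : measurable B ->
  (forall x, B x -> U mu x < +oo) -> (0 < e)%R ->
  exists K : set 'rV[R]_n, exists mK : measurable (K : set (Rn R n)),
    [/\ K `<=` B, mu (B `\` K) < e%:E & nice_on K (mrestr mu mK)].
Proof.
move=> mB UB e0; have e20 : (0 < e / 2)%R by rewrite divr_gt0.
have rmu := finite_radon mufin.
have UBfin x : B x -> U mu x \is a fin_num.
  by move=> Bx; rewrite ge0_fin_numE ?UB//; exact: potential_ge0.
(* Half of [e] is spent on the exceptional set of Egorov's theorem, half on the inner approximation
   by a compact set. *)
have [B' [mB' B'e unif]] : exists B', [/\ measurable B', mu B' < (e / 2)%:E &
    {uniform B `\` B', (fun m x => fine (F m x)) @ \oo --> (fun x => fine (U mu x))}].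
  apply: pointwise_almost_uniform => //.
  - move=> m; apply: measurable_funTS.
    by apply: (@measurableT_comp _ _ _ _ _ _ fine) => //; exact: fine_measurable.
  - by apply: le_lt_trans mufin; apply: le_measure; rewrite ?inE.
  - by move=> x Bx; apply: fine_cvg; rewrite fineK ?UBfin//; exact: cvgF.
have [K [cK KB Ke]] := compact_regular mufin (measurableD mB mB') e20.
have mK : measurable (K : set (Rn R n)) by exact: compact_measurable_rV.
exists K, mK; split.
- by move=> x /KB[].
- apply: (@le_lt_trans _ _ (mu (B' `|` ((B `\` B') `\` K)))).
    apply: le_measure; rewrite ?inE//.
    - exact: measurableD.
    - by apply: measurableU => //; apply: measurableD => //; exact: measurableD.
    - by move=> x [Bx nK]; have [B'x|nB'x] := pselect (B' x); [left|right].
  apply: (le_lt_trans (measureU2 _ _ _)) => //.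
    by apply: measurableD => //; exact: measurableD.
  by rewrite (splitr e) EFinD lteD.
have taufin : mrestr mu mK setT < +oo.
  apply: le_lt_trans mufin; rewrite /mrestr setTI; apply: le_measure; rewrite ?inE//.
pose T m x := \int[mu]_(z in K) riesz_tail (m.+1%:R^-1) x z.
have m0 m : (0 < m.+1%:R^-1 :> R)%R by rewrite invr_gt0.
have TK (d : R) : (0 < d)%R -> exists m, forall x, K x -> T m x <= d%:E.
  move=> d0.
  have [m _ /(_ m (leqnn _)) /= hm] : \forall m \near \oo, forall x, (B `\` B') x ->
      (`|fine (U mu x) - fine (F m x)| < d)%R.
    have hP : nbhs ((fun x => fine (U mu x)) : {uniform` (B `\` B') -> R})
        [set h | forall x, (B `\` B') x -> (`|fine (U mu x) - h x| < d)%R].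
      apply/uniform_nbhs; exists [set xy | ball xy.1 d xy.2]; split => //.
      exact: (@entourage_ball R R (PosNum d0)).
    exact: (unif _ hP).
  exists m => x Kx; have BB' := KB x Kx.
  apply: (@le_trans _ _ (\int[mu]_z riesz_tail (m.+1%:R^-1) x z)).
    apply: ge0_subset_integral => //; first exact: measurable_riesz_tail.
    by move=> z _; exact: riesz_tail_ge0.
  have := F_tail m x; have Ufin := UBfin x BB'.1.
  rewrite -(fineK Ufin) -(fineK (F_fin m x)) => h.
  have -> : \int[mu]_z riesz_tail m.+1%:R^-1 x z = (fine (U mu x) - fine (F m x))%:E.
    by rewrite EFinB -h [X in X - _]addeC addeK.
  by rewrite lee_fin (le_trans (ler_norm _))// ltW// hm.
pose c := (2 `^ (n%:R - alpha) : R)%R.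
have c0 : (0 < c)%R by rewrite /c powR_gt0.
have Tall (d : R) : (0 < d)%R -> exists m, forall x, T m x <= d%:E.
  move=> d0; have [K0|/set0P K0] := eqVneq K set0.
    by exists 0%N => x; rewrite /T K0 integral_set0 lee_fin ltW.
  have [m hm] := TK (d / c)%R (divr_gt0 d0 c0).
  (* The truncation radius of this index is [1/(2m+2)], exactly half of [1/(m+1)], as the doubling
     lemma requires. *)
  exists (m.*2.+1) => x.
  (* For [x'] a point of [K] nearest to [x], every [z] in [K] satisfies [|x' - z| <= |x' - x| + |x -
     z| <= 2 |x - z|]. *)
  have [x' /[!inE] Kx' x'min] : exists2 x', x' \in K & forall t, t \in K -> (edist x x' <= edist x t)%R.
    apply: EVT_min_rV => //; apply: continuous_subspaceT.
    apply: (@lipschitz_continuous_rV _ _ (edist x) 1%R) => y y'.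
    by rewrite mul1r [edist y y']edistC edist_triangle.
  have step z : K z -> riesz_tail (m.*2.+2%:R^-1) x z <= c%:E * riesz_tail (m.+1%:R^-1) x' z.
    move=> Kz.
    have -> : (m.+1%:R^-1 = 2 * m.*2.+2%:R^-1 :> R)%R.
      by rewrite -doubleS -muln2 natrM invfM mulrCA divff ?mulr1// pnatr_eq0.
    apply: riesz_tail_doubling; first by rewrite invr_gt0.
    have := x'min z; rewrite inE => /(_ Kz) h.
    by rewrite (le_trans (edist_triangle _ x _))// edistC mulr2n mulrDl mul1r lerD2r.
  rewrite /T.
  apply: (@le_trans _ _ (\int[mu]_(z in K) (c%:E * riesz_tail (m.+1%:R^-1) x' z))).
    apply: ge0_le_integral => //.
    - by move=> z _; apply: riesz_tail_ge0; rewrite invr_gt0.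
    - by apply: measurable_funTS; exact: measurable_riesz_tail.
    - apply: measurable_funTS; apply: measurable_funeM; exact: measurable_riesz_tail.
  rewrite ge0_integralZl_EFin ?(ltW c0)//; last 2 first.
    - by move=> z _; exact: riesz_tail_ge0.
    - by apply: measurable_funTS; exact: measurable_riesz_tail.
  have -> : d%:E = c%:E * (d / c)%:E by rewrite -EFinM mulrC divfK// gt_eqF.
  by apply: lee_wpmul2l; [rewrite lee_fin ltW|exact: hm].
pose FK m x := \int[mu]_(z in K) (tkn m x z)%:E.
have FK0 m x : 0 <= FK m x by apply: integral_ge0 => z _; rewrite lee_fin truncated_riesz_ge0.
have FK_fin m x : FK m x \is a fin_num.
  rewrite ge0_fin_numE//; apply: (@le_lt_trans _ _ (F m x)); last by rewrite -ge0_fin_numE// integral_ge0// => z _; rewrite lee_fin truncated_riesz_ge0.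
  apply: ge0_subset_integral => //.
  - by apply/measurable_EFinP; exact: measurable_truncated_riesz_l.
  - by move=> z _; rewrite lee_fin truncated_riesz_ge0.
have UK m x : U (mrestr mu mK) x = FK m x + T m x.
  rewrite /potential ge0_integral_mrestr//; last 2 first.
    - exact: measurable_riesz_l.
    - by move=> z; exact: riesz_ge0.
  rewrite /FK /T -ge0_integralD//.
  - by apply: eq_integral => z _; rewrite riesz_tailK.
  - by move=> z _; rewrite lee_fin truncated_riesz_ge0.
  - by apply: measurable_funTS; apply/measurable_EFinP; exact: measurable_truncated_riesz_l.
  - by move=> z _; exact: riesz_tail_ge0.
  - by apply: measurable_funTS; exact: measurable_riesz_tail.
have T0 m x : 0 <= T m x by apply: integral_ge0 => z _; exact: riesz_tail_ge0.
have UKfin x : U (mrestr mu mK) x \is a fin_num.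
  have [m hm] := Tall 1%R ltr01; rewrite (UK m) fin_numD FK_fin/= ge0_fin_numE//.
  by rewrite (le_lt_trans (hm x))// ltry.
split => //.
- by rewrite /= /mrestr setICl measure0.
- exists (fun x => fine (U (mrestr mu mK) x)); last by move=> x; rewrite fineK.
  (* The tails are uniformly small on the whole space, so the potential is a uniform limit of the
     Lipschitz functions [FK m]. *)
  apply: uniform_approx_continuous => d d0; have [m hm] := Tall d d0.
  exists (fun x => fine (FK m x)); split; last first.
    move=> x; have Tf : T m x \is a fin_num by rewrite ge0_fin_numE// (le_lt_trans (hm x))// ltry.
    rewrite (UK m) fineD// addrC addKr ger0_norm ?fine_ge0//.
    by rewrite -lee_fin fineK.
  apply: (@lipschitz_continuous_rV _ _ _ (riesz_lip (n:=n) alpha m.+1%:R^-1 * fine (mu K))) => x x'.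
  have muK : mu K \is a fin_num.
    by rewrite ge0_fin_numE//; apply: le_lt_trans mufin; apply: le_measure; rewrite ?inE.
  apply: fine_le_addr; [exact: FK_fin|exact: FK_fin|].
  have -> : (riesz_lip (n:=n) alpha m.+1%:R^-1 * fine (mu K) * edist x x')%:E =
      \int[mu]_(z in K) (riesz_lip (n:=n) alpha m.+1%:R^-1 * edist x x')%:E.
    rewrite integral_cst//.
    suff -> : mu K = (fine (mu K))%:E by rewrite -EFinM mulrAC.
    by rewrite fineK.
  rewrite /FK -ge0_integralD//=.
  - apply: ge0_le_integral => //.
    + by move=> z _; rewrite lee_fin truncated_riesz_ge0.
    + by apply: measurable_funTS; apply/measurable_EFinP; exact: measurable_truncated_riesz_l.
    + apply: emeasurable_funD => //.
      by apply: measurable_funTS; apply/measurable_EFinP; exact: measurable_truncated_riesz_l.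
    + by move=> z _; rewrite -EFinD lee_fin; exact: truncated_riesz_lipschitz.
  - by move=> z _; rewrite lee_fin truncated_riesz_ge0.
  - by apply: measurable_funTS; apply/measurable_EFinP; exact: measurable_truncated_riesz_l.
  - by move=> z _; rewrite lee_fin mulr_ge0 ?edist_ge0// riesz_lip_ge0.
Qed.

End restriction.
End nice_measures.

(** * Subordinated Gaussian approximation of the kernel *)

Section integral_tools.
Local Open Scope ereal_scope.

Import HBNNSimple.

Section density.
Context d (T : measurableType d) (R : realType) (mu nu : {measure set T -> \bar R})
  (p : T -> R) (mp : measurable_fun setT p) (p0 : forall x, (0 <= p x)%R)
  (nuE : forall A, measurable A -> nu A = \int[mu]_(x in A) (p x)%:E).

Let density_nnsfun (f : {nnsfun T >-> R}) :
  \int[nu]_x (f x)%:E = \int[mu]_x ((f x)%:E * (p x)%:E).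
Proof.
under [LHS]eq_integral do rewrite fimfunE -fsumEFin//.
rewrite [LHS]ge0_integral_fsum//; last 2 first.
  - by move=> r; exact/measurable_EFinP/measurableT_comp.
  - by move=> n x _; rewrite EFinM nnfun_muleindic_ge0.
under [RHS]eq_integral.
  move=> x xD; rewrite fimfunE -fsumEFin// ge0_mule_fsuml; last first.
    by move=> r; rewrite EFinM nnfun_muleindic_ge0.
  over.
rewrite [RHS]ge0_integral_fsum//; last 2 first.
  - move=> r; apply: emeasurable_funM; last exact/measurable_EFinP.
    by apply/measurable_EFinP; do 2 apply/measurableT_comp => //.
  - move=> n x _; rewrite EFinM mule_ge0//; first by rewrite nnfun_muleindic_ge0.
    by rewrite lee_fin.
apply: eq_fsbigr => r _.
have mf : measurable (f @^-1` [set r]) by exact: measurable_sfunP.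
rewrite integralZl_indic_nnsfun//= integral_indic//= setIT nuE//.
case: (ltP r 0%R) => r0.
  rewrite (_ : f @^-1` [set r] = set0); last first.
    by rewrite -subset0 => x /= fx; move: r0; rewrite -fx; apply/negP; rewrite -leNgt.
  by rewrite integral_set0 mule0 integral0_eq// => x _; rewrite indicE in_set0 mulr0 mul0e.
rewrite integral_mkcond -ge0_integralZl//=; first last.
- by move=> x _; rewrite erestrict_ge0// => y _; rewrite lee_fin.
- by apply/(measurable_restrictT _ _).1 => //; exact/measurable_EFinP/measurable_funTS.
- apply: eq_integral => x _; rewrite patchE indicE.
  by case: ifP => _; rewrite ?mulr1 ?mule0 ?mulr0 ?mul0e.
Qed.

Lemma integral_density (f : T -> \bar R) : measurable_fun setT f -> (forall x, 0 <= f x) ->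
  \int[nu]_x f x = \int[mu]_x (f x * (p x)%:E).
Proof.
move=> mf f0.
pose f_ := nnsfun_approx measurableT mf.
transitivity (lim (\int[nu]_x (f_ n x)%:E @[n --> \oo])).
  rewrite -monotone_convergence//=.
  - apply: eq_integral => ? /[!inE] xD; apply/esym/cvg_lim => //=.
    exact: cvg_nnsfun_approx.
  - by move=> n; exact/measurable_EFinP/measurable_funTS.
  - by move=> n ? _; rewrite lee_fin.
  - by move=> ? _ ? ? mn; rewrite lee_fin; exact/lefP/nd_nnsfun_approx.
under eq_fun do rewrite density_nnsfun.
rewrite -monotone_convergence//=.
- apply: eq_integral => x _; apply/cvg_lim => //=.
  apply: cvgeZr => //.
  exact: cvg_nnsfun_approx.
- by move=> n; apply: emeasurable_funM; apply/measurable_EFinP.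
- by move=> n ? _; rewrite mule_ge0// lee_fin.
- move=> ? _ ? ? mn; apply: lee_wpmul2r; rewrite lee_fin//.
  exact/lefP/nd_nnsfun_approx.
Qed.
End density.

Section affine.
Context {R : realType}.
Notation leb := (@lebesgue_measure R).

Let aff (c b : R) : measurableTypeR R -> measurableTypeR R := fun x => (c * x + b)%R.

Let measurable_aff c b : measurable_fun setT (aff c b).
Proof. by apply: measurable_funD => //; exact: measurable_funM. Qed.

(** The image of Lebesgue measure under [x -> c x + b], scaled by [c], gives half-open intervals
    their length, so it is Lebesgue measure by uniqueness. *)
Lemma ge0_integral_affine (c b : R) (f : R -> \bar R) : (0 < c)%R ->
  measurable_fun setT f -> (forall x, 0 <= f x) ->
  \int[leb]_x f x = c%:E * \int[leb]_x f (c * x + b)%R.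
Proof.
move=> c0 mf f0.
have E : forall A : set (measurableTypeR R), measurable A ->
    leb A = mscale (NngNum (ltW c0)) (pushforward leb (aff c b)) A.
  move=> m; apply: lebesgue_measure_unique => // _ [[u v]] _ <-.
  transitivity (c%:E * leb (aff c b @^-1` `]u, v])) => //.
  rewrite (_ : aff c b @^-1` _ = `](u - b) / c, (v - b) / c]%classic)%R; last first.
    apply/seteqP; split => x /=; rewrite !in_itv/= /aff ltr_pdivrMr// ler_pdivlMr//.
      by move=> /andP[]; rewrite mulrC -ltrBlDr -lerBrDr => -> ->.
    by rewrite mulrC -ltrBlDr -lerBrDr.
  rewrite !lebesgue_measure_itv/= !lte_fin ltr_pM2r ?invr_gt0// ltrD2r.
  case: ifP => _; last by rewrite mule0.
  rewrite -!EFinB -EFinM; congr EFin.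
  by rewrite -mulrBl mulrCA divff ?gt_eqF// mulr1; ring.
rewrite (eq_measure_integral (mscale (NngNum (ltW c0)) (pushforward leb (aff c b)))); last first.
  by move=> A mA _; exact: (E (measurable_aff c b)).
rewrite ge0_integral_mscale//= ge0_integral_pushforward//.
Qed.

Lemma ge0_integral_scale (c : R) (f : R -> \bar R) : (0 < c)%R ->
  measurable_fun setT f -> (forall x, 0 <= f x) ->
  \int[leb]_(x in `]0%R, +oo[) f x = c%:E * \int[leb]_(x in `]0%R, +oo[) f (c * x)%R.
Proof.
move=> c0 mf f0.
rewrite integral_mkcond (@ge0_integral_affine c 0)//; first last.
- by move=> x; apply: erestrict_ge0.
- apply/(measurable_restrictT _ _).1 => //; exact: measurable_funTS.
congr (_ * _); rewrite [RHS]integral_mkcond.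
apply: eq_integral => x _; rewrite !patchE addr0 !mem_setE.
by rewrite !in_itv/= !andbT pmulr_rgt0.
Qed.

Lemma ge0_integral_shift (s : R) (f : R -> \bar R) :
  measurable_fun setT f -> (forall x, 0 <= f x) ->
  \int[leb]_(x in `]0%R, +oo[) f (x + s)%R = \int[leb]_(x in `]s, +oo[) f x.
Proof.
move=> mf f0.
rewrite [RHS]integral_mkcond (@ge0_integral_affine 1 s)//; first last.
- by move=> x; apply: erestrict_ge0.
- apply/(measurable_restrictT _ _).1 => //; exact: measurable_funTS.
rewrite mul1e [LHS]integral_mkcond.
apply: eq_integral => x _; rewrite !patchE mul1r !mem_setE.
by rewrite !in_itv/= !andbT ltrDr.
Qed.
End affine.
End integral_tools.

Lemma product_pushforward d1 d2 d3 (T1 : measurableType d1) (T2 : measurableType d2)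
    (T3 : measurableType d3) (R : realType) (m1 : {measure set T1 -> \bar R})
    (m2 : {measure set T2 -> \bar R}) (phi : T1 * T2 -> T3) :
  sigma_finite setT m1 -> sigma_finite setT m2 -> measurable_fun setT phi ->
  exists N : {measure set T3 -> \bar R}, forall f : T3 -> \bar R,
    measurable_fun setT f -> (forall x, 0 <= f x)%E ->
    (\int[N]_z f z = \int[m1]_x \int[m2]_y f (phi (x, y)))%E.
Proof.
move=> s1 s2 mphi.
pose M := (sigma_finite_copy s1 \x sigma_finite_copy s2)%E.
unshelve refine (ex_intro _ (pushforward M phi : {measure set T3 -> \bar R}) _).
  exact: mphi.
move=> f mf f0.
rewrite (ge0_integral_pushforward mphi)// preimage_setT.
have mfp : measurable_fun setT (f \o phi) by exact: measurableT_comp.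
exact: (@fubini_tonelli1 _ _ _ _ _ (sigma_finite_copy s1) (sigma_finite_copy s2) _ mfp (fun x => f0 _)).
Qed.

(** * Gaussian integrals *)

Section gauss.
Context {R : realType}.
Local Open Scope ereal_scope.
Notation leb := (@lebesgue_measure R).

(** The heat kernel at time [t] without its normalisation, as a function of the squared distance
    [q]. The factor [t^(-n/2)] is supplied in [heat_mix], so that [heat] does not depend on the
    dimension and is multiplicative over coordinates. *)
Definition heat (t q : R) : R := expR (- q / (2 * t)).

(** Completing the square in [w]: the product of two Gaussian functions is a Gaussian density in
    [w], of variance [t/(t+s)] and mean [- sqrt s y/(t+s)], times a Gaussian function of [y] for the
    added times. *)
Lemma heat_normal (y s t w : R) : (0 <= s)%R -> (0 < t)%R ->
  let sg := Num.sqrt (t / (t + s)) in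
  (heat t ((y + Num.sqrt s * w) ^+ 2) * normal_pdf 0 1 w =
  sg * heat (t + s) (y ^+ 2) * normal_pdf (- (Num.sqrt s * y) / (t + s)) sg w)%R.
Proof.
move=> s0 t0 sg.
have ts0 : (0 < t + s)%R by rewrite ltr_wpDr.
have sg0 : (0 < sg)%R by rewrite sqrtr_gt0 divr_gt0.
have sg2 : (sg ^+ 2 = t / (t + s))%R by rewrite sqr_sqrtr// divr_ge0// ltW.
have s2 : (Num.sqrt s ^+ 2 = s)%R by rewrite sqr_sqrtr.
rewrite !normal_pdfE ?oner_neq0 ?gt_eqF// /normal_fun /normal_peak /heat.
have pk : (Num.sqrt (sg ^+ 2 * pi *+ 2) = sg * Num.sqrt (1 ^+ 2 * pi *+ 2))%R.
  rewrite -mulrnAr sqrtrM ?sqr_ge0// sqrtr_sqr ger0_norm ?(ltW sg0)//.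
  by rewrite expr1n mul1r.
rewrite pk (invfM sg).
set P := (Num.sqrt (1 ^+ 2 * pi *+ 2))^-1%R.
transitivity (P * (expR (- (y + Num.sqrt s * w) ^+ 2 / (2 * t)) * expR (- (w - 0) ^+ 2 / (1 ^+ 2 *+ 2))))%R.
  by rewrite mulrCA.
transitivity (P * (expR (- y ^+ 2 / (2 * (t + s))) * expR (- (w - - (Num.sqrt s * y) / (t + s)) ^+ 2 / (sg ^+ 2 *+ 2))))%R; last first.
  by rewrite /P; field; rewrite !gt_eqF// sqrtr_gt0 expr1n mul1r pmulrn_rgt0// pi_gt0.
congr (_ * _)%R; rewrite -!expRD; congr expR.
rewrite sg2 !mulr2n subr0 expr1n.
set r := Num.sqrt s in s2 *.
rewrite (_ : (- (y + r * w) ^+ 2 = - (y ^+ 2 + y * r * w *+ 2 + s * w ^+ 2))%R); last first.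
  by rewrite -[in RHS]s2; ring.
have -> : ((w - - (r * y) / (t + s)) ^+ 2 = w ^+ 2 + 2 * r * y * w / (t + s) + s * y ^+ 2 / (t + s) ^+ 2)%R.
  have -> : (s * y ^+ 2 = (r * y) ^+ 2)%R by rewrite exprMn s2.
  by field; rewrite gt_eqF.
have -> : (t / (t + s) + t / (t + s) = 2 * (t / (t + s)))%R by rewrite mulrDl !mul1r.
have t1 : t != 0%R by rewrite gt_eqF.
have t2 : (t + s)%R != 0%R by rewrite gt_eqF.
field.
by rewrite t1 t2.
Qed.

Lemma heatD t a b : (heat t (a + b) = heat t a * heat t b)%R.
Proof. by rewrite /heat -expRD opprD mulrDl. Qed.

Lemma heat_ge0 t q : (0 <= heat t q)%R. Proof. exact: expR_ge0. Qed.

Lemma measurable_heat (t : R) : measurable_fun setT (heat t).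
Proof.
by apply: measurableT_comp => //; apply: measurable_funM => //; exact: measurableT_comp.
Qed.

Lemma integral_heat_normal (y s t : R) : (0 <= s)%R -> (0 < t)%R ->
  \int[normal_prob 0 1]_w (heat t ((y + Num.sqrt s * w) ^+ 2))%:E =
  (Num.sqrt (t / (t + s)) * heat (t + s) (y ^+ 2))%:E.
Proof.
move=> s0 t0.
have mh : measurable_fun setT (fun w => heat t ((y + Num.sqrt s * w) ^+ 2)).
  apply: (measurableT_comp (measurable_heat t)); apply: measurable_funX.
  by apply: measurable_funD => //; exact: measurable_funM.
rewrite (@integral_density _ _ _ leb _ (normal_pdf 0 1))//; first last.
- by move=> w; rewrite lee_fin heat_ge0.
- exact/measurable_EFinP.
- by move=> x; exact: normal_pdf_ge0.
- exact: measurable_normal_pdf.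
under eq_integral do rewrite -EFinM heat_normal// EFinM.
rewrite ge0_integralZl//=; first by rewrite integral_normal_pdf mule1.
- by apply/measurable_EFinP; apply: measurable_normal_pdf.
- by move=> w _; rewrite lee_fin normal_pdf_ge0.
- by rewrite lee_fin mulr_ge0// ?sqrtr_ge0 ?heat_ge0.
Qed.

Definition sqnorm {n} (y : 'rV[R]_n) : R := (\sum_(i < n) y ord0 i ^+ 2)%R.

Lemma continuous_sqnorm_shift {n} (c : R) (y : 'rV[R]_n) :
  measurable_fun [set: Rn R n] (fun w : Rn R n => sqnorm (y + c *: (w : 'rV[R]_n))%R).
Proof.
apply: measurable_sum => i /=.
under eq_fun do rewrite mxE [X in (_ + X)%R]mxE.
apply: measurable_funX; apply: measurable_funD => //.
by apply: measurable_funM => //; exact: measurable_coord.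
Qed.

(** The standard Gaussian law, built as a product by induction on the dimension. Besides the total
    mass, what is recorded is the semigroup property of the heat kernel: a Gaussian step of variance
    [s] turns time [t] into [t + s]. The factor [(t/(t+s))^(n/2)] is the ratio of the two
    normalisations. *)
Lemma gauss_exists n : exists G : {measure set (Rn R n) -> \bar R}, G setT = 1 /\
  forall (y : 'rV[R]_n) (s t : R), (0 <= s)%R -> (0 < t)%R ->
  \int[G]_w (heat t (sqnorm (y + Num.sqrt s *: (w : 'rV[R]_n))%R))%:E =
  (Num.sqrt (t / (t + s)) ^+ n * heat (t + s) (sqnorm y))%:E.
Proof.
elim: n => [|n [G [G1 GE]]].
  exists (@dirac _ (Rn R 0) 0%R R); split; first by rewrite /= diracT.
  move=> y s t s0 t0; rewrite integral_dirac//; last first.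
    apply/measurable_EFinP; apply: measurableT_comp; first exact: measurable_heat.
    exact: continuous_sqnorm_shift.
  rewrite diracT mul1e /sqnorm !big_ord0 expr0 mul1r.
  by rewrite /heat !oppr0 !mul0r.
pose phi (p : R * Rn R n) : 'rV[R]_n.+1 := \row_j
  (if unlift ord0 j is Some i then (p.2 : 'rV[R]_n) ord0 i else p.1)%R.
have mphi : measurable_fun setT (phi : _ -> Rn R n.+1).
  apply: measurable_rV => i; under eq_fun do rewrite mxE.
  case: (unlift ord0 i) => [j|].
    exact: (measurableT_comp (measurable_coord j) measurable_snd).
  exact: measurable_fst.
have sG : sigma_finite setT G.
  by apply: radon_sigma_finite; apply: finite_radon; rewrite G1 ltry.
have sN : sigma_finite setT (normal_prob (0:R) 1) by exact: sigma_finiteT.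
have [N NE] := product_pushforward sN sG mphi.
exists N; split.
  have := NE (cst 1) (measurable_cst _) (fun=> lee01).
  rewrite integral_cst// mul1e => ->.
  transitivity (\int[normal_prob (0 : R) 1]_x cst 1 x); last first.
    by rewrite integral_cst// mul1e; exact: probability_setT.
  by apply: eq_integral => x _; rewrite integral_cst// mul1e.
move=> y s t s0 t0; rewrite NE; first last.
- by move=> x; rewrite lee_fin heat_ge0.
- apply/measurable_EFinP; apply: measurableT_comp; first exact: measurable_heat.
  exact: continuous_sqnorm_shift.
pose y' : 'rV[R]_n := \row_i y ord0 (lift ord0 i).
have E w v : heat t (sqnorm (y + Num.sqrt s *: phi (w, v))%R) =
   (heat t ((y ord0 ord0 + Num.sqrt s * w) ^+ 2) * heat t (sqnorm (y' + Num.sqrt s *: v)))%R.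
  rewrite -heatD; congr heat.
  rewrite /sqnorm big_ord_recl; congr (_ + _)%R.
    by rewrite !mxE unlift_none.
  by apply: eq_bigr => i _; rewrite !mxE liftK.
transitivity (\int[normal_prob 0 1]_w ((heat t ((y ord0 ord0 + Num.sqrt s * w) ^+ 2))%:E *
    (Num.sqrt (t / (t + s)) ^+ n * heat (t + s) (sqnorm y'))%:E)).
  apply: eq_integral => w _; rewrite -GE//.
  under eq_integral do rewrite E EFinM.
  rewrite ge0_integralZl//=.
  - apply/measurable_EFinP; apply: measurableT_comp; first exact: measurable_heat.
    exact: continuous_sqnorm_shift.
  - by move=> v _; rewrite lee_fin heat_ge0.
  - by rewrite lee_fin heat_ge0.
rewrite ge0_integralZr//=; first last.
- by rewrite lee_fin mulr_ge0// ?heat_ge0// exprn_ge0.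
- by move=> w _; rewrite lee_fin heat_ge0.
- apply/measurable_EFinP; apply: measurableT_comp; first exact: measurable_heat.
  by apply: measurable_funX; apply: measurable_funD => //; exact: measurable_funM.
rewrite integral_heat_normal// -EFinM; congr EFin.
have -> : heat (t + s) (sqnorm y) = (heat (t + s) (y ord0 ord0 ^+ 2) * heat (t + s) (sqnorm y'))%R.
  rewrite -heatD; congr heat.
  rewrite /sqnorm big_ord_recl; congr (_ + _)%R.
  by apply: eq_bigr => i _; rewrite !mxE.
rewrite [in RHS]exprS -!mulrA; congr (_ * _)%R; exact: mulrCA.
Qed.

End gauss.

(** * Time integrals of the heat kernel and powers of the distance *)

Section time_integral.
Context {R : realType}.
Local Open Scope ereal_scope.
Notation leb := (@lebesgue_measure R).

Lemma measurable_invr : measurable_fun setT (fun x : R => x^-1)%R.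
Proof.
(* The power with exponent [-1] is the inverse on nonnegative numbers; applied to [x^2] and
   multiplied by [x], it gives the inverse everywhere, with the value 0 at 0. *)
apply: (eq_measurable_fun (fun x : R => x * (x ^+ 2) `^ (-1))%R).
  move=> x _; rewrite powR_inv1 ?sqr_ge0//.
  by have [->|x0] := eqVneq x 0%R; [rewrite mul0r invr0|rewrite expr2; field].
apply: measurable_funM => //; apply: (measurableT_comp (measurable_powR (-1))).
exact: measurable_funX.
Qed.

Lemma measurable_heat_time q : measurable_fun setT (heat^~ q : R -> R).
Proof.
apply: measurableT_comp => //; apply: measurable_funM => //.
apply: (measurableT_comp measurable_invr).
exact: measurable_funM.
Qed.

Lemma continuous_powR_gt0 (p x : R) : (0 < x)%R -> {for x, continuous ((@powR R)^~ p)}.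
Proof.
move=> x0; apply: differentiable_continuous; apply/derivable1_diffP.
by have [] := is_derive1_powR p x0.
Qed.

Lemma integral_powR_tail (b r : R) : (0 < b)%R -> (0 < r)%R ->
  \int[leb]_(t in `]r, +oo[) (t `^ (- b - 1))%:E = (r `^ (- b) / b)%:E.
Proof.
move=> b0 r0; rewrite integral_itv_obnd_cbnd//; last first.
  by apply/measurable_funTS/measurable_EFinP; exact: measurable_powR.
pose F (x : R) : R := (- b^-1 * x `^ (- b))%R.
have dF (x : R) : (0 < x)%R -> is_derive x 1%R F (x `^ (- b - 1))%R.
  move=> x0; have dp := is_derive1_powR (- b) x0.
  have -> : (x `^ (- b - 1) = - b^-1 *: (- b * x `^ (- b - 1)))%R.
    by rewrite /GRing.scale/= mulrA mulrNN mulVf ?mul1r// gt_eqF.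
  exact: is_deriveZ.
have cF (x : R) : (0 < x)%R -> {for x, continuous F}.
  move=> x0; apply: differentiable_continuous; apply/derivable1_diffP.
  by have [] := dF _ x0.
rewrite (@ge0_continuous_FTC2y _ _ F r 0).
- by rewrite sub0e -EFinN /F mulNr opprK mulrC.
- by move=> x _; exact: powR_ge0.
- apply: continuous_in_subspaceT => x /[!inE] /=; rewrite in_itv/= andbT => rx.
  by apply: continuous_powR_gt0; exact: lt_le_trans rx.
- rewrite -[X in _ --> X](mulr0 (- b^-1)%R); apply: cvgMr.
  apply/cvgrPdist_le => e e0; near=> x.
  have x0 : (0 < x)%R by near: x; exact: nbhs_pinfty_gt.
  rewrite sub0r normrN ger0_norm ?powR_ge0// powRN -[leRHS]invrK lef_pV2 ?posrE ?invr_gt0//; last exact: powR_gt0.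
  have xe : ((e^-1) `^ (b^-1) <= x)%R by near: x; exact: nbhs_pinfty_ge.
  have : ((e^-1 `^ b^-1) `^ b <= x `^ b)%R by apply: ge0_ler_powR; rewrite ?nnegrE ?powR_ge0// ltW.
  by rewrite -powRrM mulVf ?gt_eqF// powRr1// invr_ge0 ltW.
- by move=> x rx; have [] := dF x (lt_trans r0 rx).
- by apply: cvg_at_right_filter; exact: cF.
- move=> x; rewrite in_itv/= andbT => rx.
  by rewrite derive1E; have [_ ->] := dF x (lt_trans r0 rx).
Unshelve. all: by end_near. Qed.

(** By the substitution [u = q/(2t)] this is [2^b Gamma(b) q^(-b)] for positive [b] and [q]. The
    power of [q] comes from scaling, the constant is shown to be finite and positive, and at [q = 0]
    the integral diverges, as the kernel does on the diagonal. *)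
Definition time_integral (b q : R) : \bar R :=
  \int[leb]_(t in `]0%R, +oo[) (t `^ (- b - 1) * heat t q)%:E.

Lemma measurable_time_integrand (p q : R) :
  measurable_fun setT (fun t : R => (t `^ p * heat t q)%R%:E).
Proof.
apply/measurable_EFinP; apply: measurable_funM; first exact: measurable_powR.
exact: measurable_heat_time.
Qed.

Lemma time_integral_scale b q : (0 < q)%R ->
  time_integral b q = (q `^ (- b))%:E * time_integral b 1.
Proof.
move=> q0; rewrite /time_integral (ge0_integral_scale q0)//; first last.
- by move=> x; rewrite lee_fin mulr_ge0// ?powR_ge0 ?heat_ge0.
- exact: measurable_time_integrand.
rewrite -ge0_integralZl//=; first last.
- by rewrite lee_fin ltW.
- by move=> x _; rewrite lee_fin mulr_ge0// ?powR_ge0 ?heat_ge0.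
- apply: measurable_funTS; apply: (measurableT_comp (measurable_time_integrand _ _)).
  exact: measurable_funM.
rewrite -ge0_integralZl//=; first last.
- by rewrite lee_fin powR_ge0.
- by move=> x _; rewrite lee_fin mulr_ge0// ?powR_ge0 ?heat_ge0.
- by apply: measurable_funTS; apply: measurable_time_integrand.
apply: eq_integral => t; rewrite inE/= in_itv/= andbT => t0.
rewrite -!EFinM; congr EFin.
rewrite powRM ?(ltW q0) ?(ltW t0)// !mulrA; congr (_ * _ * _)%R.
  transitivity (q `^ (1 + (- b - 1)))%R; last by congr (_ `^ _)%R; ring.
  by rewrite (@powRD _ q 1 (- b - 1)) ?(gt_eqF q0) ?implybT// powRr1// ltW.
by rewrite /heat; congr expR; field; rewrite !gt_eqF.
Qed.

Lemma time_integral_fin b : (0 < b)%R -> exists C : R, time_integral b 1 <= C%:E.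
Proof.
move=> b0.
have [k bk] : exists k : nat, (b + 1 <= k.+1%:R)%R.
  exists (Num.bound (b + 1)); rewrite ltW// (lt_trans (archi_boundP _)) ?ltr_nat//.
  by rewrite addr_ge0 ?ltW.
(* With [N = k+1 >= b + 1], the estimate [exp(1/(2t)) = exp(1/(2tN))^N >= (1/(2tN))^N] bounds the
   integrand on []0, 1]] by [(2N)^N]. *)
pose C0 : R := ((2 * k.+1%:R) ^+ k.+1)%R.
exists (C0 + 1 `^ (- b) / b)%R.
rewrite /time_integral.
have -> : `]0%R, +oo[%classic = `]0%R, 1%R] `|` `]1%R, +oo[ :> set R.
  by apply/seteqP; split => x /=; rewrite !in_itv/= !andbT; case: (ltP 1 x)%R => h; lra.
have mf := measurable_time_integrand (- b - 1) 1.
rewrite ge0_integral_setU//=; first last.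
- by apply/disj_setPS => x [] /=; rewrite !in_itv/= andbT => /andP[_ h] /(le_lt_trans h); rewrite ltxx.
- by move=> x _; rewrite lee_fin mulr_ge0// ?powR_ge0 ?heat_ge0.
- exact: measurable_funTS.
rewrite EFinD leeD//.
- apply: (@le_trans _ _ (\int[leb]_(t in `]0%R, 1%R]) C0%:E)).
    apply: ge0_le_integral => //=.
    + by move=> x _; rewrite lee_fin mulr_ge0// ?powR_ge0 ?heat_ge0.
    + exact: measurable_funTS.
    + move=> t; rewrite in_itv/= => /andP[t0 t1]; rewrite lee_fin.
      have h1 : (t `^ (- b - 1) <= (t^-1) ^+ k.+1)%R.
        rewrite -opprD -mulN1r powRrM powR_inv1 ?(ltW t0)// -powR_mulrn ?invr_ge0 ?(ltW t0)//.
        by apply: ler_powR => //; rewrite invf_ge1.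
      have h2 : ((t^-1 / (2 * k.+1%:R)) ^+ k.+1 <= expR (1 / (2 * t)))%R.
        have -> : (1 / (2 * t) = (t^-1 / (2 * k.+1%:R)) * k.+1%:R)%R.
          have k0 : (k.+1%:R : R) != 0%R by rewrite pnatr_eq0.
          move: (k.+1%:R) k0 => N k0; have t2 : t != 0%R by rewrite gt_eqF.
          by field; rewrite k0 t2.
        rewrite expRM_natr lerXn2r ?nnegrE ?expR_ge0 ?divr_ge0 ?invr_ge0 ?(ltW t0)//.
        by rewrite (le_trans _ (expR_ge1Dx _))// lerDr.
      rewrite /heat mulNr expRN ler_pdivrMr ?expR_gt0// (le_trans h1)//.
      rewrite -ler_pdivrMl ?exprn_gt0// (le_trans _ h2)//.
      by rewrite expr_div_n /C0 mulrC.
  by rewrite integral_cst//= lebesgue_measure_itv/= lte_fin ltr01 sube0 mule1.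
- rewrite -integral_powR_tail//; apply: ge0_le_integral => //=.
  + by move=> x _; rewrite lee_fin mulr_ge0// ?powR_ge0 ?heat_ge0.
  + exact: measurable_funTS.
  + by apply/measurable_funTS/measurable_EFinP; exact: measurable_powR.
  + move=> t; rewrite in_itv/= andbT => t1; rewrite lee_fin ler_piMr ?powR_ge0//.
    by rewrite /heat -[leRHS]expR0 ler_expR mulNr oppr_le0 divr_ge0// mulr_ge0//; lra.
Qed.

Lemma heat_le1 (t q : R) : (0 <= t)%R -> (0 <= q)%R -> (heat t q <= 1)%R.
Proof.
by move=> t0 q0; rewrite /heat -[leRHS]expR0 ler_expR mulNr oppr_le0 divr_ge0// mulr_ge0.
Qed.

Lemma time_integral_gt0 b : (0 < b)%R -> 0 < time_integral b 1.
Proof.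
move=> b0; apply: (@lt_le_trans _ _ (\int[leb]_(t in `]1%R, +oo[) (expR (- 1) * t `^ (- b - 1))%:E)).
  under eq_integral do rewrite EFinM.
  rewrite ge0_integralZl//=.
  - by rewrite integral_powR_tail// -EFinM lte_fin mulr_gt0// ?expR_gt0// divr_gt0// powR1.
  - by apply/measurable_funTS/measurable_EFinP; exact: measurable_powR.
  - by move=> x _; rewrite lee_fin powR_ge0.
apply: (@le_trans _ _ (\int[leb]_(t in `]1%R, +oo[) (t `^ (- b - 1) * heat t 1)%:E)).
  apply: ge0_le_integral => //=.
  - by move=> t ?; rewrite lee_fin mulr_ge0// ?powR_ge0 ?expR_ge0.
  - by apply: measurable_funTS; apply/measurable_EFinP; apply: measurable_funM => //; exact: measurable_powR.
  - by apply: measurable_funTS; apply: measurable_time_integrand.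
  - move=> t; rewrite in_itv/= andbT => t1; rewrite lee_fin mulrC ler_wpM2l ?powR_ge0//.
    by rewrite ler_expR ler_pdivlMr; lra.
apply: ge0_subset_integral => //=.
- by apply: measurable_funTS; apply: measurable_time_integrand.
- by move=> x _; rewrite lee_fin mulr_ge0// ?powR_ge0 ?heat_ge0.
- by move=> x /=; rewrite !in_itv/= !andbT; exact: lt_trans.
Qed.

Lemma time_integral0 b : (0 < b)%R -> time_integral b 0 = +oo.
Proof.
move=> b0; apply/eqyP => A A0.
(* Solves [r^(-b) / b = A], so the part of the integral beyond [r] already equals [A]. *)
pose r := ((A * b)%R `^ (- b^-1))%R.
have r0 : (0 < r)%R by rewrite powR_gt0// mulr_gt0.
have -> : A%:E = \int[leb]_(t in `]r, +oo[) (t `^ (- b - 1))%:E.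
  rewrite integral_powR_tail//; congr EFin.
  rewrite /r -powRrM mulrNN mulVf ?gt_eqF// powRr1 ?mulr_ge0 ?ltW//.
  by rewrite mulfK// gt_eqF.
rewrite /time_integral.
under [X in _ <= X]eq_integral do rewrite /heat oppr0 mul0r expR0 mulr1.
apply: ge0_subset_integral => //=.
- by apply/measurable_funTS/measurable_EFinP; exact: measurable_powR.
- by move=> x _; rewrite lee_fin powR_ge0.
- by move=> x /=; rewrite !in_itv/= !andbT; exact: lt_trans.
Qed.

End time_integral.

(** * The Pareto subordinator *)

Section subordination.
Context {R : realType}.
Local Open Scope ereal_scope.
Notation leb := (@lebesgue_measure R).

(** The integrand may blow up at [a], so the fundamental theorem is applied on [[u k, b]] and
    carried to the limit by monotone convergence, for which nonnegativity suffices. *)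
Lemma ge0_FTC_oc (f F : R -> R) (a b : R) : (a < b)%R -> measurable_fun setT f ->
  (forall x, (a < x)%R -> (0 <= f x)%R) ->
  (forall x, (a < x)%R -> {for x, continuous f}) ->
  (forall x, (a < x)%R -> is_derive x 1%R F (f x)) -> F x @[x --> a^'+] --> F a ->
  \int[leb]_(x in `]a, b]) (f x)%:E = (F b - F a)%:E.
Proof.
move=> ab mf f0 cf dF Fa.
pose u (k : nat) : R := (a + (b - a) / k.+2%:R)%R.
have ua k : (a < u k)%R by rewrite ltrDl divr_gt0// subr_gt0.
have ub k : (u k < b)%R.
  rewrite /u -ltrBrDl ltr_pdivrMr// ltr_pMr ?subr_gt0// ltr1n//.
have u_a : u k @[k --> \oo] --> a.
  rewrite -[X in _ --> X]addr0; apply: cvgD; first exact: cvg_cst.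
  rewrite -[X in _ --> X](mulr0 (b - a)%R); apply: cvgMr.
  apply/cvgrPdist_lt => e e0; near=> k; rewrite sub0r normrN ger0_norm//.
  apply: (@le_lt_trans _ _ (k.+1%:R^-1)%R).
    by rewrite lef_pV2 ?posrE// ler_nat.
  by near: k; exact: (near_infty_natSinv_lt (PosNum e0)).
have cF x : (a < x)%R -> {for x, continuous F}.
  move=> ax; apply: differentiable_continuous; apply/derivable1_diffP.
  by have [] := dF _ ax.
have U : `]a, b]%classic = \bigcup_k `[u k, b]%classic :> set R.
  apply/seteqP; split => x /=; rewrite in_itv/=; last first.
    by move=> [k _] /=; rewrite in_itv/= => /andP[h ->]; rewrite (lt_le_trans (ua k)).
  move=> /andP[ax xb].
  have : \forall k \near \oo, (u k < x)%R by apply: (cvgr_lt a).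
  by case=> k _ /(_ k (leqnn _)) /= h; exists k => //=; rewrite in_itv/= xb ltW.
have lim1 : (\int[leb]_(x in `[u k, b]) (f x)%:E) @[k --> \oo] --> \int[leb]_(x in `]a, b]) (f x)%:E.
  rewrite U; apply: ge0_nondecreasing_set_cvg_integral.
  - move=> i j ij; apply/subsetPset => x /=; rewrite !in_itv/= => /andP[h ->].
    rewrite andbT (le_trans _ h)// lerD2l ler_pM2l ?subr_gt0// lef_pV2 ?posrE// ler_nat.
    by rewrite !ltnS.
  - by move=> i; exact: measurable_itv.
  - by move=> i; apply: measurable_funTS; apply/measurable_EFinP.
  - by move=> i x /=; rewrite in_itv/= => /andP[h _]; rewrite lee_fin f0// (lt_le_trans (ua i)).
have lim2 : (F b - F (u k))%:E @[k --> \oo] --> (F b - F a)%:E.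
  apply: cvg_EFin; first by near=> k.
  apply: cvgB; first exact: cvg_cst.
  by move/cvg_at_rightP : Fa; apply; split.
apply: (cvg_unique _ lim1); first exact: ereal_hausdorff.
rewrite (_ : (fun k => _) = (fun k => (F b - F (u k))%:E))//; apply/funext => k.
rewrite (@continuous_FTC2 _ f F)//.
- apply: continuous_in_subspaceT => x /[!inE] /=; rewrite in_itv/= => /andP[h _].
  by apply: cf; exact: lt_le_trans h.
- split.
  + by move=> x; rewrite in_itv/= => /andP[h _]; have [] := dF x (lt_trans (ua k) h).
  + by apply: cvg_at_right_filter; exact: cF.
  + by apply: cvg_at_left_filter; apply: cF.
- move=> x; rewrite in_itv/= => /andP[h _].
  by rewrite derive1E; have [_ ->] := dF x (lt_trans (ua k) h).
Unshelve. all: by end_near. Qed.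

(* As a function of a uniform variable [u], [subordinator a rho u] has the Pareto law of index [a] on
   [rho, +oo[ for [a < 1], and is the constant [rho] for [a = 1]. Averaging [(t - S)^(a - 1)] over this law
   [S] gives [delayed a rho t], which is at most [t^(a - 1)]: this is where [alpha <= 2] enters. *)
Definition subordinator (a rho u : R) : R :=
  (if a < 1 then Num.max rho (rho * u `^ (- a^-1)) else rho)%R.

Lemma measurable_subordinator a rho : measurable_fun setT (subordinator a rho).
Proof.
rewrite /subordinator; case: (a < 1)%R => //; apply: measurable_maxr => //.
by apply: measurable_funM => //; exact: measurable_powR.
Qed.

Lemma subordinator_ge a rho u : (rho <= subordinator a rho u)%R.
Proof. by rewrite /subordinator; case: ifP; rewrite ?le_max ?lexx. Qed.

Definition delayed (a rho t : R) : R :=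
  (if rho < t then (if a < 1 then (t - rho) `^ a / t else 1) else 0)%R.

Lemma powR_le0_anti (p u v : R) : (p <= 0)%R -> (0 < u)%R -> (u <= v)%R -> (v `^ p <= u `^ p)%R.
Proof.
move=> p0 u0 uv; have v0 := lt_le_trans u0 uv.
rewrite -[p]opprK !(powRN _ (- p)) lef_pV2 ?posrE ?powR_gt0//.
by apply: ge0_ler_powR; rewrite ?nnegrE ?oppr_ge0 ?(ltW u0) ?(ltW v0).
Qed.

Lemma powR_split (p t : R) : (0 < t)%R -> (t `^ p = t * t `^ (p - 1))%R.
Proof.
move=> t0; rewrite -{2}(powRr1 (ltW t0)) -(@powRD _ t 1 (p - 1)) ?(gt_eqF t0) ?implybT//.
by congr (_ `^ _)%R; ring.
Qed.

Lemma integral_subordinator (a rho t : R) : (0 < a <= 1)%R -> (0 < rho)%R ->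
  \int[uniform_prob (@ltr01 R)]_u
    (if (subordinator a rho u < t)%R then (t - subordinator a rho u) `^ (a - 1) else 0)%R%:E =
  (delayed a rho t)%:E.
Proof.
move=> /andP[a0 a1] r0; rewrite /delayed; case: (ltP rho t) => [rt|tr]; last first.
  rewrite integral0_eq// => u _; rewrite ltNge (le_trans tr)//; exact: subordinator_ge.
rewrite /subordinator; case: (ltP a 1%R) => [{}a1|a1']; last first.
  have -> : a = 1%R by apply/le_anti; rewrite a1.
  rewrite rt subrr; under eq_integral do rewrite powRr0.
  by rewrite integral_cst//= mul1e; exact: probability_setT.
have ms := measurable_subordinator a rho; rewrite /subordinator a1 in ms.
have ai : (0 < a^-1)%R by rewrite invr_gt0.
have t0 := lt_trans r0 rt.
have mg : measurable_fun setT (fun u : R =>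
    (if Num.max rho (rho * u `^ (- a^-1)) < t
     then (t - Num.max rho (rho * u `^ (- a^-1))) `^ (a - 1) else 0)%R%:E).
  apply/measurable_EFinP; apply: measurable_fun_if => //.
  + by apply: measurable_fun_ltr.
  + apply: measurable_funTS; apply: (measurableT_comp (measurable_powR _)).
    exact: measurable_funB.
rewrite integral_uniform//; last first.
  by move=> u; rewrite lee_fin; case: ifP => // _; exact: powR_ge0.
rewrite subr0 invr1 mul1e -integral_itv_obnd_cbnd; last by apply: measurable_funTS.
(* For [u <= u0] the delay is at least [t] and the integrand is zero; for [u0 < u <= 1] the delay is
   [rho u^(-1/a)] and stays below [t]. *)
pose u0 : R := ((rho / t) `^ a)%R.
have u00 : (0 < u0)%R by rewrite powR_gt0// divr_gt0.
have u01 : (u0 < 1)%R.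
  have -> : (1 = (1 : R) `^ a)%R by rewrite powR1.
  rewrite /u0; apply: gt0_ltr_powR; rewrite ?nnegrE ?divr_ge0 ?(ltW r0) ?(ltW t0)//.
  by rewrite ltr_pdivrMr// mul1r.
have u0i : (u0 `^ a^-1 = rho / t)%R by rewrite /u0 -powRrM mulfV ?gt_eqF// powRr1// divr_ge0 ?ltW.
pose h (u : R) : R := ((t - rho * u `^ (- a^-1)) `^ (a - 1))%R.
have lt_u0 u : (u0 < u)%R -> (0 < t - rho * u `^ (- a^-1))%R.
  move=> uu; have uu0 := lt_trans u00 uu.
  rewrite subr_gt0 powRN ltr_pdivrMr ?powR_gt0// mulrC -ltr_pdivrMr// -u0i.
  by apply: gt0_ltr_powR; rewrite ?nnegrE// ltW.
transitivity (\int[leb]_(u in `]u0, 1%R]) (h u)%:E).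
  rewrite integral_mkcond [RHS]integral_mkcond; apply: eq_integral => u _.
  rewrite !patchE !mem_setE !in_itv/=.
  case: (ltP u0 u) => /= [uu|uu]; last first.
    case: ifP => // /andP[u_gt0 _].
    have tu : (t <= rho * u `^ (- a^-1))%R.
      rewrite powRN ler_pdivlMr ?powR_gt0// mulrC -ler_pdivlMr// -u0i.
      by apply: ge0_ler_powR; rewrite ?nnegrE ?(ltW u_gt0) ?(ltW ai) ?(ltW u00).
    by rewrite ltNge le_max tu orbT.
  rewrite (lt_trans u00 uu)/=; case: ifP => // u1.
  have ru : (rho <= rho * u `^ (- a^-1))%R.
    rewrite ler_pMr//; have -> : (1 = (1 : R) `^ (- a^-1))%R by rewrite powR1.
    apply: powR_le0_anti => //.
    - by rewrite oppr_le0 ltW.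
    - exact: lt_trans uu.
  by rewrite (max_idPr ru) -subr_gt0 lt_u0.
(* Factoring [u^(1/a)] out of the base shows that [F] is an antiderivative of [h]: the powers of [u]
   cancel because [(a-1)/a + (1/a - 1) = 0]. It vanishes at [u0] and takes the value
   [(t - rho)^a / t] at 1. *)
pose F (u : R) : R := (t^-1 * (t * u `^ a^-1 - rho) `^ a)%R.
transitivity ((F 1 - F u0)%:E); last first.
  rewrite /F powR1 mulr1 u0i mulrCA divff ?gt_eqF// mulr1 subrr powR0 ?gt_eqF// mulr0 subr0.
  by rewrite mulrC.
apply: ge0_FTC_oc => //.
- apply: (measurableT_comp (measurable_powR _)); apply: measurable_funB => //.
  by apply: measurable_funM => //; exact: measurable_powR.
- by move=> u _; exact: powR_ge0.
- move=> u uu; apply: (@continuous_comp _ _ _ (fun u : R => t - rho * u `^ (- a^-1))%R (fun x : R => x `^ (a - 1))%R).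
    apply: cvgB; first exact: cvg_cst.
    by apply: cvgMr; apply: continuous_powR_gt0; exact: lt_trans uu.
  by apply: continuous_powR_gt0; exact: lt_u0.
- move=> u uu; have uu0 := lt_trans u00 uu.
  have ut : (0 < t * u `^ a^-1 - rho)%R.
    have := lt_u0 u uu; rewrite !subr_gt0 powRN ltr_pdivrMr ?powR_gt0//.
  have d1 := is_derive1_powR (a^-1) uu0.
  have d2 := is_derive1_powR a ut.
  have d3 : is_derive u 1%R (fun x => t * x `^ a^-1 - rho)%R (t * (a^-1 * u `^ (a^-1 - 1)))%R.
    rewrite -[X in is_derive _ _ _ X]subr0; apply: is_deriveB.
  have d4 := @is_derive1_comp R ((@powR R)^~ a) (fun x => t * x `^ a^-1 - rho)%R u _ _ d2 d3.
  have -> : h u = (t^-1 *: (a * (t * u `^ a^-1 - rho) `^ (a - 1) * (t * (a^-1 * u `^ (a^-1 - 1)))))%R.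
    have -> : (t * u `^ a^-1 - rho = u `^ a^-1 * (t - rho * u `^ (- a^-1)))%R.
      rewrite mulrBr (mulrC _ t) mulrCA powRN mulfV ?mulr1// gt_eqF// powR_gt0//.
    rewrite powRM ?powR_ge0 ?(ltW (lt_u0 _ _))// -powRrM -/(h u).
    have E : (u `^ (a^-1 * (a - 1)) * u `^ (a^-1 - 1) = 1)%R.
      rewrite -powRD ?(gt_eqF uu0) ?implybT//.
      by rewrite mulrBr mulVf ?gt_eqF// mulr1 addrC subrKA subrr powRr0.
    rewrite /GRing.scale/=.
    transitivity (h u * (u `^ (a^-1 * (a - 1)) * u `^ (a^-1 - 1)))%R; first by rewrite E mulr1.
    have a2 : a != 0%R by rewrite gt_eqF.
    have t2 : t != 0%R by rewrite gt_eqF.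
    move: (h u) (u `^ _)%R (u `^ _)%R => A B C.
    by field; rewrite a2 t2.
  exact: is_deriveZ.
- have -> : F u0 = 0%R.
    by rewrite /F u0i mulrCA divff ?gt_eqF// mulr1 subrr powR0 ?gt_eqF// mulr0.
  apply/cvgrPdist_le => e e0; near=> x.
  have ux : (u0 < x)%R by near: x; exact: nbhs_right_gt.
  rewrite sub0r normrN ger0_norm; last by rewrite mulr_ge0 ?invr_ge0 ?powR_ge0// ltW.
  rewrite /F mulrC ler_pdivrMr//.
  have xl : (x `^ a^-1 < (rho + (e * t) `^ a^-1) / t)%R.
    near: x; apply: (cvgr_lt (u0 `^ a^-1)%R).
      by apply: cvg_at_right_filter; exact: continuous_powR_gt0.
    by rewrite u0i ltr_pM2r ?invr_gt0// ltrDl powR_gt0// mulr_gt0.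
  have xg : (0 <= t * x `^ a^-1 - rho)%R.
    rewrite subr_ge0 mulrC -ler_pdivrMr// -u0i.
    by apply: ge0_ler_powR; rewrite ?nnegrE ?(ltW ai) ?(ltW u00) ?(ltW (lt_trans u00 ux)) ?(ltW ux).
  rewrite -[leRHS](powRr1 (ltW (mulr_gt0 e0 t0))) -(mulVf (negbT (gt_eqF a0))) powRrM.
  apply: ge0_ler_powR; rewrite ?nnegrE ?(ltW a0) ?powR_ge0//.
  by move: xl; rewrite ltr_pdivlMr// => /ltW xl; rewrite lerBlDl mulrC.
Unshelve. all: by end_near. Qed.

(** For [a < 1], writing each power of exponent [a] as the base times a power of exponent
    [a - 1 <= 0] gives [t^a - (t-rho)^a <= rho t^(a-1)]. For [a = 1] the defect is the indicator of
    [t <= rho], at most [(rho/t)^b]. In both cases [b] exceeds [a], so that the approximation error,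
    of order [rho^b], is beaten by the gap of order [rho^a] in [kernel_gap]. *)
Lemma delayed_bounds (a rho t : R) : (0 < a <= 1)%R -> (0 < rho)%R -> (0 < t)%R ->
  let b : R := if (a < 1)%R then 1%R else 2%R in
  [/\ (0 <= delayed a rho t)%R, (delayed a rho t <= t `^ (a - 1))%R &
    (t `^ (a - 1) <= delayed a rho t + rho `^ b * t `^ (a - 1 - b))%R].
Proof.
move=> /andP[a0 a1] r0 t0; rewrite /delayed.
case: (ltP a 1%R) => [{}a1|a1'] /=; last first.
  have -> : a = 1%R by apply/le_anti; rewrite a1.
  rewrite subrr powRr0; case: ltP => [rt|tr]; split; rewrite ?lerDl ?mulr_ge0 ?powR_ge0//.
  rewrite add0r sub0r powRN ler_pdivlMr ?powR_gt0// mul1r.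
  by apply: ge0_ler_powR; rewrite ?nnegrE ?(ltW t0) ?(ltW r0).
rewrite (powRr1 (ltW r0)); case: ltP => [rt|tr].
  have tr0 : (0 < t - rho)%R by rewrite subr_gt0.
  split.
  - by rewrite divr_ge0 ?powR_ge0// ltW.
  - rewrite ler_pdivrMr// mulrC -powR_split//.
    by apply: ge0_ler_powR; rewrite ?nnegrE ?ltW// gtrBl.
  - rewrite -(ler_pM2r t0) mulrDl divfK ?gt_eqF// mulrC -powR_split//.
    rewrite -mulrA (mulrC _ t) -powR_split//.
    rewrite (powR_split a t0) (powR_split a tr0) -lerBlDr -mulrBl.
    apply: ler_wpM2l; first exact: ltW.
    by apply: powR_le0_anti; rewrite // ?gerBl ?subr_le0 ?(ltW a1) ?(ltW r0).
split; rewrite ?powR_ge0// add0r (powR_split (a - 1) t0).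
by rewrite ler_wpM2r ?powR_ge0.
Qed.

Lemma delayed0 (a rho t : R) : (t <= rho)%R -> delayed a rho t = 0%R.
Proof. by rewrite /delayed ltNge => ->. Qed.

Lemma measurable_delayed a rho : measurable_fun setT (delayed a rho).
Proof.
rewrite /delayed; apply: measurable_fun_if => //; first exact: measurable_fun_ltr.
case: (a < 1)%R => //; apply: measurable_funTS; apply: measurable_funM; last exact: measurable_invr.
by apply: (measurableT_comp (measurable_powR _)); exact: measurable_funB.
Qed.
End subordination.

(** * Gaussian mixtures *)

Section heat_potentials.
Context {R : realType} {n : nat}.
Local Open Scope ereal_scope.
Notation leb := (@lebesgue_measure R).
Notation measure_rV := {measure set (Rn R n) -> \bar R}.
Implicit Types (g : R -> R) (q s t : R).

(* Gaussian mixtures; [g t = t^(alpha/2 - 1)] gives a multiple of the Riesz kernel, and running the time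
   of this mixture after an independent random delay [S] replaces [g] by [delayed]. *)
Definition heat_mix (g : R -> R) (q : R) : \bar R :=
  \int[leb]_(t in `]0%R, +oo[) (g t * t `^ (- (n%:R / 2)) * heat t q)%:E.

Lemma heat_mixE g q : heat_mix g q =
  \int[leb]_t (if 0 < t then g t * t `^ (- (n%:R / 2)) * heat t q else 0)%R%:E.
Proof.
rewrite /heat_mix integral_mkcond; apply: eq_integral => t _.
by rewrite patchE mem_setE in_itv/= andbT; case: ifP.
Qed.

Let measurable_pos d (T : measurableType d) (g h : T -> R) : measurable_fun setT g ->
  measurable_fun setT h -> measurable_fun setT (fun p => if 0 < h p then g p else 0)%R.
Proof.
by move=> mg mh; apply: measurable_fun_if => //; [exact: measurable_fun_ltr|exact: measurable_funTS].
Qed.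

Lemma heat_mix_ge0 g q : (forall t, (0 < t)%R -> (0 <= g t)%R) -> 0 <= heat_mix g q.
Proof.
move=> g0; apply: integral_ge0 => t /=; rewrite in_itv/= andbT => t0.
by rewrite lee_fin !mulr_ge0// ?powR_ge0 ?heat_ge0 ?g0.
Qed.

Lemma measurable_mix_integrand g q : measurable_fun setT g ->
  measurable_fun setT (fun t => (g t * t `^ (- (n%:R / 2)) * heat t q)%R).
Proof.
move=> mg; apply: measurable_funM; last exact: measurable_heat_time.
by apply: measurable_funM => //; exact: measurable_powR.
Qed.

Lemma heat_mix_le g g' q : measurable_fun setT g -> measurable_fun setT g' ->
  (forall t, (0 < t)%R -> (0 <= g t <= g' t)%R) -> heat_mix g q <= heat_mix g' q.
Proof.
move=> mg mg' gg; apply: ge0_le_integral => //=.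
- move=> t; rewrite in_itv/= andbT => /gg/andP[g0 _].
  by rewrite lee_fin !mulr_ge0// ?powR_ge0 ?heat_ge0.
- by apply: measurable_funTS; apply/measurable_EFinP; exact: measurable_mix_integrand.
- by apply: measurable_funTS; apply/measurable_EFinP; exact: measurable_mix_integrand.
- move=> t; rewrite in_itv/= andbT => /gg/andP[g0 gt].
  by rewrite lee_fin -!mulrA ler_wpM2r// mulr_ge0 ?powR_ge0 ?heat_ge0.
Qed.

Lemma heat_mixD g g' q : measurable_fun setT g -> measurable_fun setT g' ->
  (forall t, (0 < t)%R -> (0 <= g t)%R) -> (forall t, (0 < t)%R -> (0 <= g' t)%R) ->
  heat_mix (fun t => g t + g' t)%R q = heat_mix g q + heat_mix g' q.
Proof.
move=> mg mg' g0 g0'; rewrite /heat_mix -ge0_integralD//=.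
- by apply: eq_integral => t _; rewrite !mulrDl EFinD.
- move=> t; rewrite in_itv/= andbT => /g0 ?.
  by rewrite lee_fin !mulr_ge0// ?powR_ge0 ?heat_ge0.
- by apply: measurable_funTS; apply/measurable_EFinP; exact: measurable_mix_integrand.
- move=> t; rewrite in_itv/= andbT => /g0' ?.
  by rewrite lee_fin !mulr_ge0// ?powR_ge0 ?heat_ge0.
- by apply: measurable_funTS; apply/measurable_EFinP; exact: measurable_mix_integrand.
Qed.

Lemma heat_mixZ (c : R) g q : (0 <= c)%R -> measurable_fun setT g ->
  (forall t, (0 < t)%R -> (0 <= g t)%R) ->
  heat_mix (fun t => c * g t)%R q = c%:E * heat_mix g q.
Proof.
move=> c0 mg g0; rewrite /heat_mix -ge0_integralZl//=.
- by apply: eq_integral => t _; rewrite -EFinM !mulrA.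
- by apply: measurable_funTS; apply/measurable_EFinP; exact: measurable_mix_integrand.
- move=> t; rewrite in_itv/= andbT => /g0 ?.
  by rewrite lee_fin !mulr_ge0// ?powR_ge0 ?heat_ge0.
Qed.

Lemma heat_mix_powR p q : heat_mix ((@powR R)^~ p) q = time_integral (n%:R / 2 - 1 - p) q.
Proof.
apply: eq_integral => t; rewrite inE/= in_itv/= andbT => t0.
rewrite -powRD ?(gt_eqF t0) ?implybT//; congr ((_ `^ _ * _)%R%:E); ring.
Qed.

Lemma heat_anti (t q q' : R) : (0 < t)%R -> (q <= q')%R -> (heat t q' <= heat t q)%R.
Proof.
by move=> t0 qq; rewrite ler_expR ler_pM2r ?invr_gt0 ?mulr_gt0// lerN2.
Qed.

Lemma heat_mix_anti g q q' : measurable_fun setT g -> (forall t, (0 < t)%R -> (0 <= g t)%R) ->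
  (q <= q')%R -> heat_mix g q' <= heat_mix g q.
Proof.
move=> mg g0 qq; apply: ge0_le_integral => //=.
- move=> t; rewrite in_itv/= andbT => /g0 ?.
  by rewrite lee_fin !mulr_ge0// ?powR_ge0 ?heat_ge0.
- by apply: measurable_funTS; apply/measurable_EFinP; exact: measurable_mix_integrand.
- by apply: measurable_funTS; apply/measurable_EFinP; exact: measurable_mix_integrand.
- move=> t; rewrite in_itv/= andbT => t0.
  by rewrite lee_fin ler_wpM2l ?mulr_ge0 ?powR_ge0 ?g0// heat_anti.
Qed.

Lemma sqnorm_ge0 (y : 'rV[R]_n) : (0 <= sqnorm y)%R.
Proof. by apply: sumr_ge0 => i _; exact: sqr_ge0. Qed.

Lemma sqnormN (y : 'rV[R]_n) : sqnorm (- y)%R = sqnorm y.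
Proof. by apply: eq_bigr => i _; rewrite mxE sqrrN. Qed.

Lemma measurable_heat_prod d (T : measurableType d) (f : T -> R) :
  measurable_fun setT f -> measurable_fun setT (fun p : T * R => heat p.2 (f p.1)).
Proof.
move=> mf; apply: measurableT_comp => //; apply: measurable_funM.
  by apply: measurableT_comp => //; exact: (measurableT_comp mf measurable_fst).
by apply: (measurableT_comp measurable_invr); apply: measurable_funM.
Qed.

Let measurable_mix_prod d (T : measurableType d) (f : T -> R) g :
  measurable_fun setT f -> measurable_fun setT g -> measurable_fun setT
    (fun p : T * R => (if 0 < p.2 then g p.2 * p.2 `^ (- (n%:R / 2)) * heat p.2 (f p.1) else 0)%R%:E).
Proof.
move=> mf mg; apply/measurable_EFinP; apply: measurable_pos; last exact: measurable_snd.
apply: measurable_funM; last exact: measurable_heat_prod.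
apply: measurable_funM; first exact: (measurableT_comp mg measurable_snd).
exact: (measurableT_comp (measurable_powR _) measurable_snd).
Qed.

Let mix_ge0 g q t : (forall t, (0 < t)%R -> (0 <= g t)%R) ->
  0 <= (if 0 < t then g t * t `^ (- (n%:R / 2)) * heat t q else 0)%R%:E.
Proof.
by move=> g0; rewrite lee_fin; case: ifP => // t0; rewrite !mulr_ge0// ?powR_ge0 ?heat_ge0 ?g0.
Qed.

Lemma measurable_heat_mix g : measurable_fun setT g -> (forall t, (0 < t)%R -> (0 <= g t)%R) ->
  measurable_fun setT (heat_mix g).
Proof.
move=> mg g0; rewrite (_ : heat_mix g = fun q =>
  \int[leb]_t (if 0 < t then g t * t `^ (- (n%:R / 2)) * heat t q else 0)%R%:E); last first.
  by apply/funext => q; exact: heat_mixE.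
apply: (@measurable_integral_snd _ _ _ _ _ leb
   (fun p : R * R => (if 0 < p.2 then g p.2 * p.2 `^ (- (n%:R / 2)) * heat p.2 p.1 else 0)%R%:E)).
- exact: sigma_finiteT.
- exact: (@measurable_mix_prod _ R id).
- by move=> x; exact: mix_ge0.
Qed.

Context (G : measure_rV) (G1 : G setT = 1)
 (GE : forall (y : 'rV[R]_n) (s t : R), (0 <= s)%R -> (0 < t)%R ->
  \int[G]_w (heat t (sqnorm (y + Num.sqrt s *: (w : 'rV[R]_n))%R))%:E =
  (Num.sqrt (t / (t + s)) ^+ n * heat (t + s) (sqnorm y))%:E).

Let sG : sigma_finite setT G.
Proof. by apply: radon_sigma_finite; apply: finite_radon; rewrite G1 ltry. Qed.

(** Under the time integral a Gaussian step of variance [s] advances each heat kernel by [s]; the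
    ratio of normalisations turns [t^(-n/2)] into [(t+s)^(-n/2)], while the weight [g] is still
    taken at the old time [t]. *)
Lemma heat_mix_gauss g v s : measurable_fun setT g -> (forall t, (0 < t)%R -> (0 <= g t)%R) -> (0 <= s)%R ->
  \int[G]_w heat_mix g (sqnorm (v + Num.sqrt s *: (w : 'rV[R]_n))%R) =
  \int[leb]_(t in `]0%R, +oo[) (g t * (t + s) `^ (- (n%:R / 2)) * heat (t + s) (sqnorm v))%:E.
Proof.
move=> mg g0 s0.
under eq_integral do rewrite heat_mixE//.
rewrite (@tonelli _ _ _ _ _ G leb (fun p => (if 0 < p.2 then g p.2 * p.2 `^ (- (n%:R / 2)) *
   heat p.2 (sqnorm (v + Num.sqrt s *: (p.1 : 'rV[R]_n))) else 0)%R%:E))//=; first last.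
- by move=> x; exact: mix_ge0.
- apply: (@measurable_mix_prod _ (Rn R n) (fun w => sqnorm (v + Num.sqrt s *: (w : 'rV[R]_n))%R)) => //.
  exact: continuous_sqnorm_shift.
- exact: sigma_finiteT.
rewrite [RHS]integral_mkcond; apply: eq_integral => t _.
rewrite patchE mem_setE in_itv/= andbT; case: ifP => t0; last by rewrite integral_cst// mul0e.
under eq_integral do rewrite EFinM.
rewrite ge0_integralZl//=; first last.
- by rewrite lee_fin mulr_ge0 ?powR_ge0 ?g0.
- by move=> x _; rewrite lee_fin heat_ge0.
- apply/measurable_EFinP; apply: (measurableT_comp (measurable_heat t)).
  exact: continuous_sqnorm_shift.
rewrite GE// -EFinM; congr EFin; rewrite mulrA; congr (_ * _)%R; rewrite -mulrA; congr (_ * _)%R.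
have ts0 : (0 < t + s)%R by rewrite ltr_wpDr.
rewrite -powR12_sqrt ?divr_ge0 ?(ltW t0) ?(ltW ts0)// -powR_mulrn ?powR_ge0// -powRrM (mulrC 2^-1%R).
rewrite powRM ?invr_ge0 ?(ltW t0) ?(ltW ts0)// mulrA -powRD ?(gt_eqF t0) ?implybT//.
by rewrite addNr powRr0 mul1r -powR_inv1 ?(ltW ts0)// -powRrM mulN1r.
Qed.

End heat_potentials.

(** * Estimates for the potentials of subordinated Gaussian laws *)

Section heat_kernel.
Context {R : realType} {n : nat} (alpha : R) (alpha0 : 0 < alpha) (alpha2 : alpha <= 2)
  (alpha_n : alpha < n%:R).
Local Open Scope ereal_scope.
Notation leb := (@lebesgue_measure R).
Notation measure_rV := {measure set (Rn R n) -> \bar R}.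
Implicit Types (x y z : 'rV[R]_n).
Local Notation U := (potential alpha).
Local Notation a := (alpha / 2)%R.
Local Notation mix := (@heat_mix R n).
Local Notation pw p := ((@powR R)^~ p).

Let a01 : (0 < a <= 1)%R.
Proof. by rewrite divr_gt0//= ler_pdivrMr// mul1r. Qed.

Let le_congr (p q r s : \bar R) : p = q -> r = s -> q <= s -> p <= r.
Proof. by move=> -> ->. Qed.

Lemma heat_mono (t t' q : R) : (0 < t)%R -> (t <= t')%R -> (0 <= q)%R -> (heat t q <= heat t' q)%R.
Proof.
move=> t0 tt q0; have t'0 := lt_le_trans t0 tt.
rewrite ler_expR !mulNr lerN2 ler_wpM2l// lef_pV2 ?posrE ?mulr_gt0//.
by rewrite ler_pM2l.
Qed.

Lemma sqnormB x z : sqnorm (x - z)%R = (edist x z ^+ 2)%R.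
Proof. by rewrite sqr_edist; apply: eq_bigr => i _; rewrite !mxE. Qed.

(** The weight [t^(a-1)] together with [t^(-n/2)] gives the time integral of index
    [b = (n-alpha)/2], and [(|x-z|^2)^(-b)] is the Riesz kernel. On the diagonal both sides are
    infinite. *)
Lemma riesz_heat_mix : exists2 C : R, (0 < C)%R &
  forall x z, C%:E * riesz alpha x z = mix (pw (a - 1)%R) (sqnorm (x - z)%R).
Proof.
pose b : R := (n%:R / 2 - 1 - (a - 1))%R.
have bE : (b = (n%:R - alpha) / 2)%R by rewrite /b; field.
have b0 : (0 < b)%R by rewrite bE divr_gt0// subr_gt0.
have C0 := time_integral_gt0 b0.
have Cfin : time_integral b 1 \is a fin_num.
  have [C hC] := time_integral_fin b0.
  by rewrite ge0_fin_numE ?ltW//; exact: le_lt_trans hC (ltry _).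
exists (fine (time_integral b 1)); first by rewrite fine_gt0// C0/= -ge0_fin_numE// ltW.
move=> x z; rewrite (fineK Cfin) heat_mix_powR -/b sqnormB /riesz.
case: eqP => [->|/eqP xz].
  have -> : edist z z = 0%R by apply/eqP; rewrite edist0.
  by rewrite expr0n/= time_integral0// gt0_muley.
have e0 : (0 < edist x z)%R by rewrite edist_gt0.
have -> : (edist x z `^ (alpha - n%:R) = (edist x z ^+ 2) `^ (- b))%R.
  rewrite -powR_mulrn ?edist_ge0// -powRrM; congr (_ `^ _)%R.
  by rewrite bE; field.
by rewrite (@time_integral_scale _ b (edist x z ^+ 2)%R) ?exprn_gt0// muleC.
Qed.

Context (G : measure_rV) (G1 : G setT = 1)
 (GE : forall (y : 'rV[R]_n) (s t : R), (0 <= s)%R -> (0 < t)%R ->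
  \int[G]_w (heat t (sqnorm (y + Num.sqrt s *: (w : 'rV[R]_n))%R))%:E =
  (Num.sqrt (t / (t + s)) ^+ n * heat (t + s) (sqnorm y))%:E).
Context (C : R) (C0 : (0 < C)%R)
  (CE : forall x z, C%:E * riesz alpha x z = mix (pw (a - 1)%R) (sqnorm (x - z)%R)).

Let sG : sigma_finite setT G.
Proof. by apply: radon_sigma_finite; apply: finite_radon; rewrite G1 ltry. Qed.

Let P := uniform_prob (@ltr01 R).

Let mpw p : measurable_fun setT (pw p). Proof. exact: measurable_powR. Qed.

Let pw0 p (t : R) : (0 < t)%R -> (0 <= t `^ p)%R. Proof. by move=> _; exact: powR_ge0. Qed.

Lemma potential_mix (m : measure_rV) z :
  C%:E * U m z = \int[m]_x mix (pw (a - 1)%R) (sqnorm (z - (x : 'rV[R]_n))%R).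
Proof.
rewrite /potential -ge0_integralZl//; first last.
- by rewrite lee_fin ltW.
- by move=> x _; exact: riesz_ge0.
- exact: measurable_riesz_l.
by apply: eq_integral => x _; rewrite CE.
Qed.

Lemma potential_gauss z : C%:E * U G z =
  \int[leb]_(t in `]0%R, +oo[) (t `^ (a - 1) * (t + 1) `^ (- (n%:R / 2)) * heat (t + 1) (sqnorm z))%:E.
Proof.
rewrite potential_mix -(sqnormN z).
rewrite -(@heat_mix_gauss R n G G1 GE (pw (a - 1)%R) (- z)%R 1%R (mpw _) (@pw0 _) ler01).
apply: eq_integral => x _; congr (mix _ _).
have -> : (- z + Num.sqrt 1 *: (x : 'rV[R]_n) = - (z - x))%R by rewrite sqrtr1 scale1r opprB addrC.
by rewrite sqnormN.
Qed.

Lemma subordinated_gauss x0 (rho : R) : (0 < rho)%R -> exists N : measure_rV, N setT = 1 /\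
  forall z, C%:E * U N z = mix (delayed a rho) (sqnorm (x0 - z)%R).
Proof.
move=> r0.
pose phi (p : R * Rn R n) : 'rV[R]_n := (x0 + Num.sqrt (subordinator a rho p.1) *: (p.2 : 'rV[R]_n))%R.
have ms := measurable_subordinator a rho.
have sge u : (0 <= subordinator a rho u)%R by rewrite (le_trans (ltW r0))// subordinator_ge.
have mphi : measurable_fun setT (phi : _ -> Rn R n).
  apply: measurable_rV => i; under eq_fun do rewrite mxE [X in (_ + X)%R]mxE.
  apply: measurable_funD => //; apply: measurable_funM.
    apply: (@measurableT_comp _ _ _ _ _ _ (@Num.sqrt R)); last exact: (measurableT_comp ms measurable_fst).
    by apply: continuous_measurable_fun; exact: sqrt_continuous.
  exact: (measurableT_comp (measurable_coord i) measurable_snd).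
have sP : sigma_finite setT P by exact: sigma_finiteT.
have [N NE] := product_pushforward sP sG mphi.
exists N; split.
  have := NE (cst 1) (measurable_cst _) (fun=> lee01).
  rewrite integral_cst// mul1e => ->.
  transitivity (\int[P]_x cst 1 x); last first.
    by rewrite integral_cst// mul1e; exact: probability_setT.
  by apply: eq_integral => x _; rewrite integral_cst// mul1e.
move=> z; rewrite potential_mix NE; first last.
- by move=> x; apply: heat_mix_ge0 => t _; exact: powR_ge0.
- apply: (measurableT_comp (measurable_heat_mix (mpw _) (@pw0 _))).
  rewrite (_ : (fun x : Rn R n => _) = (fun w : Rn R n => sqnorm (z + (-1) *: (w : 'rV[R]_n))%R)); last first.
    by apply/funext => w; rewrite scaleN1r.
  exact: continuous_sqnorm_shift.
have mdelay d (T : measurableType d) (f g : T -> R) : measurable_fun setT f -> measurable_fun setT g ->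
  measurable_fun setT (fun p => (if (0 < f p) && (g p < f p) then (f p - g p) `^ (a - 1) *
    (f p `^ (- (n%:R / 2)) * heat (f p) (sqnorm (x0 - z))) else 0)%R%:E).
  move=> mf mg; apply/measurable_EFinP; apply: measurable_fun_if => //.
    by apply: measurable_and; exact: measurable_fun_ltr.
  apply: measurable_funTS; apply: measurable_funM.
    by apply: (measurableT_comp (measurable_powR _)); exact: measurable_funB.
  apply: measurable_funM; first exact: (measurableT_comp (measurable_powR _) mf).
  exact: (measurableT_comp (measurable_heat_time _) mf).
transitivity (\int[P]_u \int[leb]_t
  (if (0 < t) && (subordinator a rho u < t) then (t - subordinator a rho u) `^ (a - 1) * (t `^ (- (n%:R / 2)) *
     heat t (sqnorm (x0 - z))) else 0)%R%:E).
  apply: eq_integral => u _.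
  transitivity (\int[G]_w mix (pw (a - 1)%R) (sqnorm (x0 - z + Num.sqrt (subordinator a rho u) *: (w : 'rV[R]_n))%R)).
    apply: eq_integral => w _; rewrite /phi/= -sqnormN opprB; congr (mix _ (sqnorm _)).
    by rewrite addrAC.
  rewrite (@heat_mix_gauss R n G G1 GE (pw (a - 1)%R) _ (subordinator a rho u) (mpw _) (@pw0 _) (sge u)).
  set s := subordinator a rho u.
  have s0 : (0 <= s)%R := sge u.
  pose h (t : R) := (if (0 < t) && (s < t) then (t - s) `^ (a - 1) * (t `^ (- (n%:R / 2)) *
     heat t (sqnorm (x0 - z))) else 0)%R%:E.
  transitivity (\int[leb]_(t in `]0%R, +oo[) h (t + s)%R).
    apply: eq_integral => t; rewrite inE/= in_itv/= andbT => t0.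
    have h1 : (0 < t + s)%R by rewrite ltr_wpDr ?s0.
    have h2 : (s < t + s)%R by rewrite ltrDr.
    by rewrite /h h1 h2 addrK mulrA.
  rewrite ge0_integral_shift//.
  - rewrite integral_mkcond; apply: eq_integral => t _.
    rewrite patchE mem_setE in_itv/= andbT /h.
    by case: (s < t)%R; rewrite ?andbT ?andbF.
  - exact: (mdelay _ _ id (cst s)).
  - by move=> t; rewrite /h lee_fin; case: ifP => // _; rewrite !mulr_ge0 ?powR_ge0 ?heat_ge0.
(* After time has been shifted by the delay, the order of integration is exchanged: for each [t] the
   average over the delay is the one computed in [integral_subordinator]. *)
rewrite (@tonelli _ _ _ _ _ P leb
  (fun p => (if (0 < p.2) && (subordinator a rho p.1 < p.2) then (p.2 - subordinator a rho p.1) `^ (a - 1) *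
   (p.2 `^ (- (n%:R / 2)) * heat p.2 (sqnorm (x0 - z))) else 0)%R%:E))//=; first last.
- by move=> t; rewrite lee_fin; case: ifP => // _; rewrite !mulr_ge0 ?powR_ge0 ?heat_ge0.
- apply: (mdelay _ _ snd (fun p => subordinator a rho p.1)); first exact: measurable_snd.
  exact: (measurableT_comp ms measurable_fst).
- exact: sigma_finiteT.
rewrite heat_mixE; apply: eq_integral => t _.
case: ifP => t0 /=; last by rewrite integral_cst// mul0e.
have -> : (delayed a rho t * t `^ (- (n%:R / 2)) * heat t (sqnorm (x0 - z)))%R%:E =
  (delayed a rho t)%:E * (t `^ (- (n%:R / 2)) * heat t (sqnorm (x0 - z)))%R%:E.
  by rewrite -EFinM mulrA.
rewrite -integral_subordinator// -ge0_integralZr//=.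
- by apply: eq_integral => u _; rewrite -EFinM; case: ifP; rewrite ?mul0r.
- apply/measurable_EFinP; apply: measurable_fun_if => //.
    exact: measurable_fun_ltr.
  by apply: measurable_funTS; apply: (measurableT_comp (measurable_powR _)); exact: measurable_funB.
- by move=> u _; rewrite lee_fin; case: ifP => // _; exact: powR_ge0.
- by rewrite lee_fin mulr_ge0 ?powR_ge0 ?heat_ge0.
Qed.

Local Notation b := (if alpha / 2 < 1 then 1 else 2)%R.

Let mdel rho : measurable_fun setT (delayed a rho). Proof. exact: measurable_delayed. Qed.

Let delayed_ge0 rho t : (0 < rho)%R -> (0 < t)%R -> (0 <= delayed a rho t)%R.
Proof. by move=> r0 t0; have [] := delayed_bounds a01 r0 t0. Qed.

Let le_C (u v : \bar R) : C%:E * u <= C%:E * v -> u <= v.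
Proof. by rewrite lee_pmul2l// lte_fin. Qed.

Lemma time_integral_ge0 p q : 0 <= @time_integral R p q.
Proof. by apply: integral_ge0 => t _; rewrite lee_fin mulr_ge0 ?powR_ge0 ?heat_ge0. Qed.

(** The last bound of [delayed_bounds], integrated in time: the remainder [rho^b t^(a-1-b)] is again
    a pure power of [t], and its time integral scales as the distance to the power
    [alpha - n - 2b]. *)
Lemma kernel_approx : exists C1 : R, (0 <= C1)%R /\ forall x0 z (rho : R) (N : measure_rV), (0 < rho)%R ->
  (forall z, C%:E * U N z = mix (delayed a rho) (sqnorm (x0 - z)%R)) -> z != x0 ->
  riesz alpha x0 z <= U N z + (C1 * rho `^ b * edist x0 z `^ (alpha - n%:R - 2 * b))%:E.
Proof.
pose p : R := (a - 1 - b)%R.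
have p0 : (0 < n%:R / 2 - 1 - p)%R.
  have -> : (n%:R / 2 - 1 - p = (n%:R - alpha) / 2 + b)%R by rewrite /p; field.
  by rewrite addr_gt0 ?divr_gt0 ?subr_gt0//; case: ifP.
have [C1 hC1] := time_integral_fin p0.
have C10 : (0 <= C1)%R by rewrite -lee_fin; apply: le_trans hC1; exact: time_integral_ge0.
exists (C1 / C)%R; split; first by rewrite divr_ge0// ltW.
move=> x0 z rho N r0 NE zx; apply: le_C.
have e0 : (0 < edist x0 z)%R by rewrite edist_gt0 eq_sym.
rewrite ge0_muleDr ?potential_ge0//; last by rewrite lee_fin !mulr_ge0 ?powR_ge0 ?invr_ge0 ?(ltW C0).
rewrite NE CE -EFinM.
apply: (@le_trans _ _ (mix (fun t => delayed a rho t + rho `^ b * t `^ p)%R (sqnorm (x0 - z)%R))).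
  apply: heat_mix_le => //.
    by apply: measurable_funD => //; apply: measurable_funM => //; exact: mpw.
  by move=> t t0; rewrite powR_ge0/=; have [] := delayed_bounds a01 r0 t0.
rewrite heat_mixD//; last 3 first.
- by apply: measurable_funM => //; exact: mpw.
- by move=> t; exact: delayed_ge0.
- by move=> t t0; rewrite mulr_ge0 ?powR_ge0.
rewrite leeD2l// heat_mixZ ?powR_ge0//; last by move=> t _; exact: powR_ge0.
rewrite heat_mix_powR sqnormB (@time_integral_scale _ _ (edist x0 z ^+ 2)%R) ?exprn_gt0//.
rewrite -powR_mulrn ?edist_ge0// -powRrM.
have -> : (2%:R * - (n%:R / 2 - 1 - p) = alpha - n%:R - 2 * b)%R by rewrite /p; field.
have -> : (C * (C1 / C * rho `^ b * edist x0 z `^ (alpha - n%:R - 2 * b)))%:E =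
  (rho `^ b)%:E * ((edist x0 z `^ (alpha - n%:R - 2 * b))%:E * C1%:E).
  rewrite -!EFinM; congr EFin; have C2 : C != 0%R by rewrite gt_eqF.
  by move: (rho `^ b)%R (edist x0 z `^ _)%R => A B; field.
by do 2 (apply: lee_pmulE; first exact: powR_ge0).
Qed.

(** Times up to [rho] carry no weight; beyond, [heat <= 1] leaves the tail of an integrable power of
    [t], which is small for large [rho]. *)
Lemma kernel_sup : exists C2 : R, (0 <= C2)%R /\ forall x0 z (rho : R) (N : measure_rV), (0 < rho)%R ->
  (forall z, C%:E * U N z = mix (delayed a rho) (sqnorm (x0 - z)%R)) ->
  U N z <= (C2 * rho `^ ((alpha - n%:R) / 2))%:E.
Proof.
pose p : R := ((n%:R - alpha) / 2)%R.
have p0 : (0 < p)%R by rewrite divr_gt0// subr_gt0.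
exists (p^-1 / C)%R; split; first by rewrite divr_ge0 ?invr_ge0// ltW.
move=> x0 z rho N r0 NE; apply: le_C; rewrite NE -EFinM.
have -> : (C * (p^-1 / C * rho `^ ((alpha - n%:R) / 2)) = rho `^ (- p) / p)%R.
  rewrite /p -mulNr opprB; have C2 : C != 0%R by rewrite gt_eqF.
  by rewrite mulrA mulrCA mulfV// mulr1 mulrC.
rewrite -integral_powR_tail// /heat_mix integral_mkcond [X in _ <= X]integral_mkcond.
apply: ge0_le_integral => //=.
- move=> t _; rewrite patchE; case: ifP => //; rewrite inE/= in_itv/= andbT => t0.
  by rewrite lee_fin !mulr_ge0 ?powR_ge0 ?heat_ge0 ?delayed_ge0.
- apply/(measurable_restrictT _ _).1 => //; apply: measurable_funTS; apply/measurable_EFinP.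
  exact: measurable_mix_integrand.
- apply/(measurable_restrictT _ _).1 => //; apply: measurable_funTS; apply/measurable_EFinP.
  exact: mpw.
- move=> t _; rewrite !patchE !mem_setE !in_itv/= !andbT.
  case: ifP => t0; last by case: ifP => //; rewrite lee_fin powR_ge0.
  case: (ltP rho t) => rt; last by rewrite delayed0// !mul0r.
  rewrite lee_fin.
  have -> : (t `^ (- p - 1) = t `^ (a - 1) * t `^ (- (n%:R / 2)))%R.
    by rewrite -powRD ?(gt_eqF t0) ?implybT//; congr (_ `^ _)%R; rewrite /p; field.
  have [h0 h1 _] := delayed_bounds a01 r0 t0.
  rewrite -[leRHS]mulr1 ler_pM ?heat_ge0 ?mulr_ge0 ?powR_ge0//.
    by rewrite ler_wpM2r ?powR_ge0.
  by rewrite heat_le1 ?sqnorm_ge0 ?(ltW t0).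
Qed.

Let mix_shift_ge0 g (t q : R) : (0 <= g)%R -> 0 <= (g * (t + 1) `^ (- (n%:R / 2)) * heat (t + 1) q)%:E.
Proof. by move=> g0; rewrite lee_fin !mulr_ge0 ?powR_ge0 ?heat_ge0. Qed.

Let mix_shift_measurable (g : R -> R) (q : R) : measurable_fun setT g ->
  measurable_fun setT (fun t : R => (g t * (t + 1) `^ (- (n%:R / 2)) * heat (t + 1) q)%R).
Proof.
move=> mg; have m1 : measurable_fun setT (fun t : R => t + 1)%R by exact: measurable_funD.
apply: measurable_funM; last exact: (measurableT_comp (measurable_heat_time _) m1).
by apply: measurable_funM => //; exact: (measurableT_comp (measurable_powR _) m1).
Qed.

Lemma integral_powR_01 : \int[leb]_(t in `]0%R, 1%R]) (t `^ (a - 1))%:E = (a^-1)%:E.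
Proof.
have /andP[a0 _] := a01.
pose F (x : R) : R := (a^-1 * x `^ a)%R.
transitivity ((F 1 - F 0)%:E)%R.
  apply: ge0_FTC_oc => //.
  - by move=> x _; exact: powR_ge0.
  - by move=> x x0; exact: continuous_powR_gt0.
  - move=> x x0; have dp := is_derive1_powR a x0.
    have -> : (x `^ (a - 1) = a^-1 *: (a * x `^ (a - 1)))%R.
      by rewrite /GRing.scale/= mulrA mulVf ?mul1r// gt_eqF.
    exact: is_deriveZ.
  - rewrite /F powR0 ?gt_eqF// mulr0.
    rewrite -[X in _ --> X](mulr0 a^-1%R); apply: cvgMr; exact: powR_cvg0.
by rewrite /F powR1 powR0 ?gt_eqF// mulr1 mulr0 subr0.
Qed.

(** The Gaussian step shifts time by 1, which removes the singularity of [t^(-n/2)] at 0. The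
    remaining weight [t^(a-1)] is integrable near 0 because [a > 0], and the product decays fast
    enough at infinity because [alpha < n]. *)
Lemma kernel_mean : exists C3 : R, forall z, U G z <= C3%:E.
Proof.
have /andP[a0 _] := a01.
pose p : R := ((n%:R - alpha) / 2)%R.
have p0 : (0 < p)%R by rewrite divr_gt0// subr_gt0.
exists ((a^-1 + 1 `^ (- p) / p) / C)%R => z; apply: le_C; rewrite potential_gauss -EFinM.
have -> : (C * ((a^-1 + 1 `^ (- p) / p) / C) = a^-1 + 1 `^ (- p) / p)%R.
  by rewrite mulrC divfK// gt_eqF.
have -> : `]0%R, +oo[%classic = `]0%R, 1%R] `|` `]1%R, +oo[ :> set R.
  by apply/seteqP; split => x /=; rewrite !in_itv/= !andbT; case: (ltP 1 x)%R => h; lra.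
have mf := mix_shift_measurable (sqnorm z) (mpw (a - 1)%R).
rewrite ge0_integral_setU//=; first last.
- by apply/disj_setPS => x [] /=; rewrite !in_itv/= andbT => /andP[_ h] /(le_lt_trans h); rewrite ltxx.
- by move=> x _; apply: mix_shift_ge0; exact: powR_ge0.
- by apply: measurable_funTS; apply/measurable_EFinP.
have h1 (t : R) : (0 < t)%R -> (heat (t + 1) (sqnorm z) <= 1)%R.
  by move=> t0; rewrite heat_le1 ?sqnorm_ge0// addr_ge0// ltW.
have n0 : (- (n%:R / 2) <= 0 :> R)%R by rewrite oppr_le0 divr_ge0.
rewrite EFinD -integral_powR_01 -integral_powR_tail//; apply: leeD; apply: ge0_le_integral => //=.
- by move=> t _; apply: mix_shift_ge0; exact: powR_ge0.
- by apply: measurable_funTS; apply/measurable_EFinP.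
- by apply: measurable_funTS; apply/measurable_EFinP; exact: mpw.
- move=> t; rewrite in_itv/= => /andP[t0 t1]; rewrite lee_fin -mulrA ler_piMr ?powR_ge0//.
  rewrite mulr_ile1 ?powR_ge0 ?heat_ge0 ?h1//.
  apply: (@le_trans _ _ ((1 : R) `^ (- (n%:R / 2)))%R); last by rewrite powR1.
  by apply: powR_le0_anti; rewrite // lerDr ltW.
- by move=> t _; apply: mix_shift_ge0; exact: powR_ge0.
- by apply: measurable_funTS; apply/measurable_EFinP.
- by apply: measurable_funTS; apply/measurable_EFinP; exact: mpw.
- move=> t; rewrite in_itv/= andbT => t1; have t0 : (0 < t)%R by exact: lt_trans t1.
  have -> : (t `^ (- p - 1) = t `^ (a - 1) * t `^ (- (n%:R / 2)))%R.
    by rewrite -powRD ?(gt_eqF t0) ?implybT//; congr (_ `^ _)%R; rewrite /p; field.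
  rewrite lee_fin -mulrA ler_wpM2l ?powR_ge0// -[leRHS]mulr1.
  by rewrite ler_pM ?heat_ge0 ?powR_ge0 ?h1//; apply: powR_le0_anti; rewrite // lerDl.
Qed.

(** By symmetry the integral is the mean of [U G] under [N]. It falls short of [U G x0] because
    [delayed] vanishes on []0, rho]]: the weight lost there is at least [rho^(a-1)] over a length
    [rho], and [c] collects lower bounds, for [t <= 1], of the other two factors at time [t + 1],
    together with the division by [C]. *)
Lemma kernel_gap x0 : exists2 c : R, (0 < c)%R & forall (rho : R) (N : measure_rV), (0 < rho <= 1)%R ->
  N setT = 1 -> (forall z, C%:E * U N z = mix (delayed a rho) (sqnorm (x0 - z)%R)) ->
  \int[G]_z U N z + (c * rho `^ a)%:E <= U G x0.
Proof.
have /andP[a0 a1] := a01.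
have n0 : (- (n%:R / 2) <= 0 :> R)%R by rewrite oppr_le0 divr_ge0.
exists (2 `^ (- (n%:R / 2)) * heat 1 (sqnorm x0) / C)%R.
  by rewrite divr_gt0// mulr_gt0 ?expR_gt0// powR_gt0.
move=> rho N /andP[r0 r1] N1 NE; apply: le_C.
pose k : R := (rho `^ (a - 1) * 2 `^ (- (n%:R / 2)) * heat 1 (sqnorm x0))%R.
have k0 : (0 <= k)%R by rewrite !mulr_ge0 ?powR_ge0 ?heat_ge0.
have rN : radon N by apply: finite_radon; rewrite N1 ltry.
rewrite ge0_muleDr; last 2 first.
- by apply: integral_ge0 => z _; exact: potential_ge0.
- by rewrite lee_fin !mulr_ge0 ?powR_ge0 ?heat_ge0 ?invr_ge0 ?(ltW C0).
rewrite -ge0_integralZl//; first last.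
- by rewrite lee_fin ltW.
- by move=> z _; exact: potential_ge0.
- exact: measurable_potential.
have -> : (\int[G]_z (C%:E * U N z) = \int[leb]_(t in `]0%R, +oo[)
   (delayed a rho t * (t + 1) `^ (- (n%:R / 2)) * heat (t + 1) (sqnorm x0))%:E).
  rewrite -(sqnormN x0).
  rewrite -(@heat_mix_gauss R n G G1 GE (delayed a rho) (- x0)%R 1%R (mdel _) (fun t => @delayed_ge0 _ t r0) ler01).
  apply: eq_integral => z _; rewrite NE; congr (mix _ _).
  have -> : (- x0 + Num.sqrt 1 *: (z : 'rV[R]_n) = - (x0 - z))%R by rewrite sqrtr1 scale1r opprB addrC.
  by rewrite sqnormN.
have kE : (C * (2 `^ (- (n%:R / 2)) * heat 1 (sqnorm x0) / C * rho `^ a))%:E =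
    \int[leb]_(t in `]0%R, +oo[) (k * \1_(`]0%R, rho]%classic) t)%:E.
  under eq_integral do rewrite EFinM.
  rewrite ge0_integralZl//=; last first.
    by apply: measurable_funTS; apply/measurable_EFinP; exact: measurable_indic.
  rewrite integral_indic//= (_ : _ `&` _ = `]0%R, rho]%classic); last first.
    apply/seteqP; split => t /=; rewrite !in_itv/= ?andbT; first by case.
    by move=> /andP[-> ->].
  rewrite lebesgue_measure_itv/= lte_fin r0 sube0 -EFinM; congr EFin.
  rewrite (powR_split a r0) /k; have C2 : C != 0%R by rewrite gt_eqF.
  by move: (rho `^ _)%R (2 `^ _)%R (heat _ _) => u v w; field.
rewrite -EFinM kE potential_gauss -ge0_integralD//=; first last.
- by apply: measurable_funTS; apply/measurable_EFinP; apply: measurable_funM => //; exact: measurable_indic.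
- by move=> t _; rewrite lee_fin mulr_ge0.
- by apply: measurable_funTS; apply/measurable_EFinP; exact: mix_shift_measurable.
- by move=> t; rewrite in_itv/= andbT => t0; apply: mix_shift_ge0; exact: delayed_ge0.
apply: ge0_le_integral => //=.
- move=> t; rewrite in_itv/= andbT => t0; rewrite adde_ge0//.
    by apply: mix_shift_ge0; exact: delayed_ge0.
  by rewrite lee_fin mulr_ge0.
- apply: measurable_funTS; apply: emeasurable_funD; apply/measurable_EFinP.
    exact: mix_shift_measurable.
  by apply: measurable_funM => //; exact: measurable_indic.
- by apply: measurable_funTS; apply/measurable_EFinP; exact: mix_shift_measurable.
- move=> t; rewrite in_itv/= andbT => t0; rewrite -EFinD lee_fin indicE mem_setE in_itv/= t0/=.
  have [h0 h1 _] := delayed_bounds a01 r0 t0.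
  case: (leP t rho) => tr; last first.
    by rewrite mulr0 addr0 -!mulrA ler_wpM2r// mulr_ge0 ?powR_ge0 ?heat_ge0.
  rewrite delayed0// !mul0r add0r mulr1 /k.
  have t1 : (t + 1 <= 2)%R by have := le_trans tr r1; lra.
  rewrite !ler_pM ?mulr_ge0 ?powR_ge0 ?heat_ge0//.
  + by apply: powR_le0_anti; rewrite // subr_le0.
  + by apply: powR_le0_anti; rewrite // addr_gt0.
  + by apply: heat_mono; rewrite ?sqnorm_ge0// lerDr ltW.
Qed.

Lemma kernel_center x0 z rho (N : measure_rV) : (0 < rho)%R ->
  (forall z, C%:E * U N z = mix (delayed a rho) (sqnorm (x0 - z)%R)) -> U N z <= U N x0.
Proof.
move=> r0 NE; apply: le_C; apply: (le_congr (NE z) (NE x0)); apply: heat_mix_anti => //.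
- by move=> t; exact: delayed_ge0.
- by rewrite subrr; apply: (@le_trans _ _ 0%R); rewrite ?sqnorm_ge0// /sqnorm big1// => i _; rewrite mxE expr0n.
Qed.

(** Only times beyond [rho] contribute; there the heat factor at squared distance [q] is at least
    [heat rho q], while at the centre it is at most 1. For large [rho] the potential is thus nearly
    constant on bounded sets. *)
Lemma kernel_harnack x0 z rho (N : measure_rV) : (0 < rho)%R ->
  (forall z, C%:E * U N z = mix (delayed a rho) (sqnorm (x0 - z)%R)) ->
  (heat rho (edist x0 z ^+ 2))%:E * U N x0 <= U N z.
Proof.
move=> r0 NE; apply: le_C.
apply: (le_congr (etrans (muleCA _ _ _) (congr1 (mule _) (NE x0))) (NE z)).
rewrite /heat_mix.
rewrite -ge0_integralZl//; first last.
- by rewrite lee_fin heat_ge0.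
- move=> t /=; rewrite in_itv/= andbT => t0.
  by rewrite lee_fin !mulr_ge0 ?powR_ge0 ?heat_ge0 ?delayed_ge0.
- by apply: measurable_funTS; apply/measurable_EFinP; exact: measurable_mix_integrand.
apply: ge0_le_integral => //=.
- move=> t; rewrite in_itv/= andbT => t0.
  by rewrite lee_fin !mulr_ge0 ?powR_ge0 ?heat_ge0 ?delayed_ge0.
- apply: measurable_funTS; apply: emeasurable_funM => //; apply/measurable_EFinP.
  exact: measurable_mix_integrand.
- by apply: measurable_funTS; apply/measurable_EFinP; exact: measurable_mix_integrand.
- move=> t; rewrite in_itv/= andbT => t0; rewrite -EFinM lee_fin.
  case: (leP t rho) => tr; first by rewrite delayed0// !mul0r mulr0.
  rewrite mulrC ler_pM ?mulr_ge0 ?powR_ge0 ?heat_ge0 ?delayed_ge0//.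
    by rewrite ler_piMr ?mulr_ge0 ?powR_ge0 ?delayed_ge0// heat_le1 ?sqnorm_ge0 ?ltW.
  by rewrite sqnormB; apply: heat_mono; rewrite ?sqr_ge0// ltW.
Qed.
End heat_kernel.

(* [N] is the law of [x0 + sqrt S G], with [G] standard Gaussian and [S] the subordinator. *)
Theorem heat_approximation {R : realType} {n : nat} (alpha : R) :
  0 < alpha -> alpha <= 2 -> alpha < n%:R ->
  let U := @potential R n alpha in
  exists (b C1 C2 C3 : R) (m : {measure set (Rn R n) -> \bar R}),
  [/\ alpha / 2 < b, 0 <= C1, 0 <= C2, m setT = 1%E & forall z, (U m z <= C3%:E)%E] /\
  forall x0, exists2 c : R, 0 < c & forall rho, 0 < rho ->
  exists N : {measure set (Rn R n) -> \bar R},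
  [/\ N setT = 1%E, forall z, (U N z <= riesz alpha x0 z)%E,
    forall z, z != x0 ->
      (riesz alpha x0 z <= U N z + (C1 * rho `^ b * edist x0 z `^ (alpha - n%:R - 2 * b))%:E)%E,
    forall z, (U N z <= (C2 * rho `^ ((alpha - n%:R) / 2))%:E)%E &
  [/\ forall z, ((heat rho (edist x0 z ^+ 2))%:E * U N x0 <= U N z)%E,
    forall z, (U N z <= U N x0)%E &
    rho <= 1 -> (\int[m]_z U N z + (c * rho `^ (alpha / 2))%:E <= U m x0)%E]].
Proof.
move=> alpha0 alpha2 alpha_n U.
have [G [G1 GE]] := gauss_exists (R:=R) n.
have [C C0 CE] := riesz_heat_mix alpha_n.
have a01 : 0 < alpha / 2 <= 1 by rewrite divr_gt0//= ler_pdivrMr// mul1r.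
have [C1 [C10 h1]] := kernel_approx alpha0 alpha2 alpha_n C0 CE.
have [C2 [C20 h2]] := kernel_sup alpha0 alpha2 alpha_n C0.
have [C3 h3] := kernel_mean alpha0 alpha2 alpha_n G1 GE C0 CE.
exists (if alpha / 2 < 1 then 1 else 2), C1, C2, C3, G; split.
  by split => //; case: ifP => //; move: a01 => /andP[_ h] _; apply: le_lt_trans h _; rewrite ltr1n.
move=> x0; have [c c0 hc] := kernel_gap alpha0 alpha2 alpha_n G1 GE C0 CE x0.
exists c => // rho r0.
have [N [N1 NE]] := subordinated_gauss alpha0 alpha2 alpha_n G1 GE C0 CE x0 r0.
have le_C (u v : \bar R) : (C%:E * u <= C%:E * v -> u <= v)%E by rewrite lee_pmul2l// lte_fin.
have d0 (t : R) : 0 < t -> 0 <= delayed (alpha / 2) rho t.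
  by move=> t0; have [] := delayed_bounds a01 r0 t0.
exists N; split.
- exact: N1.
- move=> z; apply: le_C; rewrite NE CE; apply: heat_mix_le.
  + exact: measurable_delayed.
  + exact: measurable_powR.
  + by move=> t t0; have [-> ->] := delayed_bounds a01 r0 t0.
- by move=> z zx; exact: (h1 x0 z rho N).
- by move=> z; exact: (h2 x0 z rho N).
split.
- by move=> z; apply: kernel_harnack r0 NE.
- by move=> z; apply: kernel_center r0 NE.
- by move=> r1; apply: hc => //; rewrite r0.
Qed.

(** * Domination and positivity of mass *)

Section supports.
Local Open Scope ereal_scope.

Lemma ge0_integral_support d (T : measurableType d) (R : realType)
    (mu : {measure set T -> \bar R}) (B : set T) (f : T -> \bar R) : measurable B ->
  mu (~` B) = 0 -> measurable_fun setT f -> (forall x, 0 <= f x) ->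
  \int[mu]_x f x = \int[mu]_(x in B) f x.
Proof.
move=> mB muB mf f0.
rewrite (@ge0_negligible_integral _ _ _ mu setT (~` B))//; last exact: measurableC.
by rewrite setTD setCK.
Qed.

Lemma ge0_integral_splitC d (T : measurableType d) (R : realType)
    (mu : {measure set T -> \bar R}) (B : set T) (f : T -> \bar R) : measurable B ->
  measurable_fun setT f -> (forall x, 0 <= f x) ->
  \int[mu]_x f x = \int[mu]_(x in B) f x + \int[mu]_(x in ~` B) f x.
Proof.
move=> mB mf f0; rewrite -[in LHS](setUv B) ge0_integral_setU//.
- exact: measurableC.
- by rewrite setUv.
- by apply/disj_setPS; rewrite setICr.
Qed.

Lemma ge0_le_integral_support d (T : measurableType d) (R : realType)
    (mu : {measure set T -> \bar R}) (B : set T) (f g : T -> \bar R) : measurable B ->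
  mu (~` B) = 0 -> measurable_fun setT f -> measurable_fun setT g -> (forall x, 0 <= f x) ->
  (forall x, 0 <= g x) -> (forall x, B x -> f x <= g x) -> \int[mu]_x f x <= \int[mu]_x g x.
Proof.
move=> mB muB mf mg f0 g0 fg.
rewrite (ge0_integral_support mB muB mf f0) (ge0_integral_support mB muB mg g0).
by apply: ge0_le_integral => //; exact: measurable_funTS.
Qed.

Lemma ge0_integral_addr_cst d (T : measurableType d) (R : realType)
    (mu : {measure set T -> \bar R}) (f : T -> \bar R) (v : R) : mu setT = 1 ->
  measurable_fun setT f -> (forall x, 0 <= f x) -> (0 <= v)%R ->
  \int[mu]_x (f x + v%:E) = \int[mu]_x f x + v%:E.
Proof.
move=> mu1 mf f0 v0; rewrite ge0_integralD//.
by rewrite integral_cst// mu1 mule1.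
Qed.

Lemma ge0_integral_le_cst d (T : measurableType d) (R : realType)
    (mu : {measure set T -> \bar R}) (f : T -> \bar R) (v : \bar R) :
  measurable_fun setT f -> (forall x, 0 <= f x) -> (forall x, f x <= v) ->
  \int[mu]_x f x <= v * mu setT.
Proof.
by move=> mf f0 fv; rewrite -integral_cst//; apply: ge0_le_integral.
Qed.

Lemma ge0_integral_ge_cst d (T : measurableType d) (R : realType)
    (mu : {measure set T -> \bar R}) (D : set T) (f : T -> \bar R) (v : \bar R) :
  measurable D -> measurable_fun setT f -> (forall x, 0 <= f x) -> 0 <= v ->
  (forall x, D x -> v <= f x) -> v * mu D <= \int[mu]_x f x.
Proof.
move=> mD mf f0 v0 vf; rewrite -integral_cst//.
apply: (@le_trans _ _ (\int[mu]_(x in D) f x)).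
  by apply: ge0_le_integral => //; exact: measurable_funTS.
exact: ge0_subset_integral.
Qed.

End supports.

Lemma lsc_add {R : realType} {T : topologicalType} (f : T -> \bar R) (g : T -> R) :
  (forall a : R, open [set x | (a%:E < f x)%E]) -> (forall a : R, open [set x | a < g x]) ->
  forall a : R, open [set x | (a%:E < f x + (g x)%:E)%E].
Proof.
move=> fl gl a; rewrite openE => x /= ax.
have [r [r1 r2]] : exists r : R, (r%:E < f x)%E /\ a - r < g x.
  move: ax; case: (f x) => [u| |] //.
    rewrite -EFinD lte_fin => h; exists ((u + (a - g x)) / 2).
    by rewrite lte_fin; split; lra.
  by move=> _; exists (a - g x + 1); split; [exact: ltry|lra].
have nf : nbhs x [set x | (r%:E < f x)%E] by apply: open_nbhs_nbhs; split.
have ng : nbhs x [set x | a - r < g x] by apply: open_nbhs_nbhs; split.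
apply: filterS (filterI nf ng) => z /= [h1 h2].
have -> : a%:E = (r%:E + (a - r)%:E)%E by rewrite -EFinD; congr EFin; ring.
by rewrite lteD// lte_fin.
Qed.

Section domination.
Context {R : realType} {n : nat} (alpha : R) (alpha0 : 0 < alpha) (alpha2 : alpha <= 2)
  (alpha_n : alpha < n%:R).
Local Open Scope ereal_scope.
Notation measure_rV := {measure set (Rn R n) -> \bar R}.
Implicit Types (x y z : 'rV[R]_n) (mu nu lam tau : measure_rV).
Local Notation U := (potential alpha).

Lemma mul_succ_bound (u v : R) : (0 <= u -> 0 <= v -> u * v <= 2 * ((u + 1) * (v + 1)))%R.
Proof. by move=> u0 v0; have : (0 <= u * v)%R by [exact: mulr_ge0]; nra. Qed.

Lemma gap_arith (i1 i3 w p1 p2 p3 r e : R) : (i3 + (w + p3) <= i1 + p2 + r -> i1 <= w ->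
  r <= i3 + e -> p2 + p1 <= p3 -> p1 <= e)%R.
Proof. lra. Qed.

Lemma adde_swap_le (l p q p' q' : R) (u : \bar R) : 0 <= u ->
  l%:E + (p - q)%:E <= u + (p' - q')%:E -> q'%:E + (l + p)%:E <= u + p'%:E + q%:E.
Proof.
case: u => [u| |] // _; last by rewrite !addye// !leey.
by rewrite -!EFinD !lee_fin; lra.
Qed.

Lemma double_gt0 (u : \bar R) : 0 < 2%:E * u -> 0 < u.
Proof. by rewrite pmule_rgt0// lte_fin. Qed.

Lemma riesz_gt0 x z : 0 < riesz alpha x z.
Proof.
rewrite /riesz; case: eqP => [_|/eqP xz]; first exact: lt0y.
by rewrite lte_fin powR_gt0// edist_gt0.
Qed.

Lemma riesz_le (T : R) x z : (0 < T)%R -> (T <= edist x z)%R ->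
  riesz alpha x z <= (T `^ (alpha - n%:R))%:E.
Proof.
move=> T0 Tx; rewrite /riesz; case: eqP => [xz|_].
  move: Tx; rewrite xz; have /eqP -> : edist z z == 0%R by rewrite edist0.
  by rewrite leNgt T0.
by rewrite lee_fin; exact: powR_neg_le.
Qed.

Lemma compact_separation (K : set 'rV[R]_n) x : compact K -> ~ K x ->
  exists2 d : R, (0 < d)%R & forall z, K z -> (d <= edist x z)%R.
Proof.
move=> cK nKx; have cl : closed K by apply: compact_closed => //; exact: norm_hausdorff.
have /nbhs_ballP[d /= d0 dK] : nbhs x (~` K) by apply: open_nbhs_nbhs; split => //; exact: closed_openC.
exists d => // z Kz; rewrite leNgt; apply/negP => h.
apply: (dK z) => //; apply: mx_ball_rV => // i.
by apply: le_lt_trans (coord_le_edist x z i) h.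
Qed.

Lemma potential_le_support mu (K : set 'rV[R]_n) (T : R) x : measurable (K : set (Rn R n)) ->
  mu (~` K) = 0 -> (0 < T)%R -> (forall z, K z -> (T <= edist x z)%R) ->
  U mu x <= (T `^ (alpha - n%:R))%:E * mu setT.
Proof.
move=> mK muK T0 h; rewrite -integral_cst//.
apply: (ge0_le_integral_support mK muK) => //.
- exact: measurable_riesz_l.
- by move=> z; exact: riesz_ge0.
- by move=> z; rewrite lee_fin powR_ge0.
- by move=> z Kz; apply: riesz_le => //; exact: h.
Qed.

Lemma out_box_edist (k T : R) x z : box k z -> ~ box (k + T)%R x -> (T <= edist x z)%R.
Proof.
move=> bz bx; rewrite leNgt; apply/negP => h; apply: bx => i.
rewrite -(subrK (z ord0 i) (x ord0 i)) (le_trans (ler_normD _ _))// addrC.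
by rewrite lerD// (le_trans (coord_le_edist x z i))// ltW.
Qed.

Lemma powR_cvg_infty (p e : R) : (p < 0)%R -> (0 < e)%R ->
  exists2 T : R, (0 < T)%R & (T `^ p <= e)%R.
Proof.
move=> p0 e0; exists (e `^ p^-1)%R; first exact: powR_gt0.
by rewrite -powRrM mulVf ?lt_eqF// powRr1// ltW.
Qed.

Lemma nice_decay K tau (e : R) : nice_on alpha K tau -> (0 < e)%R ->
  exists k : nat, forall x, ~ box k%:R x -> U tau x < e%:E.
Proof.
move=> [cK tfin tK _] e0.
have mK := compact_measurable_rV cK.
have [k kK] := compact_sub_box cK.
have M0 : (0 <= fine (tau setT))%R by rewrite fine_ge0.
have p0 : (alpha - n%:R < 0)%R by rewrite subr_lt0.
have [T T0 hT] := @powR_cvg_infty (alpha - n%:R) (e / (fine (tau setT) + 1)) p0 (divr_gt0 e0 (ltr_wpDl M0 ltr01)).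
exists (k + Num.bound T)%N => x hx.
have tf : tau setT \is a fin_num by rewrite ge0_fin_numE.
apply: (@le_lt_trans _ _ ((T `^ (alpha - n%:R))%:E * tau setT)).
  apply: (potential_le_support mK) => // z /kK Kz; apply: out_box_edist Kz _ => h; apply: hx.
  by move: h; apply: le_box; rewrite natrD lerD2l ltW// archi_boundP// ltW.
rewrite -(fineK tf) -EFinM lte_fin.
apply: (@le_lt_trans _ _ (e / (fine (tau setT) + 1) * fine (tau setT))%R).
  by rewrite ler_wpM2r.
by rewrite mulrAC ltr_pdivrMr ?ltr_wpDl// ltr_pM2l// ltrDl.
Qed.

Lemma powR_cvg_zero (p e : R) : (0 < p)%R -> (0 < e)%R ->
  exists2 T : R, (0 < T <= 1)%R & (T `^ p <= e)%R.
Proof.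
move=> p0 e0; have e1 : (0 < Num.min 1 (e `^ p^-1))%R by rewrite lt_min ltr01 powR_gt0.
exists (Num.min 1 (e `^ p^-1))%R; first by rewrite e1/= ge_min lexx.
apply: (@le_trans _ _ ((e `^ p^-1) `^ p)%R).
  by apply: ge0_ler_powR; rewrite ?nnegrE ?(ltW p0) ?(ltW e1) ?powR_ge0// ge_min lexx orbT.
by rewrite -powRrM mulVf ?gt_eqF// powRr1// ltW.
Qed.

(* The error term decays faster than the kernel itself. *)
Lemma kernel_far x0 (C1 rho b : R) N : (0 <= C1)%R -> (0 < b)%R ->
  (forall z, z != x0 ->
    riesz alpha x0 z <= U N z + (C1 * rho `^ b * edist x0 z `^ (alpha - n%:R - 2 * b))%:E) ->
  exists2 T : R, (0 < T)%R & forall z, (T <= edist x0 z)%R -> riesz alpha x0 z <= 2%:E * U N z.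
Proof.
move=> C10 b0 h; set K := (C1 * rho `^ b)%R in h.
have K0 : (0 <= K)%R by rewrite mulr_ge0 ?powR_ge0.
have p0 : (- (2 * b) < 0)%R by rewrite oppr_lt0 mulr_gt0.
have q0 : (0 < (2 * (K + 1))^-1)%R by rewrite invr_gt0 mulr_gt0// ltr_wpDl.
have [T T0 hT] := powR_cvg_infty p0 q0.
exists T => // z Tz; have e0 := lt_le_trans T0 Tz.
have zx : z != x0 by rewrite eq_sym -edist_gt0.
have := h z zx; rewrite /riesz eq_sym (negbTE zx); set e := edist x0 z in e0 Tz *.
have He : (K * e `^ (alpha - n%:R - 2 * b) <= e `^ (alpha - n%:R) / 2)%R.
  rewrite powRD; last by rewrite (gt_eqF e0) implybT.
  rewrite mulrCA ler_wpM2l ?powR_ge0//.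
  apply: (@le_trans _ _ (K * (2 * (K + 1))^-1)%R).
    by rewrite ler_wpM2l// (le_trans _ hT)// powR_le0_anti// ltW.
  rewrite ler_pdivrMr ?mulr_gt0 ?ltr_wpDl// mulrA mulVf// mul1r lerDl//.
move: (U N z) => [u| |]; last 2 first.
- by move=> _; rewrite gt0_muley ?leey// lte_fin.
- by rewrite leeNy_eq.
rewrite -EFinD -EFinM !lee_fin; move: (e `^ _)%R (K * _)%R He => p q; lra.
Qed.

(** A minimum principle. If the inequality failed at [x1], the function [hh], which is
    [U lam - U mu] plus a small multiple of [U m], would have a minimum below [-c] at a point [x0]
    off [K]. Averaging over the law [N] centred at [x0] does not raise [U lam], lowers [U m] by an
    amount of order [rho^(alpha/2)], and lowers [U mu] by at most a multiple of [rho^b], because [K]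
    stays away from [x0]. As [b > alpha/2], a small [rho] makes the mean of [hh] smaller than its
    minimum. *)
Theorem domination_nice K mu lam (c : R) : nice_on alpha K mu -> radon lam -> (0 <= c)%R ->
  (forall x, K x -> U mu x <= U lam x + c%:E) -> forall x, U mu x <= U lam x + c%:E.
Proof.
move=> niceK rlam c0 h x1; rewrite leNgt; apply/negP => hx1.
have [cK mufin muK [g cg gE]] := niceK.
have mK := compact_measurable_rV cK.
have [b [C1 [C2 [C3 [m [[ab C10 C20 m1 mC3] heat]]]]]] := heat_approximation alpha0 alpha2 alpha_n.
have rm : radon m by apply: finite_radon; rewrite m1 ltry.
have rmu : radon mu by exact: finite_radon.
have mfin z : U m z \is a fin_num by rewrite ge0_fin_numE ?potential_ge0//; exact: le_lt_trans (mC3 z) (ltry _).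
have lam1 : U lam x1 \is a fin_num.
  rewrite ge0_fin_numE ?potential_ge0//; apply: le_lt_trans (ltry (g x1)).
  by rewrite -gE; apply: le_trans (ltW hx1); rewrite leeDl.
(* a small multiple of [U m] is added to make the strict inequality (kernel_gap) available at the minimum *)
pose kap : R := ((g x1 - fine (U lam x1) - c) / 2 / (fine (U m x1) + 1))%R.
have d0 : (0 < g x1 - fine (U lam x1) - c)%R.
  rewrite -addrA -opprD subr_gt0 -lte_fin -gE EFinD (fineK lam1)//.
have um0 : (0 < fine (U m x1) + 1)%R by rewrite ltr_wpDl// fine_ge0// potential_ge0.
have kap0 : (0 < kap)%R by rewrite !divr_gt0.
pose hh x := U lam x + (kap * fine (U m x) - g x)%:E.
have hh1 : hh x1 < (- c)%:E.
  rewrite /hh -(fineK lam1) -EFinD lte_fin.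
  have : (kap * fine (U m x1) <= (g x1 - fine (U lam x1) - c) / 2)%R.
    rewrite /kap -mulrA ler_piMr ?divr_ge0 ?(ltW d0)// ler_pdivrMl// mulr1 lerDl//.
  lra.
have gl (a : R) : open [set x | (a < - g x)%R].
  rewrite (_ : [set x | _] = g @^-1` [set r | r < - a]%R); last first.
    by apply/seteqP; split => x /=; rewrite ltrNr.
  by apply: open_comp; [move=> x _; exact: cg|exact: open_lt].
have ml (a : R) : open [set x | a < kap * fine (U m x) - g x]%R.
  have := @lsc_add _ _ (fun x => kap%:E * U m x) (fun x => - g x)%R _ gl a.
  rewrite (_ : [set x | a%:E < _ + _] = [set x | a < kap * fine (U m x) - g x]%R).
    apply => r; rewrite (_ : [set x | _] = [set x | (r / kap)%:E < U m x]).
      exact: potential_lsc.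
    by apply/seteqP; split => x /=; rewrite -(fineK (mfin x)) -EFinM !lte_fin ltr_pdivrMr// mulrC.
  by apply/seteqP; split => x /=; rewrite -(fineK (mfin x)) -EFinM -EFinD lte_fin.
have hlsc (a : R) : open [set x | a%:E < hh x].
  by apply: lsc_add ml _ => r; exact: potential_lsc.
have ghh x : (- g x)%:E <= hh x.
  rewrite /hh -[leLHS]add0e; apply: leeD; first exact: potential_ge0.
  by rewrite lee_fin lerDr mulr_ge0 ?(ltW kap0)// fine_ge0// potential_ge0.
have hh1f : hh x1 \is a fin_num by rewrite /hh -(fineK lam1).
(* Outside a large box [g] is smaller than [- hh x1], so that [hh >= - g > hh x1]: the minimum over
   the box is global. *)
have [k hk] : exists k : nat, forall x, ~ box k%:R x -> hh x1 < hh x.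
  have r0 : (0 < - fine (hh x1))%R.
    by rewrite oppr_gt0 -lte_fin (fineK hh1f) (lt_le_trans hh1)// lee_fin oppr_le0.
  have [k hk] := nice_decay niceK r0; exists k => x /hk.
  rewrite gE lte_fin ltrNr => gx; apply: lt_le_trans (ghh x).
  by rewrite -(fineK hh1f) lte_fin.
have Lx1 : box k%:R x1 by apply: contrapT => /hk; rewrite ltxx.
have [x0 Lx0 minL] := @lsc_compact_min R 'rV[R]_n hh (box (k%:R)) (@compact_box R n k%:R) (ex_intro _ x1 Lx1) hlsc.
have minG x : hh x0 <= hh x.
  have [bx|/hk bx] := pselect (box k%:R x); first exact: minL.
  by apply: le_trans (ltW bx); exact: minL.
have nKx0 : ~ K x0.
  move=> Kx0; have := le_lt_trans (minG x1) hh1; apply/negP; rewrite -leNgt.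
  have := h _ Kx0; rewrite gE /hh; case: (U lam x0) (potential_ge0 alpha lam x0) => [u| |] //= u0; last first.
    by move=> _; rewrite addye// leey.
  rewrite -!EFinD !lee_fin => gu.
  have : (0 <= kap * fine (U m x0))%R by rewrite mulr_ge0 ?(ltW kap0)// fine_ge0// potential_ge0.
  by move: gu; move: (kap * _)%R (g x0) => p r; lra.
have lam0 : U lam x0 \is a fin_num.
  have := le_lt_trans (minG x1) hh1; rewrite /hh.
  by case: (U lam x0) (potential_ge0 alpha lam x0).
have [d d_gt0 dK] := compact_separation cK nKx0.
have [c' c'0 hheat] := heat x0.
pose M : R := fine (mu setT).
have muf : mu setT \is a fin_num by rewrite ge0_fin_numE.
have M0 : (0 <= M)%R by rewrite fine_ge0.
pose q : R := (alpha - n%:R - 2 * b)%R.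
have ba0 : (0 < b - alpha / 2)%R by rewrite subr_gt0.
have b0 : (0 < b)%R by apply: lt_trans ab; rewrite divr_gt0.
have Q0 : (0 <= C1 * d `^ q * M)%R by rewrite !mulr_ge0 ?powR_ge0.
(* Chosen so that the error [C1 rho^b d^q M] is at most half of the gap [kap c' rho^(alpha/2)]; this
   is possible because [b - alpha/2] is positive. *)
have [rho /andP[rho0 rho1] hrho] := @powR_cvg_zero _ (kap * c' / 2 / (C1 * d `^ q * M + 1)) ba0
  (divr_gt0 (divr_gt0 (mulr_gt0 kap0 c'0) (ltr0n R 2)) (ltr_wpDl Q0 ltr01)).
have [N [N1 Nle Nge Nsup [Nharn Nmax Nm]]] := hheat rho rho0.
have rN : radon N by apply: finite_radon; rewrite N1 ltry.
have err : (g x0)%:E <= \int[N]_x U mu x + (C1 * rho `^ b * d `^ q * M)%:E.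
  rewrite -gE potential_sym//.
  have -> : (C1 * rho `^ b * d `^ q * M)%:E = \int[mu]_x (C1 * rho `^ b * d `^ q)%:E.
    by rewrite integral_cst// EFinM (fineK muf).
  have e0 : (0 <= C1 * rho `^ b * d `^ q)%R by rewrite !mulr_ge0 ?powR_ge0.
  rewrite -ge0_integralD//; first last.
  - exact: measurable_potential.
  - by move=> x _; exact: potential_ge0.
  apply: (ge0_le_integral_support mK muK).
  - exact: measurable_riesz_l.
  - by apply: emeasurable_funD => //; exact: measurable_potential.
  - by move=> z; exact: riesz_ge0.
  - by move=> z; rewrite adde_ge0 ?potential_ge0.
  - move=> z Kz; have zx0 : z != x0 by apply/eqP => zx; apply: nKx0; rewrite -zx.
    apply: le_trans (Nge z zx0) _; rewrite leeD2l// lee_fin ler_wpM2l ?mulr_ge0 ?powR_ge0//.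
    apply: powR_le0_anti => //; last exact: dK.
    by rewrite /q subr_le0 (le_trans (ltW (_ : alpha - n%:R < 0)%R))// ?subr_lt0// mulr_ge0// ltW.
have lamN : \int[N]_x U lam x <= U lam x0.
  rewrite potential_sym//; apply: ge0_le_integral => //.
  - by move=> z _; exact: potential_ge0.
  - exact: measurable_potential.
  - exact: measurable_riesz_l.
have mN : \int[N]_x U m x + (c' * rho `^ (alpha / 2))%:E <= U m x0.
  by rewrite potential_sym//; exact: Nm.
have main : \int[N]_x U mu x + (fine (U lam x0) + kap * fine (U m x0))%:E <=
    \int[N]_x U lam x + kap%:E * \int[N]_x U m x + (g x0)%:E.
  have g0 : (0 <= g x0)%R by rewrite -lee_fin -gE potential_ge0.
  have A0 : (0 <= fine (U lam x0) + kap * fine (U m x0))%R.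
    by apply: addr_ge0; [|apply: mulr_ge0; first exact: ltW]; rewrite fine_ge0 ?potential_ge0.
  have km : measurable_fun [set: Rn R n] (fun x : Rn R n => kap%:E * U m x).
    by apply: emeasurable_funM => //; exact: measurable_potential.
  have k0 x : 0 <= kap%:E * U m x by rewrite mule_ge0 ?potential_ge0// lee_fin ltW.
  have mlam := measurable_potential alpha_n rlam.
  have mmu := measurable_potential alpha_n rmu.
  have mlm : measurable_fun [set: Rn R n] (fun x : Rn R n => U lam x + kap%:E * U m x).
    exact: emeasurable_funD.
  have lm0 x : 0 <= U lam x + kap%:E * U m x by rewrite adde_ge0 ?potential_ge0.
  have I2E : \int[N]_x U lam x + kap%:E * \int[N]_x U m x = \int[N]_x (U lam x + kap%:E * U m x).
    rewrite (ge0_integralD N measurableT (fun x _ => potential_ge0 alpha lam x) mlam (fun x _ => k0 x) km).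
    have mum := measurable_potential alpha_n rm.
    have kap0' : 0 <= kap%:E by rewrite lee_fin ltW.
    by rewrite (ge0_integralZl N measurableT mum (fun x _ => potential_ge0 alpha m x) kap0').
  rewrite I2E -(ge0_integral_addr_cst N1 mlm lm0 g0) -(ge0_integral_addr_cst N1 mmu (potential_ge0 alpha mu) A0).
  apply: ge0_le_integral => //.
  - by move=> x _; rewrite adde_ge0 ?potential_ge0.
  - exact: emeasurable_funD.
  - exact: emeasurable_funD.
  - move=> x _; have := minG x; rewrite /hh gE -(fineK lam0) -(fineK (mfin x)) -EFinM.
    exact: adde_swap_le (potential_ge0 alpha lam x).
have IlamF : \int[N]_x U lam x \is a fin_num.
  rewrite ge0_fin_numE; last by apply: integral_ge0 => x _; exact: potential_ge0.
  by apply: le_lt_trans lamN _; rewrite ltey_eq lam0.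
have ImF : \int[N]_x U m x \is a fin_num.
  rewrite ge0_fin_numE; last by apply: integral_ge0 => x _; exact: potential_ge0.
  have : U m x0 < +oo by rewrite ltey_eq mfin.
  by apply: le_lt_trans; apply: le_trans mN; rewrite leeDl// lee_fin mulr_ge0 ?powR_ge0// ltW.
have ImuF : \int[N]_x U mu x \is a fin_num.
  rewrite ge0_fin_numE; last by apply: integral_ge0 => x _; exact: potential_ge0.
  move: main; rewrite -(fineK IlamF) -(fineK ImF) -EFinM -!EFinD.
  move=> hI; apply: le_lt_trans (ltry _); apply: le_trans hI; rewrite leeDl// lee_fin.
  by apply: addr_ge0; [|apply: mulr_ge0; first exact: ltW]; rewrite fine_ge0 ?potential_ge0.
move: main mN lamN err; rewrite -(fineK IlamF) -(fineK ImF) -(fineK ImuF) -(fineK lam0) -(fineK (mfin x0)).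
set I1 := fine (integral N _ (U lam)); set I2 := fine (integral N _ (U m)); set I3 := fine (integral N _ (U mu)).
rewrite -!EFinM -!EFinD !lee_fin => main mN lamN err.
have gap : (kap * (c' * rho `^ (alpha / 2)) <= C1 * rho `^ b * d `^ q * M)%R.
  have : (kap * (I2 + c' * rho `^ (alpha / 2)) <= kap * fine (U m x0))%R by rewrite ler_wpM2l// ltW.
  rewrite mulrDr; exact: gap_arith main lamN err.
have bE : (rho `^ b = rho `^ (b - alpha / 2) * rho `^ (alpha / 2))%R.
  by rewrite -powRD ?subrK// (gt_eqF rho0) implybT.
have ra0 : (0 < rho `^ (alpha / 2))%R by exact: powR_gt0.
move: gap; rewrite bE.
have -> : (C1 * (rho `^ (b - alpha / 2) * rho `^ (alpha / 2)) * d `^ q * M =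
  (C1 * d `^ q * M) * rho `^ (b - alpha / 2) * rho `^ (alpha / 2))%R by ring.
rewrite mulrA ler_pM2r//; apply/negP; rewrite -ltNge.
apply: (@le_lt_trans _ _ ((C1 * d `^ q * M + 1) * (kap * c' / 2 / (C1 * d `^ q * M + 1))))%R.
  by apply: ler_pM => //; rewrite ?powR_ge0// lerDl.
have kc0 : (0 < kap * c')%R by exact: mulr_gt0.
rewrite mulrC divfK ?gt_eqF ?ltr_wpDl// ltr_pdivrMr// ltr_pMr//.
by rewrite ltr1n.
Qed.

(** [mu] is restricted to a compact set where [nice_restriction] makes its potential continuous. The
    lost part may still have a large potential, so [U mu x] is reached through truncated potentials:
    their kernel is bounded by [T], and a lost mass below [e / T] costs at most [e]. *)
Theorem domination mu lam (B : set (Rn R n)) (c : R) : mu setT < +oo -> radon lam -> (0 <= c)%R ->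
  measurable B -> mu (~` B) = 0 -> (forall x, B x -> U mu x < +oo) ->
  (forall x, B x -> U mu x <= U lam x + c%:E) -> forall x, U mu x <= U lam x + c%:E.
Proof.
move=> mufin rlam c0 mB muB muoo h x.
have [lamx|lamx] := eqVneq (U lam x) +oo; first by rewrite lamx addye// leey.
have lamf : U lam x \is a fin_num.
  by rewrite ge0_fin_numE ?potential_ge0// ltey.
rewrite leNgt; apply/negP; rewrite -(fineK lamf) -EFinD; set v := (fine _ + c)%R => hx.
have [m] := potential_sup alpha_n hx; apply/negP; rewrite -leNgt.
have m0 : (0 < m.+1%:R^-1 :> R)%R by rewrite invr_gt0.
pose T : R := (m.+1%:R^-1 `^ (alpha - n%:R))%R.
have T0 : (0 < T)%R by rewrite powR_gt0.
have rmu : radon mu by exact: finite_radon.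
apply/lee_addgt0Pr => e e0.
have [K [mK [KB muK nK]]] := nice_restriction alpha_n mufin mB muoo (divr_gt0 e0 T0).
have mnK : measurable (~` K : set (Rn R n)) by exact: measurableC.
have rle z : U (mrestr mu mK) z <= U mu z.
  rewrite /potential ge0_integral_mrestr; last 2 first.
  - exact: measurable_riesz_l.
  - by move=> w; exact: riesz_ge0.
  apply: ge0_subset_integral => //; last by move=> w _; exact: riesz_ge0.
  exact: measurable_riesz_l.
have hK : U (mrestr mu mK) x <= v%:E.
  rewrite /v EFinD (fineK lamf); apply: (domination_nice nK rlam c0) => z Kz.
  by apply: le_trans (h z (KB z Kz)); exact: rle.
rewrite truncated_potentialE.
set f := (X in \int[mu]_z X z).
have mf : measurable_fun [set: Rn R n] f.
  apply/(measurable_restrictT _ _).1; first exact: measurable_box.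
  by apply: measurable_funTS; apply/measurable_EFinP; exact: measurable_truncated_riesz_l.
have f0 z : 0 <= f z by apply: erestrict_ge0 => w _; rewrite lee_fin truncated_riesz_ge0.
rewrite (ge0_integral_splitC mu (mK : measurable (K : set (Rn R n))) mf f0).
apply: leeD.
  rewrite -ge0_integral_mrestr//; apply: le_trans hK.
  by rewrite -truncated_potentialE; exact: truncated_potential_le.
apply: (@le_trans _ _ (\int[mu]_(z in ~` K) T%:E)).
  apply: ge0_le_integral => //; first exact: measurable_funTS.
  move=> z _; rewrite /f patchE; case: ifP => _; last by rewrite lee_fin ltW.
  by rewrite lee_fin truncated_riesz_le_cst.
rewrite integral_cst//.
apply: (@le_trans _ _ (T%:E * (e / T)%:E)); last by rewrite -EFinM mulrC divfK// gt_eqF.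
apply: lee_pmulE; first exact: ltW.
apply: le_trans (ltW muK); rewrite -[leRHS]adde0 -muB.
apply: (le_trans _ (measureU2 _ _ _)); rewrite ?setDE//; last exact: measurableC.
  by apply: le_measure; rewrite ?inE//; [apply: measurableU; [exact: measurableI|exact: measurableC]|move=> z nKz /=; have [Bz|] := pselect (B z); [left|right]].
exact: measurableI.
Qed.

(** Integrating both potentials against a law [N] and using symmetry compares the integrals of [U N]
    under [lam] and [nu]. For [N] centred at the origin and [rho] large, [U N] is at most [U N 0]
    everywhere and nearly [U N 0] on a given box; dividing by this positive number compares the
    masses. *)
Theorem mass_comparison lam nu : radon lam -> radon nu -> (forall x, U lam x <= U nu x) ->
  lam setT <= nu setT.
Proof.
move=> rlam rnu lamnu.
have [b [C1 [C2 [C3 [m [[ab C10 C20 m1 mC3] heat]]]]]] := heat_approximation alpha0 alpha2 alpha_n.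
have [c' c'0 hheat] := heat 0%R.
have n0 : (0 < n)%N by rewrite -(ltr_nat R); apply: lt_trans alpha_n.
(* [U N] is positive at the origin since it dominates half of the kernel far away *)
have key (k : nat) (rho : R) : (0 < rho)%R ->
    (expR (- (n%:R * k%:R) ^+ 2 / (2 * rho)))%:E * lam (box k%:R) <= nu setT.
  move=> rho0; have [N [N1 Nle Nge Nsup [Nharn Nmax Nm]]] := hheat rho rho0.
  have rN : radon N by apply: finite_radon; rewrite N1 ltry.
  have u_fin : U N 0%R \is a fin_num.
    by rewrite ge0_fin_numE ?potential_ge0//; exact: le_lt_trans (Nsup 0%R) (ltry _).
  have u0 : 0 < U N 0%R.
    have b0 : (0 < b)%R by apply: lt_trans ab; rewrite divr_gt0.
    have [T T0 hT] := kernel_far C10 b0 Nge.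
    pose z : 'rV[R]_n := const_mx T.
    have Tz : (T <= edist 0%R z)%R.
      apply: le_trans (coord_le_edist 0%R z (Ordinal n0)).
      by rewrite !mxE sub0r normrN ler_norm.
    have := lt_le_trans _ (hT z Tz) => /(_ 0); rewrite riesz_gt0 => /(_ isT).
    move=> /double_gt0 h; exact: lt_le_trans h (Nmax z).
  rewrite -(@lee_pmul2l _ (U N 0%R))//.
  have mN := measurable_potential alpha_n rN.
  have N0 x : 0 <= U N x by exact: potential_ge0.
  apply: (@le_trans _ _ (\int[nu]_x U N x)); last exact: (ge0_integral_le_cst nu mN N0 Nmax).
  apply: (@le_trans _ _ (\int[lam]_x U N x)); last first.
    rewrite (potential_sym alpha_n rN rlam) (potential_sym alpha_n rN rnu).
    apply: ge0_le_integral => //.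
    - by move=> x _; exact: potential_ge0.
    - exact: measurable_potential.
    - exact: measurable_potential.
  rewrite muleA; apply: ge0_integral_ge_cst.
  - exact: measurable_box.
  - exact: mN.
  - exact: N0.
  - by rewrite mule_ge0// lee_fin expR_ge0.
  - move=> x bx; apply: le_trans (Nharn x); rewrite muleC; apply: lee_wpmul2r; first exact: N0.
    rewrite lee_fin ler_expR !mulNr lerN2 ler_pM2r ?invr_gt0 ?mulr_gt0//.
    rewrite ler_sqr ?nnegrE ?edist_ge0 ?mulr_ge0//; apply: edist_le => // i.
    by rewrite mxE sub0r normrN; exact: bx.
have boxle (k : nat) : lam (box k%:R) <= nu setT.
  have lf : lam (box k%:R) \is a fin_num by rewrite ge0_fin_numE//; apply: rlam; exact: compact_box.
  have [->|nuoo] := eqVneq (nu setT) +oo; first exact: leey.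
  have nf : nu setT \is a fin_num by rewrite ge0_fin_numE// ltey.
  rewrite -(fineK nf); apply/lee_addgt0Pr => e e0; rewrite -(fineK lf) -EFinD lee_fin.
  set v := fine (nu setT); have v0 : (0 <= v)%R by rewrite fine_ge0.
  set L := fine _; have L0 : (0 <= L)%R by rewrite fine_ge0.
  pose A := ((n%:R * k%:R) ^+ 2 : R)%R.
  have A0 : (0 <= A)%R by exact: sqr_ge0.
  (* Makes the loss [A L / (2 rho)], which comes from [exp(-u) >= 1 - u], at most [e]. *)
  pose rho := ((A + 1) * (L + 1) / e)%R.
  have rho0 : (0 < rho)%R by rewrite divr_gt0// mulr_gt0// ltr_wpDl.
  have := key k rho rho0; rewrite -(fineK nf) -(fineK lf) -/L -/v -EFinM lee_fin -/A => h.
  have h1 : (1 - A / (2 * rho) <= expR (- A / (2 * rho)))%R.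
    by apply: le_trans (expR_ge1Dx _); rewrite mulNr.
  have h2 : (A / (2 * rho) * L <= e)%R.
    have r2 : (0 < 2 * rho)%R by exact: mulr_gt0.
    rewrite mulrAC ler_pdivrMr//.
    have -> : (e * (2 * rho) = 2 * ((A + 1) * (L + 1)))%R.
      by rewrite /rho; field; rewrite gt_eqF.
    by apply: mul_succ_bound.
  have : ((1 - A / (2 * rho)) * L <= v)%R by apply: le_trans h; rewrite ler_wpM2r.
  by rewrite mulrBl mul1r; lra.
have cv : lam (box k%:R) @[k --> \oo] --> lam setT.
  have -> : [set: Rn R n] = \bigcup_k (box k%:R : set (Rn R n)) by rewrite bigcup_box.
  apply: nondecreasing_cvg_mu.
  - by move=> k; exact: measurable_box.
  - by rewrite bigcup_box; exact: measurableT.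
  - by move=> i j ij; apply/subsetPset; apply: le_box; rewrite ler_nat.
by apply: cvge_le cv; near=> k; exact: boxle.
Unshelve. all: by end_near. Qed.

End domination.

(** * Nearly everywhere inequalities *)

Section nearly_everywhere.
Context {R : realType} {n : nat} (alpha : R) (alpha_n : alpha < n%:R).
Local Open Scope ereal_scope.
Notation measure_rV := {measure set (Rn R n) -> \bar R}.
Implicit Types (x y z : 'rV[R]_n) (mu nu lam tau rho : measure_rV) (A K : set 'rV[R]_n).
Implicit Types (B : set (Rn R n)) (P : 'rV[R]_n -> Prop).
Local Notation U := (potential alpha).

Lemma mulpinfty_null (a : \bar R) (b : \bar R) : 0 <= a -> +oo * a <= b -> b < +oo -> a = 0.
Proof.
rewrite le_eqVlt => /orP[/eqP //|a0]; rewrite gt0_mulye// => h1 h2.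
by have := le_lt_trans h1 h2; rewrite ltxx.
Qed.

Lemma atom_null mu y : U mu y < +oo -> mu [set y : Rn R n] = 0.
Proof.
apply: mulpinfty_null => //; apply: ge0_integral_ge_cst => //.
- by apply: compact_measurable_rV; exact: compact_set1.
- exact: measurable_riesz_l.
- by move=> z; exact: riesz_ge0.
- by move=> z ->; rewrite /riesz eqxx.
Qed.

Lemma eq_lee (a b : \bar R) : a = b -> a <= b.
Proof. by move=> ->. Qed.

Lemma measurable_potential_infty mu : radon mu -> measurable [set x : Rn R n | U mu x = +oo].
Proof.
move=> rmu; rewrite (_ : [set x | _] = setT `&` [set x : Rn R n | +oo <= U mu x]).
  by apply: emeasurable_fun_le => //; exact: measurable_potential.
by rewrite setTI; apply/seteqP; split => x /=; rewrite leye_eq => /eqP.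
Qed.

Lemma energy_null mu : radon mu -> energy alpha mu < +oo -> mu [set x : Rn R n | U mu x = +oo] = 0.
Proof.
move=> rmu; apply: mulpinfty_null => //; apply: ge0_integral_ge_cst => //.
- exact: measurable_potential_infty.
- exact: measurable_potential.
- by move=> z; exact: potential_ge0.
- by move=> z ->.
Qed.

(* The point [y] may be avoided since a measure of finite energy does not charge points. *)
Lemma ne_onI A y P : (forall K tau, nice_on alpha K tau -> K `<=` A -> ~ K y ->
    (forall x, K x -> ~ P x) -> tau setT = 0) -> ne_on alpha A P.
Proof.
move=> h; rewrite /ne_on /cap_zero /inv_inner_cap.
rewrite (_ : [set energy alpha mu | mu in _] = set0) ?ereal_inf0//.
rewrite -subset0 => _ [mu [rmu [[N [mN muN EN]] [Emu mu1]]] _] /=.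
pose B0 := [set x : Rn R n | U mu x = +oo].
have mB0 : measurable B0.
  exact: measurable_potential_infty.
have muB0 : mu B0 = 0 by exact: energy_null.
have my : measurable ([set y] : set (Rn R n)) by apply: compact_measurable_rV; exact: compact_set1.
pose Z := N `|` B0 `|` [set y : Rn R n].
have mZ : measurable Z by do 2 apply: measurableU => //.
have muy : mu [set y : Rn R n] = 0.
  have [uy|uy] := eqVneq (U mu y) +oo; last by apply: atom_null; rewrite ltey.
  apply/eqP; rewrite eq_le measure_ge0 andbT; apply: le_trans (eq_lee muB0).
  by apply: le_measure; [exact: mem_set|exact: mem_set|move=> _ ->].
have muZ : mu Z = 0.
  have mNB : measurable (N `|` B0) by exact: measurableU.
  apply/eqP; rewrite eq_le measure_ge0 andbT.
  apply: (@le_trans _ _ (mu N + mu B0 + mu [set y : Rn R n])).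
    apply: (@le_trans _ _ (mu (N `|` B0) + mu [set y : Rn R n])); first exact: measureU2.
    by apply: leeD; [exact: measureU2|exact: lexx].
  by rewrite muN muB0 muy !adde0.
have mufin : mu setT < +oo by rewrite mu1 ltry.
(* Since [mu] has mass 1, losing less than [1/2] leaves a restriction of positive mass, whereas the
   hypothesis forces it to vanish. *)
have [||K [mK [KB muK nK]]] := @nice_restriction R n alpha alpha_n mu mufin (~` Z) 2^-1 (measurableC mZ).
- move=> x Zx; rewrite ltey; apply/eqP => ux; apply: Zx; left; right; exact: ux.
- by rewrite invr_gt0.
have KE x : K x -> A x /\ ~ P x.
  by move=> /KB nZx; apply: contrapT => /EN Nx; apply: nZx; left; left.
have tau0 : mrestr mu mK setT = 0.
  apply: (h K) => //.
  - by move=> x /KE[].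
  - by move=> /KB; apply; right.
  - by move=> x /KE[].
move: tau0; rewrite /= /mrestr setTI => muK0.
have : mu setT <= mu Z + (mu (~` Z `\` K) + mu K).
  have mD : measurable (~` Z `\` K) by apply: measurableD => //; exact: measurableC.
  apply: (@le_trans _ _ (mu (Z `|` (~` Z `\` K `|` K)))).
    apply: le_measure; rewrite ?inE//; first by do 2 apply: measurableU => //.
    move=> x _; have [Zx|Zx] := pselect (Z x); first by left.
    by right; have [Kx|Kx] := pselect (K x); [right|left].
  apply: le_trans (measureU2 _ _ _) _ => //; first exact: measurableU.
  by rewrite leeD2l// measureU2.
rewrite mu1 muZ muK0 add0e adde0 => /le_lt_trans /(_ muK).
by rewrite lte_fin ltNge invf_le1// ler1n.
Qed.

Lemma nice_bounded_on K tau : nice_on alpha K tau -> exists2 M : R, (0 <= M)%R &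
  forall x, K x -> U tau x <= M%:E.
Proof.
move=> [cK _ _ [g cg gE]].
have [K0|K0] := pselect (K !=set0); last by exists 0%R => // x Kx; exfalso; apply: K0; exists x.
have gl (a : R) : open [set x | a%:E < (- g x)%:E].
  rewrite (_ : [set x | _] = g @^-1` [set r | r < - a]%R); last first.
    by apply/seteqP; split => x /=; rewrite lte_fin ltrNr.
  by apply: open_comp; [move=> x _; exact: cg|exact: open_lt].
have [x0 Kx0 hx0] := lsc_compact_min cK K0 gl.
exists (g x0); first by rewrite -lee_fin -gE potential_ge0.
by move=> x /hx0; rewrite gE !lee_fin lerN2.
Qed.

Lemma nice_energy K tau : nice_on alpha K tau -> energy alpha tau < +oo.
Proof.
move=> nK; have [M M0 hM] := nice_bounded_on nK; have [cK tfin tK _] := nK.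
have mK := compact_measurable_rV cK.
have rt : radon tau by exact: finite_radon.
apply: (@le_lt_trans _ _ (M%:E * tau setT)); last first.
  by rewrite lte_mul_pinfty// lee_fin.
rewrite -integral_cst//; apply: (ge0_le_integral_support mK tK) => //.
- exact: measurable_potential.
- by move=> x; exact: potential_ge0.
Qed.

Lemma potential_mscale (c : {nonneg R}) mu x : U (mscale c mu) x = (c%:num)%:E * U mu x.
Proof.
rewrite /potential ge0_integral_mscale//; first exact: measurable_riesz_l.
by move=> z _; exact: riesz_ge0.
Qed.

(** Converse of [ne_onI]: a nice measure has finite energy, so a nonzero one, normalised, would
    compete in the definition of the capacity of the exceptional set. *)
Lemma ne_onE A P K tau : ne_on alpha A P -> nice_on alpha K tau -> K `<=` A ->
  (forall x, K x -> ~ P x) -> tau setT = 0.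
Proof.
move=> ne nK KA KP; have [cK tfin tK _] := nK.
apply/eqP; rewrite -[_ == _]negbK; apply/negP => t0'.
have t0 : 0 < tau setT by rewrite lt_neqAle eq_sym t0'/=.
have tf : tau setT \is a fin_num by rewrite ge0_fin_numE.
have c0 : (0 < (fine (tau setT))^-1)%R by rewrite invr_gt0 fine_gt0// t0.
pose c : {nonneg R} := NngNum (ltW c0).
pose mu : measure_rV := mscale c tau.
have mu1 : mu setT = 1.
  by rewrite /mu/= /mscale/= -[X in _ * X](fineK tf) -EFinM mulVf// gt_eqF// -invr_gt0.
have Efin : energy alpha mu < +oo.
  rewrite /energy; under eq_integral do rewrite potential_mscale.
  have rt : radon tau by exact: finite_radon.
  have mt := measurable_potential alpha_n rt.
  rewrite ge0_integral_mscale//; last 2 first.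
  - by apply: emeasurable_funM => //.
  - by move=> x _; rewrite mule_ge0 ?potential_ge0// lee_fin.
  rewrite ge0_integralZl//; last by move=> x _; exact: potential_ge0.
  rewrite lte_mul_pinfty ?lee_fin// lte_mul_pinfty ?lee_fin//.
  exact: nice_energy nK.
move: ne; rewrite /ne_on /cap_zero /inv_inner_cap => h.
have : ereal_inf [set energy alpha mu | mu in [set mu : measure_rV | radon mu /\
    concentrated mu [set x | A x /\ ~ P x] /\ energy alpha mu < +oo /\ mu setT = 1]] <= energy alpha mu.
  apply: ereal_inf_lbound; exists mu => //; split.
    by apply: finite_radon; rewrite mu1 ltry.
  split=> //; exists (~` K); split.
  - by apply: measurableC; exact: compact_measurable_rV.
  - by rewrite /mu/= /mscale/= tK mule0.
  - by move=> x nE Kx; apply: nE; split; [exact: KA|exact: KP].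
by rewrite h => /le_lt_trans/(_ Efin); rewrite ltxx.
Qed.

Lemma ne_on_null A P mu B : ne_on alpha A P -> mu setT < +oo -> measurable B -> B `<=` A ->
  (forall x, B x -> U mu x < +oo) -> (forall x, B x -> ~ P x) -> mu B = 0.
Proof.
move=> ne mufin mB BA Boo BP; apply/eqP; rewrite eq_le measure_ge0 andbT.
apply/lee_addgt0Pr => e e0; rewrite add0e.
have [K [mK [KB muK nK]]] := nice_restriction alpha_n mufin mB Boo e0.
have := ne_onE ne nK (subset_trans KB BA) (fun x Kx => BP x (KB x Kx)).
rewrite /= /mrestr setTI => muK0.
have -> : B = (B `\` K) `|` K by rewrite setUC setDUK.
apply: le_trans (measureU2 _ _ _) _ => //; first exact: measurableD.
by rewrite -[leRHS]adde0; apply: leeD; [exact: ltW|exact: eq_lee muK0].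
Qed.

(** The inequality [f <= U rho] nearly everywhere on [A], in integrated form. By symmetry the right
    side is the integral of [U tau] against [rho], which is what passes to vague limits; [weak_ne]
    converts the result back. *)
Definition weak_ge A (f : 'rV[R]_n -> \bar R) rho :=
  forall K tau, nice_on alpha K tau -> K `<=` A ->
    \int[tau]_x f x <= \int[tau]_x U rho x.

Lemma weak_null A f rho mu B : weak_ge A f rho -> measurable_fun [set: Rn R n] f ->
  (forall x, 0 <= f x) -> radon rho -> mu setT < +oo -> measurable B -> B `<=` A ->
  (forall x, B x -> U mu x < +oo) -> (forall x, B x -> f x < +oo) ->
  (forall x, B x -> U rho x < f x) -> mu B = 0.
Proof.
move=> hw mf f0 rrho mufin mB BA Boo foo Bf.
have mU := measurable_potential alpha_n rrho.
(* On [Bn k] the gap is at least [1/(k+1)] and [U rho <= f <= k], so the integrals are finite and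
   can be subtracted. *)
pose Bn (k : nat) := B `&` [set x | U rho x + (k.+1%:R^-1)%:E <= f x] `&` [set x | f x <= k%:R%:E].
have mBn k : measurable (Bn k).
  apply: measurableI; first apply: measurableI => //.
    rewrite -[X in measurable X]setTI; apply: emeasurable_fun_le => //.
    exact: emeasurable_funD.
  by rewrite -[X in measurable X]setTI; apply: emeasurable_fun_le.
have BE : B = \bigcup_k Bn k.
  apply/seteqP; split; last by move=> x [k _ [[]]].
  move=> x Bx; have := Bf x Bx; have := foo x Bx.
  have Ux0 := potential_ge0 alpha rho x.
  case E : (f x) => [r| |] // _; last by rewrite ltNge leNye.
  case Eu : (U rho x) Ux0 => [u| |] // u0; rewrite lte_fin => ur.
  pose k := maxn (Num.bound r) (Num.bound (r - u)^-1).
  have r0 : (0 < r)%R by apply: le_lt_trans ur; rewrite -lee_fin.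
  have ru0 : (0 < r - u)%R by rewrite subr_gt0.
  exists k => //; split; last first.
    rewrite /= E lee_fin (le_trans (ltW (archi_boundP (ltW r0))))// ler_nat leq_maxl//.
  split => //=; rewrite E Eu -EFinD lee_fin -lerBrDl.
  rewrite -[leRHS]invrK lef_pV2 ?posrE ?invr_gt0//.
  apply: (le_trans (ltW (archi_boundP _))); first by rewrite invr_ge0 ltW.
  by rewrite ler_nat (leq_trans (leq_maxr (Num.bound r) _)).
apply/eqP; rewrite eq_le measure_ge0 andbT BE.
apply: (@le_trans _ _ (\sum_(0 <= k <oo) mu (Bn k))).
  by apply: measure_sigma_subadditive => //; exact: bigcupT_measurable.
rewrite eseries0// => k _ _.
have BnB : Bn k `<=` B by move=> x [[]].
apply/eqP; rewrite eq_le measure_ge0 andbT.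
apply/lee_addgt0Pr => e e0; rewrite add0e.
have [K [mK [KB muK nK]]] := nice_restriction alpha_n mufin (mBn k) (fun x h => Boo x (BnB x h)) e0.
suff muK0 : mu K = 0.
  have -> : Bn k = (Bn k `\` K) `|` K by rewrite setUC setDUK.
  apply: le_trans (measureU2 _ _ _) _ => //; first exact: measurableD.
  by rewrite -[leRHS]adde0; apply: leeD; [exact: ltW|exact: eq_lee muK0].
have KA : K `<=` A by move=> x /KB/BnB/BA.
have := hw _ _ nK KA.
rewrite !ge0_integral_mrestr//; last by move=> x; exact: potential_ge0.
set I := \int[mu]_(x in K) U rho x => h.
have muKfin : mu K \is a fin_num.
  by rewrite ge0_fin_numE//; apply: le_lt_trans mufin; apply: le_measure; rewrite ?inE.
have Ifin : I \is a fin_num.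
  rewrite ge0_fin_numE; last by apply: integral_ge0 => x _; exact: potential_ge0.
  apply: (@le_lt_trans _ _ (\int[mu]_(x in K) k%:R%:E)).
    apply: ge0_le_integral => //.
    - by move=> x _; exact: potential_ge0.
    - exact: measurable_funTS.
    - move=> x /KB [[_ /= h1] h2]; apply: le_trans h2; apply: le_trans h1.
      by rewrite leeDl// lee_fin invr_ge0.
  by rewrite integral_cst// lte_mul_pinfty ?lee_fin// -ge0_fin_numE.
have : I + (k.+1%:R^-1)%:E * mu K <= I.
  apply: le_trans h; rewrite -integral_cst// -ge0_integralD//; first last.
  - by move=> x _; rewrite lee_fin invr_ge0.
  - exact: measurable_funTS.
  - by move=> x _; exact: potential_ge0.
  apply: ge0_le_integral => //.
  - by move=> x _; rewrite adde_ge0 ?potential_ge0// lee_fin invr_ge0.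
  - by apply: emeasurable_funD => //; exact: measurable_funTS.
  - exact: measurable_funTS.
  - by move=> x /KB [[_ /= h1] h2].
rewrite -[leRHS]adde0 leeD2lE// => h'.
apply/eqP; rewrite eq_le measure_ge0 andbT -(@lee_pmul2l _ (k.+1%:R^-1)%:E)//.
  by rewrite mule0.
Qed.

(** Removing [y], which is legitimate by [ne_onI], allows [f] to be infinite there, as the kernel
    with pole [y] is. *)
Lemma weak_ne A y f rho : weak_ge (A `\ y) f rho -> measurable_fun [set: Rn R n] f ->
  (forall x, 0 <= f x) -> radon rho -> (forall x, x <> y -> f x < +oo) ->
  ne_on alpha A (fun x => f x <= U rho x).
Proof.
move=> hw mf f0 rrho foo; apply: (@ne_onI A y) => K tau nK KA Ky KP.
have [cK tfin tK [g _ gE]] := nK; have mK := compact_measurable_rV cK.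
have Kny x : K x -> x <> y by move=> Kx xy; apply: Ky; rewrite -xy.
have tK0 : tau K = 0.
  apply: (weak_null hw) => //.
  - by move=> x Kx; split; [exact: KA|exact: Kny].
  - by move=> x _; rewrite gE ltry.
  - by move=> x /Kny; exact: foo.
  - by move=> x /KP/negP; rewrite -ltNge.
apply/eqP; rewrite eq_le measure_ge0 andbT -(setUv K).
apply: le_trans (measureU2 _ _ _) _ => //; first exact: measurableC.
by rewrite -[leRHS]adde0; apply: leeD; [exact: eq_lee tK0|exact: eq_lee tK].
Qed.

End nearly_everywhere.

(** * Vague convergence *)

Section vague_convergence.
Context {R : realType} {n : nat}.
Local Open Scope ereal_scope.
Notation measure_rV := {measure set (Rn R n) -> \bar R}.
Implicit Types (x y z : 'rV[R]_n) (mu nu lam tau : measure_rV) (K : set 'rV[R]_n).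

(** The clause on open sets carries masses and supports to the limit; the clause on compactly
    supported continuous functions carries potentials and integrals of potentials. *)
Definition vaguely {I : Type} (F : set_system I) (rho : I -> measure_rV) lam :=
  [/\ radon lam,
    forall (G : set 'rV[R]_n) (r : R), open G -> r%:E < lam G -> \forall i \near F, r%:E < rho i G &
    forall (phi : 'rV[R]_n -> R) (k : nat), continuous phi -> (forall x, (0 <= phi x)%R) ->
      (forall x, ~ box k%:R x -> phi x = 0%R) -> forall e : R, (0 < e)%R -> \forall i \near F,
    \int[rho i]_x (phi x)%:E <= \int[lam]_x (phi x)%:E + e%:E /\
    \int[lam]_x (phi x)%:E <= \int[rho i]_x (phi x)%:E + e%:E].

Lemma vague_compactness {I : Type} (F : set_system I) {UF : UltraFilter F} (rho : I -> measure_rV)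
    (M : nat -> R) : (forall k i, rho i (box k%:R) <= (M k)%:E) -> exists lam, vaguely F rho lam.
Proof.
move=> rhoM; have [lam [rlam lamF lamG]] := @vague_limit R n I F UF rho M rhoM.
exists lam; split => // phi k cphi phi0 phik.
exact: (@vague_integral R n I F UF rho M rhoM lam rlam lamF lamG phi k cphi phi0 phik).
Qed.

Lemma vague_mass {I : Type} (F : set_system I) {FF : ProperFilter F} (rho : I -> measure_rV) lam (m : R) :
  vaguely F rho lam -> (\forall i \near F, rho i setT <= m%:E) -> lam setT <= m%:E.
Proof.
move=> [_ hG _] hm; rewrite leNgt; apply/negP => lm.
have := hG setT m openT lm => h.
by have [i [/le_lt_trans/[apply]]] := filter_ex (filterI hm h); rewrite ltxx.
Qed.

Lemma vague_support {I : Type} (F : set_system I) {FF : ProperFilter F} (rho : I -> measure_rV) lam K :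
  vaguely F rho lam -> closed K -> (forall i, rho i (~` K) = 0) -> lam (~` K) = 0.
Proof.
move=> [_ hG _] cK h; apply/eqP; rewrite eq_le measure_ge0 andbT leNgt; apply/negP => l0.
have [i] := filter_ex (hG (~` K) 0%R (closed_openC cK) l0).
by rewrite h ltxx.
Qed.

Definition cutoff (k : nat) x : R := (Num.max 0 (Num.min 1 (k.+1%:R - `|x|)))%R.

Lemma cutoff_ge0 k x : (0 <= cutoff k x)%R. Proof. by rewrite le_max lexx. Qed.

Lemma cutoff_le1 k x : (cutoff k x <= 1)%R. Proof. by rewrite ge_max ler01 ge_min lexx. Qed.

Lemma cutoff1 k x : box k%:R x -> cutoff k x = 1%R.
Proof.
move=> bx; have h : (`|x| <= k%:R)%R by apply: norm_le_rV.
have h1 : (1 <= k.+1%:R - `|x|)%R by rewrite lerBrDr -natr1 addrC lerD2r.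
by rewrite /cutoff (min_idPl h1) (max_idPr ler01).
Qed.

Lemma cutoff0 k x : ~ box k.+1%:R x -> cutoff k x = 0%R.
Proof.
move=> bx; have h : (k.+1%:R <= `|x|)%R.
  rewrite leNgt; apply/negP => h; apply: bx => i.
  by rewrite (le_trans (coord_le_norm x i))// ltW.
rewrite /cutoff; apply/max_idPl; rewrite ge_min subr_le0 h orbT//.
Qed.

Lemma continuous_cutoff k : continuous (cutoff k).
Proof.
apply: (@lipschitz_continuous_rV R n _ 1%R) => x x'; rewrite mul1r /cutoff.
have h1 : (`|x'| <= `|x| + edist x x')%R.
  rewrite -[x' in leLHS](subrK x) addrC (le_trans (ler_normD _ _))// lerD2l.
  apply: norm_le_rV; first exact: edist_ge0.
  by move=> i; rewrite !mxE distrC coord_le_edist.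
have e0 := edist_ge0 x x'.
move: (`|x|)%R (`|x'|)%R (edist x x') h1 e0 => p q e h1 e0.
rewrite ge_max addr_ge0 ?le_max ?lexx//=.
set A := (_ - p)%R; set B := (_ - q)%R; have AB : (A <= B + e)%R by rewrite /A /B; lra.
have hA : (Num.min 1 A <= A)%R by rewrite ge_min lexx orbT.
have hA1 : (Num.min 1 A <= 1)%R by rewrite ge_min lexx.
have hB : (Num.min 1 B <= Num.max 0 (Num.min 1 B))%R by rewrite le_max lexx orbT.
move: (Num.max _ _) hB => v; move: (Num.min 1%R A) hA hA1 => u.
by case: (leP 1%R B) => ?; lra.
Qed.

End vague_convergence.

(** * Gauss variation and sweeping on compact sets *)

Section energy_limits.
Context {R : realType} {n : nat} (alpha : R) (alpha_n : alpha < n%:R).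
Local Open Scope ereal_scope.
Notation measure_rV := {measure set (Rn R n) -> \bar R}.
Implicit Types (x y z : 'rV[R]_n) (mu nu lam tau : measure_rV) (K : set 'rV[R]_n).
Local Notation U := (potential alpha).
Local Notation tk := (truncated_riesz alpha).
Local Notation tkn m := (truncated_riesz alpha (m.+1%:R^-1)).

Lemma continuous_truncated h x : (0 < h)%R -> continuous (tk h x).
Proof.
move=> h0; apply: (@lipschitz_continuous_rV R n _ (riesz_lip (n:=n) alpha h)) => z z'.
by rewrite truncated_rieszC [X in (_ <= X + _)%R]truncated_rieszC; exact: truncated_riesz_lipschitz.
Qed.

Definition smooth_potential (m : nat) mu x : R := fine (\int[mu]_z (tkn m x z)%:E).

Lemma smooth_potential_fin m mu x : mu setT < +oo -> \int[mu]_z (tkn m x z)%:E \is a fin_num.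
Proof.
move=> mufin; rewrite ge0_fin_numE; last by apply: integral_ge0 => z _; rewrite lee_fin truncated_riesz_ge0.
apply: (@le_lt_trans _ _ (((m.+1%:R^-1) `^ (alpha - n%:R))%:E * mu setT)); last first.
  by rewrite lte_mul_pinfty// lee_fin powR_ge0.
apply: ge0_integral_le_cst.
- by apply/measurable_EFinP; exact: measurable_truncated_riesz_l.
- by move=> z; rewrite lee_fin truncated_riesz_ge0.
- by move=> z; rewrite lee_fin truncated_riesz_le_cst.
Qed.

Lemma smooth_potentialE m mu x : mu setT < +oo ->
  (smooth_potential m mu x)%:E = \int[mu]_z (tkn m x z)%:E.
Proof. by move=> mufin; rewrite fineK// smooth_potential_fin. Qed.

Let fin_le_congr (a b c : R) (A B : \bar R) : a%:E = A -> b%:E = B -> A <= B + c%:E -> (a <= b + c)%R.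
Proof. by move=> <- <-; rewrite -EFinD lee_fin. Qed.

Lemma smooth_potential_ge0 m mu x : (0 <= smooth_potential m mu x)%R.
Proof. by apply: fine_ge0; apply: integral_ge0 => z _; rewrite lee_fin truncated_riesz_ge0. Qed.

Lemma smooth_potential_le m mu x : mu setT < +oo -> (smooth_potential m mu x)%:E <= U mu x.
Proof.
move=> mufin; rewrite smooth_potentialE//; apply: ge0_le_integral => //.
- by move=> z _; rewrite lee_fin truncated_riesz_ge0.
- by apply/measurable_EFinP; exact: measurable_truncated_riesz_l.
- exact: measurable_riesz_l.
- by move=> z _; exact: truncated_riesz_le.
Qed.

Lemma smooth_potential_lipschitz m mu x x' (M : R) : mu setT <= M%:E ->
  (smooth_potential m mu x <= smooth_potential m mu x' +
    riesz_lip (n:=n) alpha m.+1%:R^-1 * M * edist x x')%R.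
Proof.
move=> muM; have mufin : mu setT < +oo by apply: le_lt_trans muM (ltry _).
have h0 : (0 < m.+1%:R^-1 :> R)%R by rewrite invr_gt0.
have L0 := @riesz_lip_ge0 R n alpha _ h0.
apply: (fin_le_congr (smooth_potentialE m x mufin) (smooth_potentialE m x' mufin)).
have mt w : measurable_fun [set: Rn R n] (fun z : Rn R n => (tkn m w z)%:E).
  by apply/measurable_EFinP; exact: measurable_truncated_riesz_l.
apply: (@le_trans _ _ (\int[mu]_z ((tkn m x' z)%:E + (riesz_lip (n:=n) alpha m.+1%:R^-1 * edist x x')%:E))).
  apply: ge0_le_integral => //.
  - by move=> z _; rewrite lee_fin truncated_riesz_ge0.
  - exact: emeasurable_funD.
  - by move=> z _; rewrite -EFinD lee_fin; exact: truncated_riesz_lipschitz.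
rewrite ge0_integralD//; first last.
- by move=> z _; rewrite lee_fin mulr_ge0 ?edist_ge0.
- by move=> z _; rewrite lee_fin truncated_riesz_ge0.
rewrite leeD2l// integral_cst//.
have -> : (riesz_lip (n:=n) alpha m.+1%:R^-1 * M * edist x x')%:E =
  (riesz_lip (n:=n) alpha m.+1%:R^-1 * edist x x')%:E * M%:E.
  by rewrite -EFinM mulrAC.
apply: lee_pmulE => //.
by rewrite mulr_ge0 ?edist_ge0.
Qed.

Lemma continuous_smooth_potential m mu : mu setT < +oo -> continuous (smooth_potential m mu).
Proof.
move=> mufin; have tf : mu setT \is a fin_num by rewrite ge0_fin_numE.
apply: lipschitz_continuous_rV => x x'; apply: (@smooth_potential_lipschitz m mu x x' (fine (mu setT))).
by rewrite fineK.
Qed.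

Context (K : set 'rV[R]_n) (cK : compact K) (k : nat) (Kk : K `<=` box k%:R).

Let mK : measurable (K : set (Rn R n)). Proof. exact: compact_measurable_rV. Qed.

Lemma integral_cutoff mu (phi : 'rV[R]_n -> R) : mu (~` K) = 0 -> continuous phi ->
  (forall x, (0 <= phi x)%R) -> \int[mu]_x (phi x)%:E = \int[mu]_x (phi x * cutoff k x)%:E.
Proof.
move=> muK cphi phi0.
have mphi := continuous_measurable_rV cphi.
have mc := continuous_measurable_rV (@continuous_cutoff R n k).
rewrite (ge0_integral_support mK muK); last 2 first.
- exact/measurable_EFinP.
- by move=> x; rewrite lee_fin.
rewrite [RHS](ge0_integral_support mK muK); last 2 first.
- by apply/measurable_EFinP; exact: measurable_funM.
- by move=> x; rewrite lee_fin mulr_ge0 ?cutoff_ge0.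
by apply: eq_integral => x /[!inE] Kx; rewrite cutoff1 ?mulr1//; exact: Kk.
Qed.

Lemma vague_integral_support {I : Type} (F : set_system I) {FF : ProperFilter F} (rho : I -> measure_rV)
    lam (phi : 'rV[R]_n -> R) (e : R) : vaguely F rho lam -> (forall i, rho i (~` K) = 0) ->
  continuous phi -> (forall x, (0 <= phi x)%R) -> (0 < e)%R -> \forall i \near F,
    \int[rho i]_x (phi x)%:E <= \int[lam]_x (phi x)%:E + e%:E /\
    \int[lam]_x (phi x)%:E <= \int[rho i]_x (phi x)%:E + e%:E.
Proof.
move=> hv rK cphi phi0 e0; have cl : closed K by apply: compact_closed => //; exact: norm_hausdorff.
have lK := @vague_support R n I F FF rho lam K hv cl rK; have [_ _ hphi] := hv.
have := hphi (fun x => phi x * cutoff k x)%R k.+1 _ _ _ e e0.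
have -> : \int[lam]_x (phi x)%:E = \int[lam]_x (phi x * cutoff k x)%:E.
  exact: integral_cutoff lK cphi phi0.
under [X in _ -> X]eq_near do rewrite (integral_cutoff (rK _) cphi phi0).
apply.
- by move=> x; apply: continuousM; [exact: cphi|exact: continuous_cutoff].
- by move=> x; rewrite mulr_ge0 ?cutoff_ge0.
- by move=> x /cutoff0 ->; rewrite mulr0.
Qed.

(** Behind the lower semicontinuity of the energy. Both the measure and its potential vary, so
    pointwise convergence of the smoothed potentials is not enough; with a common bound [M] on the
    masses they are equi-Lipschitz, hence comparable uniformly on the compact [K], after which the
    integrating measure can be replaced. *)
Lemma smooth_energy_limit {I : Type} (F : set_system I) {FF : ProperFilter F} (rho : I -> measure_rV)
    lam (M : R) (m : nat) (e : R) : vaguely F rho lam -> (forall i, rho i (~` K) = 0) ->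
  (forall i, rho i setT <= M%:E) -> (0 < e)%R ->
  \forall i \near F, \int[lam]_x (smooth_potential m lam x)%:E <= energy alpha (rho i) + e%:E.
Proof.
move=> hv rK rM e0.
have M0 : (0 <= M)%R by rewrite -lee_fin; have [i _] := filter_ex (@filterT _ F _); exact: le_trans (rM i).
have lM : lam setT <= M%:E by apply: (vague_mass hv); near=> i; exact: rM.
have lfin : lam setT < +oo by apply: le_lt_trans lM (ltry _).
have rfin i : rho i setT < +oo by apply: le_lt_trans (rM i) (ltry _).
have h0 : (0 < m.+1%:R^-1 :> R)%R by rewrite invr_gt0.
(* [d] is spent as [d M + d = e / 2]; the other half of [e] pays for integrating the fixed function
   [smooth_potential m lam]. *)
pose d := (e / (2 * (M + 1)))%R.
have d0 : (0 < d)%R by rewrite divr_gt0// mulr_gt0// ltr_wpDl.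
pose C := (riesz_lip (n:=n) alpha m.+1%:R^-1 * M)%R.
have C0 : (0 <= C)%R by rewrite mulr_ge0// ?riesz_lip_ge0.
have unif : \forall i \near F, forall x, K x -> (smooth_potential m lam x <= smooth_potential m (rho i) x + d)%R.
  move/compact_near_coveringP : (cK) => /(_ I F (fun i x => smooth_potential m lam x <= smooth_potential m (rho i) x + d)%R FF).
  apply => x Kx.
  have d4 : (0 < d / 4)%R by rewrite divr_gt0.
  have near1 : \forall i \near F, (smooth_potential m lam x <= smooth_potential m (rho i) x + d / 4)%R.
    have := @vague_integral_support _ _ FF _ _ _ _ hv rK (@continuous_truncated _ x h0) (truncated_riesz_ge0 alpha m.+1%:R^-1 x) d4.
    apply: filterS => i [_ h].
    exact: (fin_le_congr (smooth_potentialE m x lfin) (smooth_potentialE m x (rfin i)) h).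
  have near2 : \forall x' \near x, (C * edist x x' <= d / 4)%R.
    have cC : continuous (fun x' => C * edist x x')%R.
      apply: (@lipschitz_continuous_rV R n _ C) => w w'.
      by rewrite -mulrDr ler_wpM2l// (edistC w) edist_triangle.
    move/continuous_epsP : cC => /(_ x _ d4); apply: filterS => x'.
    have /eqP -> : edist x x == 0%R by rewrite edist0.
    by rewrite mulr0 sub0r normrN => /ltW; apply: le_trans; rewrite ler_norm.
  exists ([set x' | C * edist x x' <= d / 4]%R, [set i | smooth_potential m lam x <= smooth_potential m (rho i) x + d / 4]%R) => //.
  move=> [x' i] /= [h2 h1].
  have l1 := @smooth_potential_lipschitz m lam x' x M lM.
  have l2 := @smooth_potential_lipschitz m (rho i) x x' M (rM i).
  rewrite edistC -/C in l1; rewrite -/C in l2.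
  move: (smooth_potential _ _ _) (smooth_potential _ _ _) (smooth_potential _ _ _) (smooth_potential _ _ _) (C * _)%R h1 h2 l1 l2.
  move=> p1 p2 p3 p4 p5; lra.
have cs := @continuous_smooth_potential m _ lfin.
have e2 : (0 < e / 2)%R by rewrite divr_gt0.
have near3 := @vague_integral_support _ _ FF _ _ _ _ hv rK cs (smooth_potential_ge0 m lam) e2.
have near4 : \forall i \near F, \int[lam]_x (smooth_potential m lam x)%:E <=
    \int[rho i]_x (smooth_potential m lam x)%:E + (e / 2)%:E.
  by apply: filterS near3 => i [].
near=> i.
have hu : forall x, K x -> (smooth_potential m lam x <= smooth_potential m (rho i) x + d)%R by near: i.
have hi : \int[lam]_x (smooth_potential m lam x)%:E <=
    \int[rho i]_x (smooth_potential m lam x)%:E + (e / 2)%:E by near: i.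
apply: (le_trans hi).
have eE : (e = d * M + d + e / 2)%R.
  have M1 : (M + 1 != 0)%R by rewrite gt_eqF// ltr_wpDl.
  by rewrite /d; field.
rewrite [in leRHS]eE 2!EFinD addeA leeD2r// addeA.
apply: (@le_trans _ _ (energy alpha (rho i) + (d * M)%:E)); last by rewrite leeDl// lee_fin ltW.
apply: (@le_trans _ _ (\int[rho i]_x (U (rho i) x + d%:E))).
  apply: (ge0_le_integral_support mK (rK i)).
  - by apply/measurable_EFinP; exact: continuous_measurable_rV.
  - by apply: emeasurable_funD => //; apply: measurable_potential => //; exact: finite_radon.
  - by move=> x; rewrite lee_fin smooth_potential_ge0.
  - by move=> x; rewrite adde_ge0 ?potential_ge0// lee_fin ltW.
  - move=> x /hu; rewrite -lee_fin EFinD => h; apply: (le_trans h).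
    by rewrite leeD2r//; exact: smooth_potential_le.
rewrite ge0_integralD//; first last.
- by move=> x _; rewrite lee_fin ltW.
- by apply: measurable_potential => //; exact: finite_radon.
- by move=> x _; exact: potential_ge0.
rewrite integral_cst// (EFinM d M); apply: leeD => //.
by apply: lee_pmulE => //; exact: ltW.
Unshelve. all: by end_near. Qed.

Lemma smooth_energy_sup lam (r : R) : lam setT < +oo -> r%:E < energy alpha lam ->
  exists m, r%:E < \int[lam]_x (smooth_potential m lam x)%:E.
Proof.
move=> lfin; have rl : radon lam by exact: finite_radon.
have nd (x : 'rV[R]_n) : {homo (fun m => (smooth_potential m lam x)%:E) : a b / (a <= b)%N >-> a <= b}.
  move=> a b ab; rewrite (smooth_potentialE a x lfin) (smooth_potentialE b x lfin); apply: ge0_le_integral; first exact: measurableT.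
  - by move=> z _; rewrite lee_fin truncated_riesz_ge0.
  - by apply/measurable_EFinP; exact: measurable_truncated_riesz_l.
  - by apply/measurable_EFinP; exact: measurable_truncated_riesz_l.
  - by move=> z _; exact: truncated_riesz_nd.
have cv (x : 'rV[R]_n) : (smooth_potential m lam x)%:E @[m --> \oo] --> U lam x.
  rewrite (_ : (fun m => (smooth_potential m lam x)%:E) = (fun m => \int[lam]_z (tkn m x z)%:E)); last first.
    by apply/funext => m; exact: smooth_potentialE.
  rewrite /potential.
  under [X in _ --> X]eq_integral => z _.
    rewrite (_ : riesz alpha x z = limn (fun m => (tkn m x z)%:E)).
    over.
    by apply/esym/cvg_lim => //; exact: cvg_truncated_riesz.
  apply: cvg_monotone_convergence => //.
  - by move=> m; apply/measurable_EFinP; exact: measurable_truncated_riesz_l.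
  - by move=> m z _; rewrite lee_fin truncated_riesz_ge0.
  - by move=> z _ a b ab; exact: truncated_riesz_nd.
have cv2 : \int[lam]_x (smooth_potential m lam x)%:E @[m --> \oo] --> energy alpha lam.
  rewrite /energy.
  under [X in _ --> X]eq_integral => z _.
    rewrite (_ : U lam z = limn (fun m => (smooth_potential m lam z)%:E)).
    over.
    by apply/esym/cvg_lim => //; exact: cv.
  apply: cvg_monotone_convergence => //.
  - by move=> m; apply/measurable_EFinP; apply: continuous_measurable_rV; exact: continuous_smooth_potential.
  - by move=> m z _; rewrite lee_fin smooth_potential_ge0.
have /ereal_nondecreasing_cvgn h2 : nondecreasing_seq (fun m => \int[lam]_x (smooth_potential m lam x)%:E).
  move=> a b ab; apply: ge0_le_integral; first exact: measurableT.
  - by move=> z _; rewrite lee_fin smooth_potential_ge0.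
  - by apply/measurable_EFinP; apply: continuous_measurable_rV; exact: continuous_smooth_potential.
  - by apply/measurable_EFinP; apply: continuous_measurable_rV; exact: continuous_smooth_potential.
  - by move=> z _; exact: nd.
by rewrite (cvg_unique _ cv2 h2)// => /ereal_sup_gt[_ [m _ <-] am]; exists m.
Qed.

End energy_limits.

Section gauss_variation.
Context {R : realType} {n : nat} (alpha : R) (alpha0 : 0 < alpha) (alpha2 : alpha <= 2)
  (alpha_n : alpha < n%:R).
Local Open Scope ereal_scope.
Notation measure_rV := {measure set (Rn R n) -> \bar R}.
Implicit Types (x y z : 'rV[R]_n) (mu nu lam tau rho : measure_rV).
Local Notation U := (potential alpha).
Local Notation E := (energy alpha).

Context (K : set 'rV[R]_n) (cK : compact K) (phi : 'rV[R]_n -> R) (cphi : continuous phi)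
  (phi0 : forall x, (0 <= phi x)%R).

Let mK : measurable (K : set (Rn R n)). Proof. exact: compact_measurable_rV. Qed.
Let mphi : measurable_fun [set: Rn R n] (phi : Rn R n -> R). Proof. exact: continuous_measurable_rV. Qed.

Definition carried rho := rho setT < +oo /\ rho (~` K) = 0.

Let Phi rho : R := fine (\int[rho]_x (phi x)%:E).

(** Up to a constant this is formally the squared energy distance to a measure with potential [phi].
    There is no constraint on the total mass, so the potential of a minimiser is compared with [phi]
    itself, without a Lagrange multiplier. *)
Definition gauss_functional rho : R := (fine (E rho) - 2 * Phi rho)%R.
Local Notation J := gauss_functional.

Lemma compact_sup : exists2 F : R, (0 <= F)%R & forall x, K x -> (phi x <= F)%R.
Proof.
have : compact (phi @` K) by apply: continuous_compact => //; exact: continuous_subspaceT.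
move=> /compact_bounded[B [_ hB]]; exists (`|B| + 1)%R; first by rewrite addr_ge0.
move=> x Kx; apply: (le_trans (ler_norm _)); apply: hB; last by exists x.
by rewrite (le_lt_trans (ler_norm _))// ltrDl.
Qed.

(** Coercivity: a kernel bounded below by [kap] on [K] gives energy at least [kap] times the squared
    mass, which bounds the masses of a minimising sequence. *)
Lemma riesz_min : exists2 kap : R, (0 < kap)%R & forall x z, K x -> K z -> kap%:E <= riesz alpha x z.
Proof.
have [k Kk] := compact_sub_box cK.
pose D : R := (n%:R * (2 * k%:R) + 1)%R.
have D0 : (0 < D)%R by rewrite ltr_wpDl// !mulr_ge0.
exists (D `^ (alpha - n%:R))%R; first exact: powR_gt0.
move=> x z /Kk bx /Kk bz; rewrite /riesz; case: eqP => [_|/eqP xz]; first exact: leey.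
rewrite lee_fin; apply: powR_neg_le => //; first by rewrite edist_gt0.
rewrite /D (le_trans (@edist_le R n x z (2 * k%:R)%R _ _))// ?lerDl// ?mulr_ge0// => i.
by rewrite (le_trans (ler_normB _ _))// mulr_natl mulr2n lerD.
Qed.

Lemma carried_fin rho : carried rho -> rho setT \is a fin_num.
Proof. by move=> [h _]; rewrite ge0_fin_numE. Qed.

Lemma Phi_bound (F : R) rho : (0 <= F)%R -> (forall x, K x -> (phi x <= F)%R) -> carried rho ->
  \int[rho]_x (phi x)%:E <= F%:E * rho setT.
Proof.
move=> F0 hF [rfin rK]; rewrite -integral_cst//.
apply: (ge0_le_integral_support mK rK) => //.
exact/measurable_EFinP.
Qed.

Lemma Phi_fin rho : carried rho -> \int[rho]_x (phi x)%:E \is a fin_num.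
Proof.
move=> cr; have [F F0 hF] := compact_sup.
rewrite ge0_fin_numE; last by apply: integral_ge0 => x _; rewrite lee_fin.
apply: le_lt_trans (Phi_bound F0 hF cr) _; rewrite lte_mul_pinfty// ?lee_fin//.
by case: cr.
Qed.

Lemma energy_ge0 rho : 0 <= E rho.
Proof. by apply: integral_ge0 => x _; exact: potential_ge0. Qed.

Lemma energy_lower (kap : R) rho : (0 < kap)%R -> (forall x z, K x -> K z -> kap%:E <= riesz alpha x z) ->
  carried rho -> (kap * fine (rho setT) ^+ 2)%:E <= E rho.
Proof.
move=> k0 hk cr; have [rfin rK] := cr; have rf := carried_fin cr.
have rr : radon rho by exact: finite_radon.
have v0 : 0 <= kap%:E * rho setT by rewrite mule_ge0// lee_fin ltW.
have -> : (kap * fine (rho setT) ^+ 2)%:E = kap%:E * rho setT * rho setT.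
  by rewrite -(fineK rf) -!EFinM expr2 mulrA.
rewrite -integral_cst//; apply: (ge0_le_integral_support mK rK) => //.
- exact: measurable_potential.
- by move=> x; exact: potential_ge0.
- move=> x Kx; rewrite -integral_cst//; apply: (ge0_le_integral_support mK rK) => //.
  + exact: measurable_riesz_l.
  + by move=> z; rewrite lee_fin ltW.
  + by move=> z; exact: riesz_ge0.
  + by move=> z Kz; exact: hk.
Qed.

Let gauss_arith (p q r s e I : R) :
  (p - 2 * q < I + s -> s < e -> q <= r + e / 2 -> I + 2 * r + 3 * e < p + e -> False)%R.
Proof. lra. Qed.

Lemma gauss_minimizer : exists rho, [/\ carried rho, E rho < +oo &
  forall rho', carried rho' -> E rho' < +oo -> (J rho <= J rho')%R].
Proof.
have [F F0 hF] := compact_sup; have [kap k0 hk] := riesz_min.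
have [k Kk] := compact_sub_box cK.
have lower rho : carried rho -> E rho < +oo ->
    (kap * fine (rho setT) ^+ 2 - 2 * F * fine (rho setT) <= J rho)%R.
  move=> cr Er; have rf := carried_fin cr; have Pf := Phi_fin cr.
  have Ef : E rho \is a fin_num by rewrite ge0_fin_numE// energy_ge0.
  have := energy_lower k0 hk cr; rewrite -(fineK Ef) lee_fin => h1.
  have := Phi_bound F0 hF cr; rewrite -(fineK Pf) -(fineK rf) -EFinM lee_fin -/(Phi rho) => h2.
  rewrite /J lerB// -mulrA ler_pM2l//.
pose S := [set j : R | exists rho, [/\ carried rho, E rho < +oo & j = J rho]].
have S0 : S 0%R.
  exists (@mzero _ (Rn R n) R); split.
  - by split; rewrite /= /mzero// ltry.
  - by rewrite /energy integral_measure_zero ltry.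
  - by rewrite /J /Phi /energy !integral_measure_zero/= mulr0 subr0.
(* Completing the square: [kap m^2 - 2 F m = (kap m - F)^2 / kap - F^2 / kap]. *)
have Slb : lbound S (- (F ^+ 2 / kap))%R.
  move=> _ [rho [cr Er ->]]; apply: le_trans (lower _ cr Er).
  set m := fine _; rewrite -subr_ge0.
  have -> : (kap * m ^+ 2 - 2 * F * m - - (F ^+ 2 / kap) = (kap * m - F) ^+ 2 / kap)%R.
    by field; rewrite gt_eqF.
  by rewrite divr_ge0 ?sqr_ge0// ltW.
have Sinf : has_inf S by split; [exists 0%R|exists (- (F ^+ 2 / kap))%R].
pose I := inf S.
have I0 : (I <= 0)%R by apply: ge_inf => //; exists (- (F ^+ 2 / kap))%R.
have seqP (i : nat) : exists rho, [/\ carried rho, E rho < +oo & (J rho < I + i.+1%:R^-1)%R].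
  have i0 : (0 < i.+1%:R^-1 :> R)%R by rewrite invr_gt0.
  by have [_ [rho [cr Er ->]] h] := inf_adherent i0 Sinf; exists rho.
pose rho_ i : measure_rV := projT1 (cid (seqP i)).
have cr i : carried (rho_ i) by have [] := projT2 (cid (seqP i)).
have Er i : E (rho_ i) < +oo by have [] := projT2 (cid (seqP i)).
have Jr i : (J (rho_ i) < I + i.+1%:R^-1)%R by have [] := projT2 (cid (seqP i)).
(* A mass [m > M] gives [kap m - 2 F >= 1] and [m > 1], hence a value of [J] above 1, whereas the
   infimum is at most 0 and the sequence stays within 1 of it. *)
pose M : R := ((2 * F + 1) / kap + 1)%R.
have rM i : rho_ i setT <= M%:E.
  rewrite -(fineK (carried_fin (cr i))) lee_fin; set m := fine _.
  have m0 : (0 <= m)%R by rewrite fine_ge0.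
  have := lower _ (cr i) (Er i); rewrite -/m => h.
  have h1 : (kap * m ^+ 2 - 2 * F * m <= 1)%R.
    apply: (le_trans h); apply: ltW; apply: (lt_le_trans (Jr i)).
    by rewrite -[leRHS]add0r lerD// invf_le1// ler1n.
  rewrite leNgt; apply/negP => Mm.
  have M1 : (1 <= M)%R by rewrite /M lerDr divr_ge0 ?addr_ge0 ?mulr_ge0// ltW.
  have h2 : (2 * F + 1 <= kap * m)%R.
    by rewrite (mulrC kap) -ler_pdivrMr//; apply: le_trans (ltW Mm); rewrite /M lerDl.
  have : (1 < kap * m ^+ 2 - 2 * F * m)%R.
    have -> : (kap * m ^+ 2 - 2 * F * m = m * (kap * m - 2 * F))%R by ring.
    apply: (lt_le_trans (le_lt_trans M1 Mm)); rewrite -[leLHS]mulr1 ler_wpM2l//.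
    by rewrite lerBrDl.
  by rewrite ltNge h1.
have [G [UG sG]] := @ultraFilterLemma nat \oo _.
have rbox k' i : rho_ i (box k'%:R) <= M%:E.
  by apply: le_trans (rM i); apply: le_measure; rewrite ?inE//; exact: measurable_box.
have [rho hv] := @vague_compactness R n nat G UG rho_ (fun=> M) rbox.
have PG : ProperFilter G := @ultra_proper _ _ UG.
have clK : closed K by apply: compact_closed => //; exact: norm_hausdorff.
have rK : rho (~` K) = 0 by apply: (@vague_support R n nat G PG rho_ rho K hv clK) => i; case: (cr i).
have rhoM : rho setT <= M%:E by apply: (@vague_mass R n nat G PG rho_ rho M hv); apply: nearW.
have crho : carried rho by split => //; exact: le_lt_trans rhoM (ltry _).
have Pf := Phi_fin crho.
(* Lower semicontinuity of the energy and convergence of the integrals of [phi] show that the vague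
   limit attains the infimum. *)
have key : E rho <= (I + 2 * Phi rho)%:E.
  rewrite leNgt; apply/negP => h.
  have [m hm] := smooth_energy_sup alpha_n (proj1 crho) h.
  have [e e0 he] : exists2 e : R, (0 < e)%R & (I + 2 * Phi rho + 3 * e)%:E < \int[rho]_x (smooth_potential alpha m rho x)%:E.
    move: hm; case: (\int[rho]_x _) => [v| |] //; last by move=> _; exists 1%R; rewrite ?ltry.
    rewrite lte_fin => hv'; exists ((v - (I + 2 * Phi rho)) / 4)%R; first by rewrite divr_gt0// subr_gt0.
    by rewrite lte_fin; move: (Phi rho) hv' => p hv'; lra.
  have e2 : (0 < e / 2)%R by rewrite divr_gt0.
  have near1 := @smooth_energy_limit R n alpha alpha_n K cK k Kk nat G PG rho_ rho M m e hv (fun i => proj2 (cr i)) rM e0.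
  have near2 := @vague_integral_support R n K cK k Kk nat G PG rho_ rho phi (e / 2)%R hv (fun i => proj2 (cr i)) cphi phi0 e2.
  have near3 : \forall i \near G, (i.+1%:R^-1 < e)%R by apply: sG; exact: (near_infty_natSinv_lt (PosNum e0)).
  have [i [[h1 [h2 _]] h3]] := filter_ex (filterI (filterI near1 near2) near3).
  have Ef : E (rho_ i) \is a fin_num by rewrite ge0_fin_numE ?energy_ge0.
  have h4 := lt_le_trans he h1; rewrite -(fineK Ef) -EFinD lte_fin in h4.
  rewrite -(fineK Pf) -(fineK (Phi_fin (cr i))) -EFinD lee_fin in h2.
  exact: gauss_arith (Jr i) h3 h2 h4.
exists rho; split => //; first exact: le_lt_trans key (ltry _).
have Ef : E rho \is a fin_num by rewrite ge0_fin_numE ?energy_ge0//; exact: le_lt_trans key (ltry _).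
move=> rho' cr' Er'; apply: (@le_trans _ _ I).
  by move: key; rewrite -(fineK Ef) lee_fin /J lerBlDr.
by apply: ge_inf; [exists (- (F ^+ 2 / kap))%R|exists rho'].
Qed.

Lemma energy_add rho tau (t : R) (t0 : (0 <= t)%R) : radon rho -> radon tau ->
  E (measure_add rho (mscale (NngNum t0) tau)) =
  E rho + (2 * t)%:E * \int[tau]_x U rho x + (t ^+ 2)%:E * E tau.
Proof.
move=> rr rt; pose mt : measure_rV := mscale (NngNum t0) tau.
have mr := measurable_potential alpha_n rr; have mta := measurable_potential alpha_n rt.
have Uadd x : U (measure_add rho mt) x = U rho x + t%:E * U tau x.
  rewrite /potential ge0_integral_measure_add//; last 2 first.
  - by move=> z _; exact: riesz_ge0.
  - exact: measurable_riesz_l.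
  by congr (_ + _); rewrite -/(potential alpha mt x) potential_mscale.
have t0' : 0 <= t%:E by rewrite lee_fin.
have mU : measurable_fun [set: Rn R n] (fun x : Rn R n => t%:E * U tau x) by exact: emeasurable_funM.
have U0 x : 0 <= t%:E * U tau x by rewrite mule_ge0 ?potential_ge0.
have lin (m : measure_rV) : \int[m]_x (U rho x + t%:E * U tau x) =
    \int[m]_x U rho x + t%:E * \int[m]_x U tau x.
  rewrite (ge0_integralD m measurableT (fun x _ => potential_ge0 alpha rho x) mr (fun x _ => U0 x) mU).
  by rewrite (ge0_integralZl m measurableT mta (fun x _ => potential_ge0 alpha tau x) t0').
have Eadd : E (measure_add rho mt) = \int[measure_add rho mt]_x (U rho x + t%:E * U tau x).
  by apply: eq_integral => x _; exact: Uadd.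
rewrite Eadd ge0_integral_measure_add//; last 2 first.
- by move=> x _; rewrite adde_ge0 ?potential_ge0.
- exact: emeasurable_funD.
rewrite (ge0_integral_mscale _ measurableT)//; last 2 first.
- exact: emeasurable_funD.
- by move=> x _; rewrite adde_ge0 ?potential_ge0.
rewrite !lin (potential_sym alpha_n rt rr) /=.
have I0 : 0 <= \int[tau]_x U rho x by apply: integral_ge0 => x _; exact: potential_ge0.
have W0 : 0 <= t%:E * \int[tau]_x U tau x by rewrite mule_ge0//; exact: energy_ge0.
rewrite (ge0_muleDr _ I0 W0).
rewrite !addeA; congr (_ + _).
  by rewrite mulr_natl mulr2n EFinD ge0_muleDl// addeA.
by rewrite muleA -EFinM expr2.
Qed.

Lemma integral_add rho tau (t : R) (t0 : (0 <= t)%R) :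
  \int[measure_add rho (mscale (NngNum t0) tau)]_x (phi x)%:E =
  \int[rho]_x (phi x)%:E + t%:E * \int[tau]_x (phi x)%:E.
Proof.
rewrite ge0_integral_measure_add//; last 2 first.
- by move=> x _; rewrite lee_fin.
- exact/measurable_EFinP.
rewrite ge0_integral_mscale//; first exact/measurable_EFinP.
by move=> x _; rewrite lee_fin.
Qed.

Lemma carried_add rho tau (t : R) (t0 : (0 <= t)%R) : carried rho -> carried tau ->
  carried (measure_add rho (mscale (NngNum t0) tau)).
Proof.
move=> [r1 r2] [t1 t2].
have AE B : measure_add rho (mscale (NngNum t0) tau) B = rho B + t%:E * tau B by exact: measure_addE.
split; [apply: le_lt_trans (eq_lee (AE _)) _|apply: (etrans (AE _))].
  by rewrite lte_add_pinfty// lte_mul_pinfty// ?lee_fin// ge0_fin_numE.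
by rewrite r2 t2 mule0 adde0.
Qed.

Let scaling_arith (t v p e : R) : (0 < t -> t <= 1 -> 0 <= v -> t * v <= e ->
  v - 2 * p <= (1 - t) ^+ 2 * v - 2 * ((1 - t) * p) -> v <= p + e)%R.
Proof.
move=> t0 t1 v0 te h.
have h1 : (t * ((2 - t) * v) <= t * (2 * p))%R by nra.
rewrite ler_pM2l// in h1; nra.
Qed.

Let variation_arith (t v i w p q : R) : (0 < t -> 0 <= w ->
  v - 2 * p <= v + 2 * t * i + t ^+ 2 * w - 2 * (p + t * q) -> q <= i + t * w)%R.
Proof.
move=> t0 w0 h.
have h1 : (t * (2 * q) <= t * (2 * i + t * w))%R by nra.
rewrite ler_pM2l// in h1; have : (0 <= t * w)%R by rewrite mulr_ge0// ltW.
lra.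
Qed.

(** First-order conditions at the minimiser. Adding [t tau] and letting [t] tend to 0 gives the
    inequality tested by [tau]; shrinking [rho] to [(1-t) rho] bounds its energy. Each is first
    obtained with an error of order [t]. *)
Lemma gauss_variation : exists rho, [/\ carried rho, E rho < +oo, E rho <= \int[rho]_x (phi x)%:E &
  forall K' tau, nice_on alpha K' tau -> K' `<=` K -> \int[tau]_x (phi x)%:E <= \int[tau]_x U rho x].
Proof.
have [rho [crho Erho hmin]] := gauss_minimizer.
have Pf := Phi_fin crho.
have rr : radon rho by apply: finite_radon; case: crho.
have Ef : E rho \is a fin_num by rewrite ge0_fin_numE ?energy_ge0.
exists rho; split => //.
- rewrite -(fineK Ef) -(fineK Pf) lee_fin; apply/ler_addgt0Pr => e e0.
  set v := fine (E rho); have v0 : (0 <= v)%R by rewrite fine_ge0// energy_ge0.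
  have [t /andP[t0 t1] te] : exists2 t : R, (0 < t <= 1)%R & (t * v <= e)%R.
    have v1 : (0 < v + 1)%R by rewrite ltr_wpDl.
    exists (Num.min 1 (e / (v + 1)))%R.
      by rewrite lt_min ltr01 divr_gt0//= ge_min lexx.
    apply: (@le_trans _ _ (e / (v + 1) * v)%R).
      by rewrite ler_wpM2r// ge_min lexx orbT.
    by rewrite mulrAC ler_pdivrMr// ler_pM2l// lerDl.
  have s0 : (0 <= 1 - t)%R by rewrite subr_ge0.
  (* Starting from the zero measure makes the scaled measure [(1-t) rho] an instance of
     [energy_add]. *)
  pose z : measure_rV := @mzero _ (Rn R n) R.
  have cz : carried z by split; rewrite /z/= /mzero// ltry.
  have rz : radon z by apply: finite_radon; case: cz.
  have Ez : E (measure_add z (mscale (NngNum s0) rho)) = ((1 - t) ^+ 2 * v)%:E.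
    rewrite energy_add//.
    have -> : E z = 0 by rewrite /energy integral_measure_zero.
    have -> : \int[rho]_x U z x = 0.
      by apply: integral0_eq => x _; rewrite /potential integral_measure_zero.
    by rewrite mule0 !add0e -(fineK Ef) -EFinM.
  have Pz : Phi (measure_add z (mscale (NngNum s0) rho)) = ((1 - t) * Phi rho)%R.
    by rewrite /Phi integral_add integral_measure_zero add0e -(fineK Pf) -EFinM.
  have := hmin _ (carried_add s0 cz crho); rewrite /J Ez Pz => /(_ (ltry _)) /=.
  by apply: scaling_arith.
- move=> K' tau nK K'K.
  have [cK' tfin tK' _] := nK.
  have rt : radon tau by exact: finite_radon.
  have ct : carried tau.
    split => //; apply/eqP; rewrite eq_le measure_ge0 andbT -tK'.
    apply: le_measure; rewrite ?inE//.
    + exact: measurableC.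
    + by apply: measurableC; exact: compact_measurable_rV.
    + by move=> x Kx K'x; apply: Kx; exact: K'K.
  have Et := nice_energy alpha_n nK.
  have Etf : E tau \is a fin_num by rewrite ge0_fin_numE ?energy_ge0.
  have Ptf := Phi_fin ct.
  have [->|Ioo] := eqVneq (\int[tau]_x U rho x) +oo; first exact: leey.
  have If : \int[tau]_x U rho x \is a fin_num.
    rewrite ge0_fin_numE ?ltey//; apply: integral_ge0 => x _; exact: potential_ge0.
  rewrite -(fineK If) -(fineK Ptf) lee_fin.
  have step (t : R) : (0 < t)%R -> (fine (\int[tau]_x (phi x)%:E) <= fine (\int[tau]_x U rho x) + t * fine (E tau))%R.
    move=> t0.
    have Et' : E (measure_add rho (mscale (NngNum (ltW t0)) tau)) =
        (fine (E rho) + 2 * t * fine (\int[tau]_x U rho x) + t ^+ 2 * fine (E tau))%:E.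
      by rewrite energy_add// !EFinD !EFinM (fineK Ef) (fineK If) (fineK Etf).
    have Pt' : Phi (measure_add rho (mscale (NngNum (ltW t0)) tau)) =
        (Phi rho + t * fine (\int[tau]_x (phi x)%:E))%R.
      by rewrite /Phi integral_add -(fineK Pf) -(fineK Ptf) -EFinM -EFinD.
    have := hmin _ (carried_add (ltW t0) crho ct); rewrite /J Et' Pt' => /(_ (ltry _)) /=.
    by apply: variation_arith => //; rewrite fine_ge0// energy_ge0.
  apply/ler_addgt0Pr => e e0.
  have v0 : (0 <= fine (E tau))%R by rewrite fine_ge0// energy_ge0.
  have v1 : (0 < fine (E tau) + 1)%R by rewrite ltr_wpDl.
  apply: (le_trans (step (e / (fine (E tau) + 1))%R (divr_gt0 e0 v1))).
  by rewrite lerD2l mulrAC ler_pdivrMr// ler_pM2l// lerDl.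
Qed.

End gauss_variation.

Lemma ge0_integral_le_null d (T : measurableType d) (R : realType)
    (mu : {measure set T -> \bar R}) (S : set T) (f g : T -> \bar R) : measurable S ->
  mu (~` S) = 0%E -> measurable_fun setT f -> measurable_fun setT g ->
  (forall x, 0 <= f x)%E -> (forall x, 0 <= g x)%E -> (forall x, S x -> f x <= g x)%E ->
  (\int[mu]_x g x <= \int[mu]_x f x)%E -> (\int[mu]_x f x < +oo)%E ->
  (forall x, S x -> f x < +oo)%E -> mu (S `&` [set x | (f x < g x)%E]) = 0%E.
Proof.
move=> mS muS mf mg f0 g0 fg gf foo Sf.
pose B (k : nat) := S `&` [set x | (f x + (k.+1%:R^-1)%:E <= g x)%E].
have mB k : measurable (B k).
  apply: measurableI => //; rewrite -[X in measurable X]setTI.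
  by apply: emeasurable_fun_le => //; exact: emeasurable_funD.
have BE : S `&` [set x | (f x < g x)%E] = \bigcup_k B k.
  apply/seteqP; split => x; last first.
    move=> [k _ [Sx /= h]]; split => //=; apply: lt_le_trans h.
    have := Sf x Sx; have := f0 x; case: (f x) => [r| |] // _ _.
    by rewrite -EFinD lte_fin ltrDl.
  move=> [Sx /= fgx]; have := Sf x Sx; have := f0 x; have := fgx; have := g0 x.
  case Ef : (f x) => [r| |] //; case Eg : (g x) => [s| |] //.
    move=> _; rewrite lte_fin => rs _ _.
    have sr0 : 0 < s - r by rewrite subr_gt0.
    have [k _ /(_ k (leqnn _)) /= hk] := near_infty_natSinv_lt (PosNum sr0).
    exists k => //; split => //=; rewrite Ef Eg -EFinD lee_fin -lerBrDl; exact: ltW.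
  by move=> *; exists 0%N => //; split => //=; rewrite Ef Eg leey.
apply/eqP; rewrite eq_le measure_ge0 andbT BE.
apply: (@le_trans _ _ (\sum_(0 <= k <oo) mu (B k))%E).
  by apply: measure_sigma_subadditive => //; exact: bigcupT_measurable.
rewrite eseries0// => k _ _.
have d0 : (0 < k.+1%:R^-1 :> R) by rewrite invr_gt0.
have mI : measurable_fun setT (fun x => (k.+1%:R^-1 * \1_(B k) x)%:E : \bar R).
  by apply/measurable_EFinP; apply: measurable_funM => //; exact: measurable_indic.
have h : (\int[mu]_x f x + (k.+1%:R^-1)%:E * mu (B k) <= \int[mu]_x f x)%E.
  apply: le_trans gf.
  have -> : ((k.+1%:R^-1)%:E * mu (B k) = \int[mu]_x (k.+1%:R^-1 * \1_(B k) x)%:E)%E.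
    under eq_integral do rewrite EFinM.
    rewrite ge0_integralZl ?lee_fin ?(ltW d0)//.
    - by rewrite integral_indic// setIT.
    - by apply/measurable_EFinP; exact: measurable_indic.
  have i0 x : (0 <= (k.+1%:R^-1 * \1_(B k) x)%:E :> \bar R)%E by rewrite lee_fin mulr_ge0// ltW.
  rewrite -(ge0_integralD mu measurableT (fun x _ => f0 x) mf (fun x _ => i0 x) mI).
  apply: (ge0_le_integral_support mS muS) => //.
  - exact: emeasurable_funD.
  - by move=> x; rewrite adde_ge0.
  - move=> x Sx; rewrite indicE; case: (boolP (x \in B k)) => [/set_mem[_ /=]|_].
      by rewrite mulr1.
    by rewrite mulr0 adde0; exact: fg.
apply/eqP; rewrite eq_le measure_ge0 andbT -(@lee_pmul2l _ (k.+1%:R^-1)%:E)//.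
have Ff : (\int[mu]_x f x)%E \is a fin_num.
  by rewrite ge0_fin_numE//; apply: integral_ge0.
by move: h; rewrite -[X in (_ <= X)%E]adde0 leeD2lE// mule0.
Qed.

(** * Sweeping onto a compact set *)

Section compact_sweeping.
Context {R : realType} {n : nat} (alpha : R) (alpha0 : 0 < alpha) (alpha2 : alpha <= 2)
  (alpha_n : alpha < n%:R).
Local Open Scope ereal_scope.
Notation measure_rV := {measure set (Rn R n) -> \bar R}.
Implicit Types (x y z : 'rV[R]_n) (mu nu lam tau rho : measure_rV) (K : set 'rV[R]_n).
Local Notation U := (potential alpha).

Lemma null_setC_setD mu (B C : set (Rn R n)) : measurable B -> measurable C ->
  mu (~` B) = 0 -> mu (B `&` C) = 0 -> mu (~` (B `\` C)) = 0.
Proof.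
move=> mB mC muB muC; apply/eqP; rewrite eq_le measure_ge0 andbT.
have mnB : measurable (~` B) by exact: measurableC.
have mBC : measurable (B `&` C) by exact: measurableI.
apply: (@le_trans _ _ (mu (~` B `|` (B `&` C)))).
  apply: le_measure; rewrite ?inE.
  - by apply: measurableC; exact: measurableD.
  - exact: measurableU.
  - move=> x nx; have [Bx|] := pselect (B x); last by left.
    by right; split => //; apply: contrapT => nC; apply: nx.
apply: (@le_trans _ _ (mu (~` B) + mu (B `&` C))); first exact: (measureU2 mu mnB mBC).
by rewrite -[leRHS]adde0; apply: leeD; [exact: eq_lee muB|exact: eq_lee muC].
Qed.

(** The form [U lam + c] covers the Dirac mass, with [c = 0], and the constant 1, with [lam = 0],
    and is the form in which domination applies. Gauss variation gives [f <= U rho] almost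
    everywhere for [rho]; since the energy is at most the integral of [f], equality holds almost
    everywhere, and domination spreads [U rho <= f] from a set carrying [rho] to the whole space. *)
Theorem compact_sweeping K lam (c : R) (phi : 'rV[R]_n -> R) : compact K -> radon lam -> (0 <= c)%R ->
  continuous phi -> (forall x, (0 <= phi x)%R) -> (forall x, K x -> U lam x + c%:E = (phi x)%:E) ->
  exists rho, [/\ carried K rho, forall x, U rho x <= U lam x + c%:E &
    weak_ge alpha K (fun x => U lam x + c%:E) rho].
Proof.
move=> cK rlam c0 cphi phi0 fphi.
have mK : measurable (K : set (Rn R n)) by exact: compact_measurable_rV.
have mphi : measurable_fun [set: Rn R n] (phi : Rn R n -> R) by exact: continuous_measurable_rV.
pose f x := U lam x + c%:E.
have mf : measurable_fun [set: Rn R n] f by apply: emeasurable_funD => //; exact: measurable_potential.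
have f0 x : 0 <= f x by rewrite adde_ge0 ?potential_ge0.
have fE mu : mu (~` K) = 0 -> \int[mu]_x f x = \int[mu]_x (phi x)%:E.
  move=> muK; rewrite (ge0_integral_support mK muK mf f0).
  rewrite [RHS](ge0_integral_support mK muK); last 2 first.
  - exact/measurable_EFinP.
  - by move=> x; rewrite lee_fin.
  by apply: eq_integral => x /[!inE] Kx; exact: fphi.
have [rho [crho Erho Ele hvar]] := gauss_variation alpha_n cK cphi phi0.
have [rfin rK] := crho.
have rr : radon rho by exact: finite_radon.
have mU := measurable_potential alpha_n rr.
have hw : weak_ge alpha K f rho.
  move=> K' tau nK K'K; have [cK' _ tK' _] := nK.
  rewrite fE; first exact: hvar nK K'K.
  apply/eqP; rewrite eq_le measure_ge0 andbT -tK'.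
  apply: le_measure; rewrite ?inE.
  - exact: measurableC.
  - by apply: measurableC; exact: compact_measurable_rV.
  - by move=> x Kx K'x; apply: Kx; exact: K'K.
pose B0 : set (Rn R n) := [set x | U rho x < f x].
have mB0 : measurable B0.
  by rewrite -[X in measurable X]setTI; apply: emeasurable_fun_lt.
have foo x : K x -> f x < +oo by move=> Kx; rewrite /f fphi// ltry.
have rB0 : rho (K `&` B0) = 0.
  apply: (weak_null alpha_n hw) => //.
  - exact: measurableI.
  - by move=> x [Kx /= h]; exact: lt_trans h (foo x Kx).
  - by move=> x [Kx _]; exact: foo.
  - by move=> x [].
pose S : set (Rn R n) := K `\` B0.
have mS : measurable S by exact: measurableD.
have rS : rho (~` S) = 0 by exact: null_setC_setD.
have SfU x : S x -> f x <= U rho x.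
  by move=> [Kx nB]; rewrite leNgt; apply/negP => h; apply: nB.
pose B1 : set (Rn R n) := [set x | f x < U rho x].
have mB1 : measurable B1.
  by rewrite -[X in measurable X]setTI; apply: emeasurable_fun_lt.
have rB1 : rho (S `&` B1) = 0.
  apply: (ge0_integral_le_null mS rS) => //.
  - by move=> x; exact: potential_ge0.
  - by rewrite fE.
  - by rewrite fE// -ge0_fin_numE ?(Phi_fin cK cphi phi0)//; apply: integral_ge0 => x _; rewrite lee_fin.
  - by move=> x [Kx _]; exact: foo.
exists rho; split => //.
apply: (@domination R n alpha alpha0 alpha2 alpha_n rho lam (S `\` B1) c) => //.
- exact: measurableD.
- exact: null_setC_setD.
- move=> x [[Kx _] nB]; apply: le_lt_trans (foo x Kx).
  by rewrite leNgt; apply/negP => h; apply: nB.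
- by move=> x [_ nB]; rewrite leNgt; apply/negP => h; apply: nB.
Qed.

End compact_sweeping.

(** * Exhaustion by compact sets *)

Section swept_measures.
Context {R : realType} {n : nat} (alpha : R) (alpha0 : 0 < alpha) (alpha2 : alpha <= 2)
  (alpha_n : alpha < n%:R).
Local Open Scope ereal_scope.
Notation measure_rV := {measure set (Rn R n) -> \bar R}.
Implicit Types (x y z : 'rV[R]_n) (mu nu lam tau rho sig : measure_rV) (A K : set 'rV[R]_n).
Local Notation U := (potential alpha).

Definition swept K (f : 'rV[R]_n -> \bar R) rho :=
  [/\ carried K rho, forall x, U rho x <= f x & weak_ge alpha K f rho].

Lemma carried_radon K rho : carried K rho -> radon rho.
Proof. by move=> [h _]; exact: finite_radon. Qed.

Lemma swept_ge0 K f rho x : swept K f rho -> 0 <= f x.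
Proof. by move=> [_ h _]; apply: le_trans (h x); exact: potential_ge0. Qed.

Lemma measurable_lt_potential f rho : measurable_fun [set: Rn R n] f -> radon rho ->
  measurable [set x : Rn R n | U rho x < f x].
Proof.
move=> mf rr; rewrite -[X in measurable X]setTI; apply: emeasurable_fun_lt => //.
exact: measurable_potential.
Qed.

(** The weak inequality makes [U rho = f] on [K] outside a set that is null for every finite measure
    on [K] whose potential is finite there. *)
Lemma swept_integral K f rho mu : compact K -> swept K f rho -> measurable_fun [set: Rn R n] f ->
  (forall x, K x -> f x < +oo) -> carried K mu -> (forall x, K x -> U mu x < +oo) ->
  \int[mu]_x f x = \int[mu]_x U rho x.
Proof.
move=> cK sw mf foo [mufin muK] muoo; have [cr Uf hw] := sw.
have mK : measurable (K : set (Rn R n)) by exact: compact_measurable_rV.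
have rr := carried_radon cr; have mU := measurable_potential alpha_n rr.
have mB := measurable_lt_potential mf rr.
have nB : mu (K `&` [set x : Rn R n | U rho x < f x]) = 0.
  apply: (weak_null alpha_n hw) => //.
  - by move=> x; exact: swept_ge0 sw.
  - exact: measurableI.
  - by move=> x [Kx _]; exact: muoo.
  - by move=> x [Kx _]; exact: foo.
  - by move=> x [].
apply/eqP; rewrite eq_le; apply/andP; split; last first.
  by apply: ge0_le_integral => // x _; exact: potential_ge0.
have mD : measurable ((K : set (Rn R n)) `\` [set x : Rn R n | U rho x < f x]) by exact: measurableD.
apply: (ge0_le_integral_support mD) => //; first exact: null_setC_setD.
- by move=> x; exact: swept_ge0 sw.
- by move=> x; exact: potential_ge0.
- by move=> x [_ /= h]; rewrite leNgt; exact/negP.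
Qed.

Lemma swept_swap K f g rho sig : compact K -> swept K f rho -> swept K g sig ->
  measurable_fun [set: Rn R n] f -> measurable_fun [set: Rn R n] g ->
  (forall x, K x -> f x < +oo) -> (forall x, K x -> g x < +oo) ->
  \int[sig]_x f x = \int[rho]_x g x.
Proof.
move=> cK sf sg mf mg foo goo; have [cr Uf _] := sf; have [cs Ug _] := sg.
rewrite (swept_integral cK sf mf foo cs); last by move=> x Kx; exact: le_lt_trans (goo x Kx).
rewrite (swept_integral cK sg mg goo cr); last by move=> x Kx; exact: le_lt_trans (foo x Kx).
by apply: potential_sym => //; [exact: carried_radon cr|exact: carried_radon cs].
Qed.

(** The potential of [rho] is finite on [K], so [rho] does not charge the exceptional set of [lam];
    off this set domination applies. *)
Lemma swept_minimal A K f rho lam : compact K -> K `<=` A -> swept K f rho ->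
  measurable_fun [set: Rn R n] f -> (forall x, K x -> f x < +oo) -> radon lam ->
  ne_on alpha A (fun x => f x <= U lam x) -> forall x, U rho x <= U lam x.
Proof.
move=> cK KA [cr Uf hw] mf foo rlam ne x; rewrite -[leRHS]adde0.
have mK : measurable (K : set (Rn R n)) by exact: compact_measurable_rV.
have mB := measurable_lt_potential mf rlam; have [rfin rK] := cr.
apply: (@domination R n alpha alpha0 alpha2 alpha_n rho lam
  (K `\` [set x : Rn R n | U lam x < f x]) 0%R) => //.
- exact: measurableD.
- apply: null_setC_setD => //; apply: (ne_on_null alpha_n ne) => //.
  + exact: measurableI.
  + by move=> z [/KA].
  + by move=> z [Kz _]; apply: le_lt_trans (Uf z) (foo z Kz).
  + by move=> z [_ /= h] /(lt_le_trans h); rewrite ltxx.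
- by move=> z [Kz _]; apply: le_lt_trans (Uf z) (foo z Kz).
- by move=> z [Kz /= h]; rewrite adde0 (le_trans (Uf z))// leNgt; exact/negP.
Qed.

Lemma potential_dirac y x : U (@dirac _ (Rn R n) y R) x = riesz alpha x y.
Proof.
rewrite /potential integral_dirac//; last exact: measurable_riesz_l.
by rewrite diracT mul1e.
Qed.

Lemma radon_dirac y : radon (@dirac _ (Rn R n) y R).
Proof. by apply: finite_radon; rewrite /= diracE in_setT ltry. Qed.

Lemma potential_mzero x : U mzero x = 0.
Proof. by rewrite /potential integral_measure_zero. Qed.

Lemma exists_swept_dirac K y : compact K -> ~ K y -> exists rho, swept K (riesz alpha ^~ y) rho.
Proof.
move=> cK nKy; have [d d0 dK] := compact_separation cK nKy.
(* Truncating at a radius [d] below the distances from [y] to [K] leaves the kernel unchanged on [K]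
   and makes it continuous. *)
have [] := @compact_sweeping R n alpha alpha0 alpha2 alpha_n K (@dirac _ (Rn R n) y R) 0%R
  (truncated_riesz alpha d y) cK (radon_dirac y) (lexx _) (@continuous_truncated R n alpha alpha_n d y d0).
- by move=> x; exact: truncated_riesz_ge0.
- move=> x Kx; rewrite adde0 potential_dirac rieszC; apply: truncated_riesz_eq; first exact: dK.
  by apply/eqP => yx; apply: nKy; rewrite yx.
- move=> rho [cr Ur hw]; exists rho.
  have E : (fun x => U (@dirac _ (Rn R n) y R) x + 0%:E) = riesz alpha ^~ y.
    by apply/funext => x; rewrite adde0 potential_dirac.
  by split => //; [move=> x; rewrite -(congr1 (@^~ x) E); exact: Ur|rewrite -E].
Qed.

Lemma exists_swept_one K : compact K -> exists rho, swept K (fun=> 1) rho.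
Proof.
move=> cK; have r0 : radon (mzero : measure_rV) by apply: finite_radon; rewrite /mzero ltry.
have [] := @compact_sweeping R n alpha alpha0 alpha2 alpha_n K mzero 1%R (fun=> 1%R) cK r0 ler01.
- exact: cst_continuous.
- by move=> x; exact: ler01.
- by move=> x _; rewrite potential_mzero add0e.
- move=> rho [cr Ur hw]; exists rho.
  have E : (fun x : 'rV[R]_n => U mzero x + 1%:E) = fun=> 1 by apply/funext => x; rewrite potential_mzero add0e.
  by split => //; [move=> x; rewrite -(congr1 (@^~ x) E); exact: Ur|rewrite -E].
Qed.

End swept_measures.

(** * Limits of potentials and mass escaping to infinity *)

Section vague_limits_of_swept_measures.
Context {R : realType} {n : nat} (alpha : R) (alpha0 : 0 < alpha) (alpha2 : alpha <= 2)
  (alpha_n : alpha < n%:R).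
Local Open Scope ereal_scope.
Notation measure_rV := {measure set (Rn R n) -> \bar R}.
Implicit Types (x y z : 'rV[R]_n) (mu nu lam tau sig : measure_rV) (A K : set 'rV[R]_n).
Local Notation U := (potential alpha).

(** On each box the kernel with pole [x] is bounded below, so a bound of the potential at one point
    controls the mass of every box. This yields vague compactness even when the total masses are
    unbounded. *)
Lemma potential_box_bound x (c : R) : exists M : nat -> R, forall rho : measure_rV,
  U rho x <= c%:E -> forall k, rho (box k%:R) <= (M k)%:E.
Proof.
have [j xj] := box_ex x.
pose D k : R := (n%:R * (j%:R + k%:R) + 1)%R.
have D0 k : (0 < D k)%R by rewrite ltr_wpDl// mulr_ge0// addr_ge0.
pose v k : R := (D k `^ (alpha - n%:R))%R.
have v0 k : (0 < v k)%R by exact: powR_gt0.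
exists (fun k => (v k)^-1 * c)%R => rho hc k.
have mb := @measurable_box R n k%:R.
have xz z : box k%:R z -> (v k)%:E <= riesz alpha x z.
  move=> zk; rewrite /riesz; case: eqP => [_|/eqP nxz]; first exact: leey.
  rewrite lee_fin; apply: (powR_neg_le alpha_n); first by rewrite edist_gt0.
  apply: (@le_trans _ _ (n%:R * (j%:R + k%:R))%R); last by rewrite lerDl.
  apply: edist_le; first by rewrite addr_ge0.
  by move=> i; apply: le_trans (ler_normB _ _) _; exact: lerD.
have h : (v k)%:E * rho (box k%:R) <= c%:E.
  apply: le_trans hc; apply: ge0_integral_ge_cst => //.
  - exact: measurable_riesz_l.
  - by move=> z; exact: riesz_ge0.
  - by rewrite lee_fin ltW.
by rewrite EFinM lee_pdivlMl.
Qed.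

Lemma vague_potential_le {I : Type} (F : set_system I) {FF : ProperFilter F} (rho : I -> measure_rV)
    lam x (c : R) : vaguely F rho lam -> (\forall i \near F, U (rho i) x <= c%:E) -> U lam x <= c%:E.
Proof.
move=> [_ _ hphi] hc; rewrite leNgt; apply/negP => /(potential_sup alpha_n)[m].
apply/negP; rewrite -leNgt; apply/lee_addgt0Pr => e e0.
have m0 : (0 < m.+1%:R^-1 :> R)%R by rewrite invr_gt0.
pose phi z : R := (truncated_riesz alpha m.+1%:R^-1 x z * cutoff m z)%R.
have cphi : continuous phi.
  by move=> z; apply: continuousM; [exact: (@continuous_truncated R n alpha alpha_n _ x m0)|exact: continuous_cutoff].
have phi0 z : (0 <= phi z)%R by rewrite mulr_ge0 ?truncated_riesz_ge0 ?cutoff_ge0.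
have phik z : ~ box m.+1%:R z -> phi z = 0%R by move=> nz; rewrite /phi (cutoff0 nz) mulr0.
have mphi : measurable_fun [set: Rn R n] (EFin \o (phi : Rn R n -> R)).
  by apply/measurable_EFinP; exact: continuous_measurable_rV.
have mb := @measurable_box R n m%:R.
have [i [hi [_ h]]] := filter_ex (filterI hc (hphi phi m.+1 cphi phi0 phik e e0)).
apply: (@le_trans _ _ (\int[lam]_z (phi z)%:E)).
  apply: (@le_trans _ _ (\int[lam]_(z in box m%:R) (phi z)%:E)).
    rewrite /truncated_potential (_ : \int[lam]_(z in box m%:R) (phi z)%:E =
      \int[lam]_(z in box m%:R) (truncated_riesz alpha m.+1%:R^-1 x z)%:E)//.
    by apply: eq_integral => z /set_mem zm; rewrite /phi (cutoff1 zm) mulr1.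
  by apply: ge0_subset_integral => // z _; rewrite lee_fin.
apply: (le_trans h); apply: leeD => //; apply: le_trans hi.
apply: ge0_le_integral => //.
- by move=> z _; rewrite lee_fin.
- exact: measurable_riesz_l.
- move=> z _; apply: le_trans (truncated_riesz_le alpha_n x z m0).
  by rewrite lee_fin ler_piMr ?truncated_riesz_ge0 ?cutoff_le1.
Qed.

(** [U tau] is continuous but not compactly supported. On a box it is replaced by a cut-off version,
    whose integrals converge; [r0] records what the complement of large boxes may contribute in the
    limit. *)
Lemma vague_potential_integral {I : Type} (F : set_system I) {FF : ProperFilter F}
    (rho : I -> measure_rV) lam K tau (r : \bar R) (r0 : R) :
  vaguely F rho lam -> nice_on alpha K tau ->
  (\forall i \near F, r <= \int[rho i]_x U tau x) ->
  (forall e : R, (0 < e)%R -> exists T : nat, \forall i \near F,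
     \int[rho i]_(x in ~` box T%:R) U tau x <= (r0 + e)%:E) ->
  r <= \int[tau]_x U lam x + r0%:E.
Proof.
move=> [rlam _ hphi] [cK tfin tK [g cg gE]] hr hT.
have rtau : radon tau by exact: finite_radon.
have mU := measurable_potential alpha_n rtau.
apply/lee_addgt0Pr => e e0.
have e20 : (0 < e / 2)%R by rewrite divr_gt0.
have [T hT'] := hT _ e20.
have g0 x : (0 <= g x)%R by rewrite -lee_fin -gE; exact: potential_ge0.
pose phi x : R := (g x * cutoff T x)%R.
have cphi : continuous phi by move=> z; apply: continuousM; [exact: cg|exact: continuous_cutoff].
have phi0 z : (0 <= phi z)%R by rewrite mulr_ge0 ?cutoff_ge0.
have phik z : ~ box T.+1%:R z -> phi z = 0%R by move=> nz; rewrite /phi (cutoff0 nz) mulr0.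
have mphi : measurable_fun [set: Rn R n] (EFin \o (phi : Rn R n -> R)).
  by apply/measurable_EFinP; exact: continuous_measurable_rV.
have mb := @measurable_box R n T%:R.
have [i [hi1 [hi2 [hi3 _]]]] := filter_ex (filterI hr (filterI hT' (hphi phi T.+1 cphi phi0 phik _ e20))).
apply: (le_trans hi1).
rewrite (ge0_integral_splitC (rho i) mb mU (fun x => potential_ge0 alpha tau x)).
have h1 : \int[rho i]_(x in box T%:R) U tau x <= \int[tau]_x U lam x + (e / 2)%:E.
  apply: (@le_trans _ _ (\int[rho i]_x (phi x)%:E)).
    rewrite (_ : \int[rho i]_(x in box T%:R) U tau x = \int[rho i]_(x in box T%:R) (phi x)%:E).
      by apply: ge0_subset_integral => // z _; rewrite lee_fin.
    by apply: eq_integral => z /set_mem zT; rewrite gE /phi (cutoff1 zT) mulr1.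
  apply: (le_trans hi3); apply: leeD => //.
  rewrite (potential_sym alpha_n rlam rtau); apply: ge0_le_integral => //.
  - by move=> z _; rewrite lee_fin.
  - by move=> z _; rewrite gE lee_fin ler_piMr ?cutoff_le1.
apply: le_trans (leeD h1 hi2) _.
rewrite -addeA -[leRHS]addeA; apply: leeD2l; rewrite -!EFinD lee_fin.
by rewrite addrCA -splitr.
Qed.

Lemma nice_tail_mass {I : Type} (F : set_system I) {FF : ProperFilter F} (rho : I -> measure_rV)
    K tau (m e : R) : nice_on alpha K tau -> (forall i, rho i setT <= m%:E) -> (0 < e)%R ->
  exists T : nat, \forall i \near F, \int[rho i]_(x in ~` box T%:R) U tau x <= (0 + e)%:E.
Proof.
move=> nK hm e0.
have m0 : (0 <= m)%R by have [i _] := filter_ex (@filterT _ F _); rewrite -lee_fin; exact: le_trans (hm i).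
have em0 : (0 < e / (m + 1))%R by rewrite divr_gt0// ltr_wpDl.
have [T hT] := nice_decay alpha_n nK em0; exists T; near=> i.
have mb := measurableC (@measurable_box R n T%:R); have [cK tfin tK _] := nK.
have mU := measurable_potential alpha_n (finite_radon tfin).
apply: (@le_trans _ _ (\int[rho i]_(x in ~` box T%:R) (e / (m + 1))%:E)).
  apply: ge0_le_integral => //.
  - by move=> z _; exact: potential_ge0.
  - exact: measurable_funTS.
  - by move=> z /hT /ltW.
rewrite integral_cst// add0r; apply: (@le_trans _ _ ((e / (m + 1))%:E * m%:E)).
  apply: lee_wpmul2l; first by rewrite lee_fin ltW.
  by apply: le_trans (hm i); apply: le_measure; rewrite ?inE.
by rewrite -EFinM lee_fin mulrAC ler_pdivrMr ?ltr_wpDl// ler_wpM2l ?(ltW e0)// lerDl.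
Unshelve. all: end_near. Qed.

(** Seen from far away, [tau] acts like a point mass placed at any fixed [x0], because the ratio of
    the distances to [x0] and to the points of [K] tends to 1. *)
Lemma potential_far K tau x0 (e : R) : nice_on alpha K tau -> (0 < e)%R -> exists T : nat,
  forall z, ~ box T%:R z -> U tau z <= ((1 + e) * fine (tau setT))%:E * riesz alpha x0 z.
Proof.
move=> [cK tfin tK _] e0; have mK := compact_measurable_rV cK.
have [k Kk] := compact_sub_box cK; have [j xj] := box_ex x0.
have p0 : (alpha - n%:R < 0)%R by rewrite subr_lt0.
(* [th < 1] is the ratio of distances with [th^(alpha-n) = 1 + e]. With [D] a bound for the distance
   from [x0] to [K], the inequality [th (r + D) <= r] holds once [r >= S], so distances to [K] are
   at least [th] times the distance to [x0]. *)
pose th : R := ((1 + e) `^ (alpha - n%:R)^-1)%R.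
have th0 : (0 < th)%R by rewrite powR_gt0// addr_gt0.
have thE : (th `^ (alpha - n%:R) = 1 + e)%R by rewrite -powRrM mulVf ?lt_eqF// powRr1// ltW// addr_gt0.
have th1 : (th < 1)%R.
  rewrite ltNge; apply/negP => /(powR_neg_le alpha_n ltr01); rewrite powR1 thE.
  by rewrite gerDl leNgt e0.
pose D : R := (n%:R * (j%:R + k%:R))%R.
have D0 : (0 <= D)%R by rewrite mulr_ge0// addr_ge0.
pose S : R := (th * D / (1 - th) + 1)%R.
have S0 : (0 < S)%R by rewrite ltr_wpDl// divr_ge0// ?mulr_ge0 ?subr_ge0// ltW.
exists (maxn j (k + Num.bound S))%N => z hz.
have nzx : z != x0.
  apply/eqP => zx; apply: hz; rewrite zx; move: xj; apply: le_box.
  by rewrite ler_nat leq_maxl.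
have tf : tau setT \is a fin_num by rewrite ge0_fin_numE.
have d0 : (0 < edist z x0)%R by rewrite edist_gt0.
have hS w : K w -> (th * edist z x0 <= edist z w)%R.
  move=> /Kk wk; have : (S <= edist z w)%R.
    apply: (out_box_edist wk) => h; apply: hz; move: h; apply: le_box.
    apply: (@le_trans _ _ (k + Num.bound S)%:R); last by rewrite ler_nat leq_maxr.
    by rewrite natrD lerD2l ltW// archi_boundP// ltW.
  have : (edist z x0 <= edist z w + D)%R.
    apply: le_trans (edist_triangle z w x0) _; rewrite lerD2l; apply: edist_le; first by rewrite addr_ge0.
    by move=> i; rewrite (addrC j%:R); apply: le_trans (ler_normB _ _) _; exact: lerD.
  move=> h1 h2; apply: (@le_trans _ _ (th * (edist z w + D))%R); first by rewrite ler_pM2l.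
  rewrite mulrDr -lerBrDl -[X in (X - _)%R]mul1r -mulrBl [leRHS]mulrC -ler_pdivrMr ?subr_gt0//.
  by apply: le_trans h2; rewrite lerDl.
have := @potential_le_support R n alpha alpha_n tau K (th * edist z x0)%R z mK tK (mulr_gt0 th0 d0) hS.
move=> /le_trans; apply.
rewrite powRM ?(ltW th0) ?(ltW d0)// thE rieszC /riesz (negbTE nzx) -(fineK tf) -!EFinM lee_fin.
by rewrite fineK// mulrAC.
Qed.

(** Far away [U tau] is nearly the mass of [tau] times the kernel with pole [x0], and the integral
    of that kernel against [rho i] is the potential of [rho i] at [x0]. A bound at one point thus
    takes the place of a bound on masses. *)
Lemma nice_tail_potential {I : Type} (F : set_system I) {FF : ProperFilter F} (rho : I -> measure_rV)
    K tau x0 (q e : R) : nice_on alpha K tau -> (forall i, U (rho i) x0 <= q%:E) -> (0 < e)%R ->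
  exists T : nat, \forall i \near F,
    \int[rho i]_(x in ~` box T%:R) U tau x <= (fine (tau setT) * q + e)%:E.
Proof.
move=> nK hq e0; have [cK tfin tK _] := nK.
have M0 : (0 <= fine (tau setT))%R by rewrite fine_ge0.
have q0 : (0 <= q)%R.
  by have [i _] := filter_ex (@filterT _ F _); rewrite -lee_fin; apply: le_trans (hq i); exact: potential_ge0.
set M := fine (tau setT) in M0 *.
have d0 : (0 < e / (M * q + 1))%R by rewrite divr_gt0// ltr_wpDl// mulr_ge0.
have [T hT] := potential_far x0 nK d0; exists T; near=> i.
have mb := measurableC (@measurable_box R n T%:R).
have mU := measurable_potential alpha_n (finite_radon tfin).
have c0 : (0 <= (1 + e / (M * q + 1)) * M)%R by rewrite mulr_ge0// addr_ge0// ltW.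
have mr := measurable_riesz_l alpha_n x0.
apply: (@le_trans _ _ (\int[rho i]_(x in ~` box T%:R) (((1 + e / (M * q + 1)) * M)%:E * riesz alpha x0 x))).
  apply: ge0_le_integral => //.
  - by move=> z _; exact: potential_ge0.
  - exact: measurable_funTS.
  - by apply: measurable_funTS; exact: measurable_funeM.
rewrite ge0_integralZl//; [|exact: measurable_funTS|by move=> z _; exact: riesz_ge0].
apply: (@le_trans _ _ (((1 + e / (M * q + 1)) * M)%:E * q%:E)).
  apply: lee_wpmul2l; first by rewrite lee_fin.
  apply: le_trans (hq i); apply: ge0_subset_integral => // z _; exact: riesz_ge0.
rewrite -EFinM lee_fin -mulrA mulrDl mul1r lerD2l.
by rewrite mulrAC ler_pdivrMr ?ltr_wpDl ?mulr_ge0// ler_wpM2l ?(ltW e0)// lerDl.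
Unshelve. all: end_near. Qed.

(** [U lam] is averaged over the law [N] centred at [x0] with a large [rho]. The part of [lam] in a
    large box contributes little because [U N] is uniformly small by then, and the part outside
    contributes at most its share of the finite integral [U lam x0]. A lower bound [q] of [U lam]
    would be one of the average too. *)
Lemma potential_inf0 lam (q : R) : Mplus alpha lam -> (0 < q)%R -> exists x, U lam x < q%:E.
Proof.
move=> [rlam [x0 Ux0]] q0; apply: contrapT => hn.
have hq x : q%:E <= U lam x by rewrite leNgt; apply/negP => h; apply: hn; exists x.
have [b [C1 [C2 [C3 [m [[_ _ C20 _ _] heat]]]]]] := heat_approximation alpha0 alpha2 alpha_n.
have [c _ hN] := heat x0.
have Uf : U lam x0 \is a fin_num by rewrite ge0_fin_numE ?potential_ge0// ltey; exact/eqP.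
have [k hk] : exists k, (fine (U lam x0) - q / 2)%:E < truncated_potential alpha lam k x0.
  apply: (potential_sup alpha_n); rewrite -[ltRHS]fineK// lte_fin ltrBlDr ltrDl divr_gt0//.
have mb := @measurable_box R n k%:R; have mnb := measurableC mb.
have mr := measurable_riesz_l alpha_n x0.
have k0 : (0 < k.+1%:R^-1 :> R)%R by rewrite invr_gt0.
have htail : \int[lam]_(z in ~` box k%:R) riesz alpha x0 z <= (q / 2)%:E.
  have hsp := ge0_integral_splitC lam mb mr (riesz_ge0 alpha x0).
  have h1 : (fine (U lam x0) - q / 2)%:E < \int[lam]_(z in box k%:R) riesz alpha x0 z.
    apply: (lt_le_trans hk); apply: ge0_le_integral => //.
    - by move=> z _; rewrite lee_fin truncated_riesz_ge0.
    - by apply: measurable_funTS; apply/measurable_EFinP; exact: measurable_truncated_riesz_l.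
    - exact: measurable_funTS.
    - by move=> z _; exact: truncated_riesz_le.
  have i0 : 0 <= \int[lam]_(z in ~` box k%:R) riesz alpha x0 z by apply: integral_ge0 => z _; exact: riesz_ge0.
  move: h1 i0 hsp; rewrite -/(U lam x0).
  case: (\int[lam]_(z in box k%:R) _) => [u| |]; case: (\int[lam]_(z in ~` box k%:R) _) => [v| |] //=.
  - by move=> h1 _ h2; move: h1; rewrite h2 /= lte_fin lee_fin; lra.
have L0 : (0 <= fine (lam (box k%:R)))%R by rewrite fine_ge0.
have Lf : lam (box k%:R) \is a fin_num by rewrite ge0_fin_numE//; apply: rlam; exact: compact_box.
set L := fine (lam (box k%:R)) in L0.
have p0 : ((alpha - n%:R) / 2 < 0)%R by rewrite ltr_pdivrMr// mul0r subr_lt0.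
have CL0 : (0 <= C2 * L)%R by exact: mulr_ge0.
have [T T0 hT] := powR_cvg_infty p0 (divr_gt0 (divr_gt0 q0 (ltr0n R 4)) (ltr_wpDl CL0 ltr01)).
have [N [N1 Nle _ NC _]] := hN T T0.
have rN : radon N by apply: finite_radon; rewrite N1 ltry.
have : q%:E <= \int[N]_x U lam x.
  rewrite -[leLHS]mule1 -N1; apply: ge0_integral_ge_cst => //.
  - exact: measurable_potential.
  - by move=> x; exact: potential_ge0.
  - by rewrite lee_fin ltW.
rewrite (potential_sym alpha_n rlam rN) (ge0_integral_splitC lam mb (measurable_potential alpha_n rN) (potential_ge0 alpha N)).
apply/negP; rewrite -ltNge.
have h1 : \int[lam]_(z in box k%:R) U N z <= (q / 4)%:E.
  apply: (@le_trans _ _ (\int[lam]_(z in box k%:R) (C2 * T `^ ((alpha - n%:R) / 2))%:E)).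
    apply: ge0_le_integral => //.
    - by move=> z _; exact: potential_ge0.
    - by apply: measurable_funTS; exact: measurable_potential.
  rewrite integral_cst// -(fineK Lf) -EFinM lee_fin -/L.
  apply: (@le_trans _ _ (C2 * L * (q / 4 / (C2 * L + 1)))%R); first by rewrite mulrAC ler_wpM2l.
  by rewrite mulrCA mulrA ler_pdivrMr ?ltr_wpDl// ler_wpM2l ?lerDl// divr_ge0 ?ltW.
have h2 : \int[lam]_(z in ~` box k%:R) U N z <= (q / 2)%:E.
  apply: le_trans htail; apply: ge0_le_integral => //.
  - by move=> z _; exact: potential_ge0.
  - by apply: measurable_funTS; exact: measurable_potential.
  - exact: measurable_funTS.
apply: le_lt_trans (leeD h1 h2) _; rewrite -EFinD lte_fin; lra.
Qed.

End vague_limits_of_swept_measures.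

(** * Exhaustion of an arbitrary set by compact subsets *)

Section compact_exhaustion.
Context {R : realType} {n : nat} (alpha : R) (alpha0 : 0 < alpha) (alpha2 : alpha <= 2)
  (alpha_n : alpha < n%:R).
Local Open Scope ereal_scope.
Notation measure_rV := {measure set (Rn R n) -> \bar R}.
Implicit Types (x y z : 'rV[R]_n) (mu nu lam tau sig : measure_rV) (A K : set 'rV[R]_n).
Local Notation U := (potential alpha).

Definition compact_subset A : Type := {K : set 'rV[R]_n | compact K /\ K `<=` A}.

Definition exhausting A (F : set_system (compact_subset A)) :=
  forall K, compact K -> K `<=` A -> \forall L \near F, K `<=` sval L.

(** The families of all compact [L] containing a given [K] form a filter base, since a union of two
    compact subsets is again one. An arbitrary [A] need not have an exhausting sequence, whence the
    net. *)
Lemma exhausting_ultrafilter A : exists F : set_system (compact_subset A), UltraFilter F /\ exhausting F.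
Proof.
pose F0 : set_system (compact_subset A) :=
  [set P | exists K : compact_subset A, forall L : compact_subset A, sval K `<=` sval L -> P L].
have FF : ProperFilter F0.
  split; first by move=> [K /(_ K (@subset_refl _ _))].
  split.
  - by exists (exist _ set0 (conj compact0 (@sub0set _ A))).
  - move=> P Q [[K [cK KA]] hK] [[L [cL LA]] hL].
    have KLA : K `|` L `<=` A by move=> z [/KA|/LA].
    exists (exist _ (K `|` L) (conj (compactU cK cL) KLA)) => M /= KLM; split.
      by apply: hK; apply: subset_trans KLM => z; left.
    by apply: hL; apply: subset_trans KLM => z; right.
  - by move=> P Q PQ [K hK]; exists K => L /hK /PQ.
have [F [UF F0F]] := @ultraFilterLemma _ F0 FF; exists F; split => // K cK KA.
by apply: F0F; exists (exist _ K (conj cK KA)).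
Qed.

Section swept_net.
Context (A : set 'rV[R]_n) (F : set_system (compact_subset A)) {FF : ProperFilter F}
  (exF : exhausting F) (f : 'rV[R]_n -> \bar R) (mf : measurable_fun [set: Rn R n] f)
  (foo : forall x, A x -> f x < +oo) (rho : compact_subset A -> measure_rV)
  (rhoP : forall L, swept alpha (sval L) f (rho L)).

(** As soon as [L] contains [K], [f] and [U (rho L)] have the same integral against [tau]; symmetry
    then moves the potential onto [tau], where it is continuous. *)
Lemma swept_net_integral K tau : nice_on alpha K tau -> K `<=` A ->
  \forall L \near F, \int[tau]_x f x <= \int[rho L]_x U tau x.
Proof.
move=> [cK tfin tK [g _ gE]] KA; near=> L.
have KL : K `<=` sval L by near: L; exact: exF.
have [cL LA] := svalP L; have cr : carried (sval L) (rho L) by have [] := rhoP L.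
have ct : carried (sval L) tau.
  split => //; apply/eqP; rewrite eq_le measure_ge0 andbT -tK.
  apply: le_measure; rewrite ?inE.
  - by apply: measurableC; exact: compact_measurable_rV.
  - by apply: measurableC; exact: compact_measurable_rV.
  - by apply: subsetC.
rewrite (swept_integral alpha_n cL (rhoP L) mf (fun x Lx => foo (LA x Lx)) ct).
  by rewrite (potential_sym alpha_n (carried_radon cr) (finite_radon tfin)).
by move=> x _; rewrite gE ltry.
Unshelve. all: end_near. Qed.

Lemma swept_limit_mass lam (m : R) : (forall L, rho L setT <= m%:E) -> vaguely F rho lam ->
  weak_ge alpha A f lam.
Proof.
move=> hm hv K tau nK KA; rewrite -[leRHS]adde0.
apply: (@vague_potential_integral _ _ _ alpha_n _ F FF rho lam K tau _ 0%R hv nK (swept_net_integral nK KA)).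
move=> e e0; exact: (nice_tail_mass alpha_n nK hm e0).
Qed.

Lemma swept_limit_potential lam x0 (q : R) : (forall L, U (rho L) x0 <= q%:E) -> vaguely F rho lam ->
  forall K tau, nice_on alpha K tau -> K `<=` A ->
  \int[tau]_x f x <= \int[tau]_x U lam x + (fine (tau setT) * q)%:E.
Proof.
move=> hq hv K tau nK KA.
apply: (@vague_potential_integral _ _ _ alpha_n _ F FF rho lam K tau _ _ hv nK (swept_net_integral nK KA)).
move=> e e0; exact: (nice_tail_potential alpha_n nK hq e0).
Qed.

Lemma swept_limit_exists {UF : UltraFilter F} x0 (c : R) : f x0 <= c%:E -> exists lam, vaguely F rho lam.
Proof.
move=> fc; have [M hM] := potential_box_bound alpha_n x0 c.
apply: (@vague_compactness R n _ F UF rho M) => k K; apply: hM; apply: le_trans fc.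
by have [_ h _] := rhoP K.
Qed.

Lemma swept_limit_le lam : vaguely F rho lam -> forall x, U lam x <= f x.
Proof.
move=> hv x; have [K0 _] := filter_ex (@filterT _ F _).
have f0 : 0 <= f x by exact: swept_ge0 (rhoP K0).
case Ef : (f x) f0 => [c| |] // _; last exact: leey.
apply: (vague_potential_le alpha_n hv); near=> K.
by have [_ h _] := rhoP K; rewrite -Ef.
Unshelve. all: end_near. Qed.

End swept_net.

End compact_exhaustion.

(** * Balayage, equilibrium measure and total mass *)

Section inner_balayage.
Context {R : realType} {n : nat} (alpha : R) (alpha0 : 0 < alpha) (alpha2 : alpha <= 2)
  (alpha_n : alpha < n%:R).
Local Open Scope ereal_scope.
Notation measure_rV := {measure set (Rn R n) -> \bar R}.
Implicit Types (x y z : 'rV[R]_n) (mu nu lam tau sig : measure_rV) (A K : set 'rV[R]_n).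
Local Notation U := (potential alpha).

Definition potentials_above A (f : 'rV[R]_n -> \bar R) : set measure_rV :=
  [set lam | Mplus alpha lam /\ ne_on alpha A (fun z => f z <= U lam z)].

(** Common form of [is_equilibrium], with [f] the constant 1, and of [is_balayage], with [f] the
    potential of the measure to be swept. *)
Definition infimal A f nu :=
  Mplus alpha nu /\ forall x, U nu x = ereal_inf [set U lam x | lam in potentials_above A f].

Lemma infimal_le A f nu lam x : infimal A f nu -> potentials_above A f lam -> U nu x <= U lam x.
Proof. by move=> [_ ->] h; apply: ereal_inf_lbound; exists lam. Qed.

Lemma infimal_ge A f nu x (c : \bar R) : infimal A f nu ->
  (forall lam, potentials_above A f lam -> c <= U lam x) -> c <= U nu x.
Proof. by move=> [_ ->] h; apply: le_ereal_inf_tmp => _ [lam hlam <-]; exact: h. Qed.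

Lemma infimal_minimum A f lam : potentials_above A f lam ->
  (forall lam', potentials_above A f lam' -> forall x, U lam x <= U lam' x) -> infimal A f lam.
Proof.
move=> hlam h; split; first by have [] := hlam.
move=> x; apply/eqP; rewrite eq_le; apply/andP; split.
  by apply: le_ereal_inf_tmp => _ [lam' hlam' <-]; exact: h.
by apply: ereal_inf_lbound; exists lam.
Qed.

Lemma infimal_nonempty A f nu : infimal A f nu -> potentials_above A f !=set0.
Proof.
move=> [[_ [x Ux]] /(_ x) E]; apply: contrapT => h; apply: Ux; rewrite E.
rewrite (_ : [set _ | _ in _] = set0) ?ereal_inf0//.
by rewrite -subset0 => u [lam hlam _]; apply: h; exists lam.
Qed.

Lemma Mplus_potential_le lam f x (c : R) : radon lam -> (forall z, U lam z <= f z) -> f x = c%:E ->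
  Mplus alpha lam.
Proof.
move=> rlam h fx; split => //; exists x => /= E; have := h x; by rewrite E fx leye_eq.
Qed.

Lemma dirac_potentials_above A y : potentials_above A (riesz alpha ^~ y) (@dirac _ (Rn R n) y R).
Proof.
have n0 : (0 < n)%N by rewrite -(ltr_nat R); exact: lt_trans alpha_n.
split; first split.
- exact: radon_dirac.
- exists (y + const_mx 1)%R; rewrite potential_dirac// /riesz ifF//.
  apply/negbTE; apply/eqP => /matrixP/(_ ord0 (Ordinal n0)).
  by rewrite !mxE => /eqP; rewrite -subr_eq0 addrAC subrr add0r oner_eq0.
- apply: (@ne_onI R n alpha alpha_n A y) => K tau [_ _ tK _] _ _ KP.
  have K0 : K = set0.
    by rewrite -subset0 => x /KP; apply; rewrite potential_dirac.
  by rewrite -tK K0 setC0.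
Qed.

Section fixed_point.
Context (A : set 'rV[R]_n) (y : 'rV[R]_n) (nu : measure_rV) (nuP : infimal A (riesz alpha ^~ y) nu).
Let A' := A `\ y.
Context (F : set_system (compact_subset A')) (UF : UltraFilter F) (exF : exhausting F)
  (rho sig : compact_subset A' -> measure_rV)
  (rhoP : forall L, swept alpha (sval L) (riesz alpha ^~ y) (rho L))
  (sigP : forall L, swept alpha (sval L) (fun=> 1) (sig L)).
Let FF : ProperFilter F := @ultra_proper _ _ UF.

Let mkernel : measurable_fun [set: Rn R n] (riesz alpha ^~ y).
Proof. exact: measurable_riesz_r. Qed.

Let kernel_fin x : x <> y -> riesz alpha x y < +oo.
Proof. by move=> /eqP xy; rewrite /riesz (negbTE xy) ltry. Qed.

Let kernel_finA' x : A' x -> riesz alpha x y < +oo.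
Proof. by move=> [_ xy]; exact: kernel_fin. Qed.

Let sub_A (L : compact_subset A') : sval L `<=` A.
Proof. by move=> x Lx; have [_ /(_ _ Lx) []] := svalP L. Qed.

Let compact_sval (L : compact_subset A') : compact (sval L).
Proof. by have [] := svalP L. Qed.

Lemma swept_mass_potential L : rho L setT = U (sig L) y.
Proof.
have finA' x : sval L x -> riesz alpha x y < +oo.
  by move=> Lx; apply: kernel_finA'; have [_ h] := svalP L; exact: h.
rewrite -[LHS]mul1e -integral_cst//.
have <- := swept_swap alpha_n (@compact_sval L) (rhoP L) (sigP L) mkernel
  (measurable_cst 1) finA' (fun x _ => ltry 1).
by apply: eq_integral => x _; exact: rieszC.
Qed.

(** By domination [rho L] has a potential below that of every competitor, hence below their infimum
    [U nu]; positivity of mass concludes. *)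
Lemma swept_mass_le L : rho L setT <= nu setT.
Proof.
have [rnu _] := proj1 nuP; have [cr _ _] := rhoP L.
apply: (mass_comparison alpha0 alpha2 alpha_n (carried_radon cr) rnu) => x.
apply: (infimal_ge nuP) => lam [[rlam _] ne].
apply: (swept_minimal alpha0 alpha2 alpha_n (@compact_sval L) (@sub_A L) (rhoP L)) => // z Lz.
by apply: kernel_finA'; have [_ h] := svalP L; exact: h.
Qed.

Lemma balayage_mass_le1 : nu setT <= 1.
Proof.
have [rnu _] := proj1 nuP.
have := mass_comparison alpha0 alpha2 alpha_n rnu (radon_dirac y).
rewrite /= diracE in_setT; apply => x.
exact: infimal_le nuP (dirac_potentials_above A y).
Qed.

(** A vague limit may lose mass at infinity but cannot gain any, so the bound passes to the limit
    [lam]; being admissible, [lam] has a potential, hence a mass, at least that of [nu]. *)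
Lemma balayage_mass_le (m : R) : (forall L, rho L setT <= m%:E) -> nu setT <= m%:E.
Proof.
move=> hm; have [rnu _] := proj1 nuP.
have [[_ [x1]]] := dirac_potentials_above A y; rewrite potential_dirac// => /eqP x1oo _.
have rf : riesz alpha x1 y \is a fin_num by rewrite ge0_fin_numE ?riesz_ge0// ltey.
have hc : riesz alpha x1 y <= (fine (riesz alpha x1 y))%:E by rewrite fineK.
have [lam hv] := @swept_limit_exists _ _ _ alpha_n _ F _ rho rhoP UF x1 _ hc.
have [rlam _ _] := hv.
have hw := @swept_limit_mass _ _ _ alpha_n _ F FF exF _ mkernel kernel_finA' rho rhoP lam m hm hv.
have Ul := @swept_limit_le _ _ _ alpha_n _ F FF _ rho rhoP lam hv.
have lamP : potentials_above A (riesz alpha ^~ y) lam.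
  split; first exact: (Mplus_potential_le rlam Ul (esym (fineK rf))).
  by apply: (weak_ne alpha_n hw) => // x; exact: riesz_ge0.
apply: (@le_trans _ _ (lam setT)).
  by apply: (mass_comparison alpha0 alpha2 alpha_n rnu rlam) => x; exact: infimal_le nuP lamP.
by apply: (@vague_mass _ _ _ F FF rho lam m hv); near=> L; exact: hm.
Unshelve. all: end_near. Qed.

Context (lam1 : measure_rV) (hv : vaguely F sig lam1).
Let rlam1 : radon lam1. Proof. by have [] := hv. Qed.

Lemma swept_one_limit_Mplus : Mplus alpha lam1.
Proof.
apply: (@Mplus_potential_le lam1 (fun=> 1) y 1%R) => //.
exact: (@swept_limit_le _ _ _ alpha_n _ F FF _ sig sigP lam1 hv).
Qed.

Let mone : measurable_fun [set: Rn R n] (fun=> 1 : \bar R). Proof. exact: measurable_cst. Qed.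

Lemma swept_one_le lam L x : potentials_above A (fun=> 1) lam -> U (sig L) x <= U lam x.
Proof.
move=> [[rlam _] ne].
exact: (swept_minimal alpha0 alpha2 alpha_n (@compact_sval L) (@sub_A L) (sigP L) mone
  (fun z _ => ltry 1) rlam ne).
Qed.

(** An admissible potential takes arbitrarily small values, at [x0] say, and dominates there the
    potentials of all [sig L]. The escaping mass then adds to the test integral at most the mass of
    [tau] times that value, which is below [e]. *)
Lemma swept_one_limit_above lam : potentials_above A (fun=> 1) lam -> potentials_above A (fun=> 1) lam1.
Proof.
move=> hlam; split; first exact: swept_one_limit_Mplus.
apply: (@weak_ne R n alpha alpha_n A y (fun=> 1) lam1) => //; last by move=> x _; exact: ltry.
move=> K tau nK KA; apply/lee_addgt0Pr => e e0.
have [cK tfin tK _] := nK.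
have M0 : (0 <= fine (tau setT))%R by rewrite fine_ge0.
have [x0 hx0] := potential_inf0 alpha0 alpha2 alpha_n (proj1 hlam) (divr_gt0 e0 (ltr_wpDl M0 ltr01)).
have := @swept_limit_potential _ _ _ alpha_n _ F FF exF (fun=> 1) mone (fun x _ => ltry 1) sig sigP lam1 x0 _
  (fun L => le_trans (swept_one_le L x0 hlam) (ltW hx0)) hv K tau nK KA.
move=> /le_trans; apply; apply: leeD2l; rewrite lee_fin mulrCA.
by rewrite ler_piMr ?(ltW e0)// ler_pdivrMr ?ltr_wpDl// mul1r lerDl.
Qed.

Lemma swept_one_limit_infimal lam : potentials_above A (fun=> 1) lam -> infimal A (fun=> 1) lam1.
Proof.
move=> hlam; apply: infimal_minimum; first exact: swept_one_limit_above hlam.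
move=> lam' hlam' x; case E : (U lam' x) (potential_ge0 alpha lam' x) => [c| |] // _; last exact: leey.
apply: (@vague_potential_le R n alpha alpha_n _ F FF sig lam1 x c hv); near=> L.
by rewrite -E; exact: swept_one_le.
Unshelve. all: end_near. Qed.

(** The mass of [rho L] is [U (sig L) y]. It is at most the mass of [nu], and this bound passes to
    [U lam1 y]; conversely [U (sig L) y <= U lam1 y] for all [L] bounds the mass of [nu]. Infimal
    measures for the constant 1 share their potential, so [lam1] may stand for [lam]. *)
Lemma balayage_mass_equilibrium lam : infimal A (fun=> 1) lam -> nu setT = U lam y.
Proof.
move=> hlam; have [lam' hlam'] := infimal_nonempty hlam.
have hl1 := swept_one_limit_infimal hlam'.
have E : U lam y = U lam1 y by rewrite (proj2 hlam) (proj2 hl1).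
have nuf : nu setT \is a fin_num.
  by rewrite ge0_fin_numE//; apply: le_lt_trans balayage_mass_le1 (ltry _).
have h1 : U lam1 y <= nu setT.
  rewrite -(fineK nuf); apply: (@vague_potential_le R n alpha alpha_n _ F FF sig lam1 y _ hv).
  by near=> L; rewrite (fineK nuf) -swept_mass_potential; exact: swept_mass_le.
have lf : U lam1 y \is a fin_num.
  by rewrite ge0_fin_numE ?potential_ge0//; apply: le_lt_trans h1 _; rewrite -ge0_fin_numE.
apply/eqP; rewrite eq_le E h1 andbT -(fineK lf); apply: balayage_mass_le => L.
by rewrite (fineK lf) swept_mass_potential; exact: swept_one_le (swept_one_limit_above hlam').
Unshelve. all: end_near. Qed.

(* A mass defect of the balayage bounds the potentials of [sig] at [y] by [q < 1]; far away they then
   contribute at most [q] times the mass of a test measure, so [lam1 / (1 - q)] is admissible. *)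
Lemma balayage_mass_defect : nu setT < 1 -> infimal A (fun=> 1) lam1.
Proof.
move=> nu1; have nuf : nu setT \is a fin_num by rewrite ge0_fin_numE//; apply: lt_trans nu1 (ltry _).
pose q := fine (nu setT); have q1 : (q < 1)%R by rewrite -lte_fin fineK.
have hq L : U (sig L) y <= q%:E by rewrite -swept_mass_potential fineK//; exact: swept_mass_le.
have c0 : (0 <= (1 - q)^-1)%R by rewrite invr_ge0 subr_ge0 ltW.
pose c := NngNum c0.
have rc : radon (mscale c lam1 : measure_rV).
  by move=> K cK; rewrite /= /mscale lte_mul_pinfty// ?lee_fin//; exact: rlam1.
apply: (@swept_one_limit_infimal (mscale c lam1)); split.
  apply: (@Mplus_potential_le _ (fun=> ((1 - q)^-1)%:E) y (1 - q)^-1%R) => // z.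
  rewrite potential_mscale//= -[leRHS]mule1; apply: lee_wpmul2l; first by rewrite lee_fin.
  exact: (@swept_limit_le _ _ _ alpha_n _ F FF _ sig sigP lam1 hv z).
apply: (@weak_ne R n alpha alpha_n A y (fun=> 1) (mscale c lam1)) => //; last by move=> x _; exact: ltry.
move=> K tau nK KA; have [cK tfin tK _] := nK.
have tf : tau setT \is a fin_num by rewrite ge0_fin_numE.
have := @swept_limit_potential _ _ _ alpha_n _ F FF exF (fun=> 1) mone (fun x _ => ltry 1) sig sigP lam1 y q
  hq hv K tau nK KA.
have mU := measurable_potential alpha_n rlam1.
under [X in _ -> _ <= X]eq_integral do rewrite potential_mscale//.
rewrite (ge0_integralZl tau measurableT mU (fun x _ => potential_ge0 alpha lam1 x))/= ?lee_fin//.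
rewrite integral_cst// mul1e -(fineK tf); set I := \int[tau]_x U lam1 x.
have : 0 <= I by apply: integral_ge0 => x _; exact: potential_ge0.
have q1' : (0 < 1 - q)%R by rewrite subr_gt0.
case: I => [u| |] // _; last by move=> _; rewrite gt0_muley ?leey// lte_fin invr_gt0.
(* With [M] the mass of [tau], the limit inequality reads [M <= u + M q], that is
   [(1 - q) M <= u]. *)
rewrite -EFinD -EFinM !lee_fin ler_pdivlMl// => h.
by rewrite mulrBl mul1r lerBlDr mulrC.
Qed.

End fixed_point.

End inner_balayage.

Theorem mainTheorem3 (R : realType) (n : nat) (alpha : R)
  (hn : (3 <= n)%N) (ha0 : 0 < alpha) (ha2 : alpha <= 2)
  (A : set 'rV[R]_n) (y : 'rV[R]_n)
  (eyA : {measure set (Rn R n) -> \bar R})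
  (heyA : is_balayage alpha A (@dirac _ (Rn R n) y R) eyA) :
  (forall g : {measure set (Rn R n) -> \bar R},
      is_equilibrium alpha A g -> eyA setT = potential alpha g y) /\
  (~ thin_at_infinity alpha A -> eyA setT = 1%E).
Proof.
have alpha_n : alpha < n%:R by apply: le_lt_trans ha2 _; rewrite ltr_nat.
have kE : potential alpha (@dirac _ (Rn R n) y R) = riesz alpha ^~ y.
  by apply/funext => x; exact: potential_dirac.
have nuP : infimal alpha A (riesz alpha ^~ y) eyA by move: heyA; rewrite /is_balayage kE.
have [F [UF exF]] := exhausting_ultrafilter (A `\ y).
have compactL (L : compact_subset (A `\ y)) : compact (sval L) by have [] := svalP L.
have nLy (L : compact_subset (A `\ y)) : ~ sval L y by have [_ h] := svalP L => /h [_]; apply.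
have [rho rhoP] := choice (fun L => exists_swept_dirac ha0 ha2 alpha_n (compactL L) (nLy L)).
have [sig sigP] := choice (fun L => exists_swept_one ha0 ha2 alpha_n (compactL L)).
(* The potentials of all [sig L] are at most 1 at [y], which bounds the masses of boxes and so
   provides a vague limit. *)
have [lam1 hv] := swept_limit_exists alpha_n sigP (x0 := y) (lexx 1%:E).
split=> [g hg|nthin].
  exact: (balayage_mass_equilibrium ha0 ha2 alpha_n nuP UF exF rhoP sigP hv hg).
apply/eqP; rewrite eq_le (balayage_mass_le1 ha0 ha2 alpha_n nuP) leNgt; apply/negP => h.
apply: nthin; exists lam1.
exact: (balayage_mass_defect ha0 ha2 alpha_n nuP UF exF rhoP sigP hv h).
Qed.
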